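(* Let Assumptions 0, 1, 2, 3 (see context) hold. There exist $\rho_f>0$ and $\rho_u>0$ such that the following holds for every mesh and every $f\in\mathcal U_\#(\mathcal L)$ with $|f|_{-1,\infty}<\rho_f$. The coarse-grained problem with exact summation of the external force $$\text{find } u_h^0\in\mathcal U_{h,\#}(\mathcal L):\qquad \langle \delta\Phi^0(Du_h^0),Dv_h\rangle_{\mathcal L}=\langle f,v_h\rangle_{\mathcal L}\quad\forall v_h\in\mathcal U_{h,\#}(\mathcal L)$$ has a solution $u_h^0$ with $|u_h^0|_{1,\infty}<\rho_u$, and this solution is unique among functions with $|u_h^0|_{1,\infty}<\rho_u$. Moreover, let $u$ be the solution of the atomistic equilibrium problem $\langle\delta E(u),v\rangle_{\mathcal L}=\langle f,v\rangle_{\mathcal L}$ for all $v\in\mathcal U_\#(\mathcal L)$ that lies in the ball $\{u\in\mathcal U_\#(\mathcal L):|u-\epsilon\chi^\epsilon_*|_{1,\infty}<\rho_u\}$ (it exists and is unique there), and let $u_h^{\rm c}:=\mathcal I_\#\big(u_h^0+\epsilon\chi^\epsilon(Du_h^0)\big)$. Then $$|u_h^{\rm c}-u|_{1,\infty}\le \mathrm{Const}\big(c_0,C_\Phi^{(1,1)}\big)\,\|hf\|_\infty .$$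
   Context: Lattices. Fix positive integers $p$, $R$ and a positive multiple $N$ of $p$; $\epsilon=1/N$, $\mathcal L=\{\epsilon,2\epsilon,\dots,N\epsilon\}$, $\mathcal P=\{1,\dots,p\}$. $\mathcal U(\mathcal L)$ is the space of functions $u:\epsilon\mathbb Z\to\mathbb R$ with $u(x+1)=u(x)$ (note $\epsilon N=1$); $\langle u\rangle_{\mathcal L}=\frac1N\sum_{x\in\mathcal L}u(x)$, $\langle u,v\rangle_{\mathcal L}=\langle uv\rangle_{\mathcal L}$, $\mathcal U_\#(\mathcal L)=\{u\in\mathcal U(\mathcal L):\langle u\rangle_{\mathcal L}=0\}$, $\mathcal I_\# u=u-\langle u\rangle_{\mathcal L}$. $D_ru(x)=\frac{u(x+r\epsilon)-u(x)}{r\epsilon}$, $D=D_1$. Likewise $\mathcal U(\mathcal P)$ is the space of $p$-periodic functions $\mathbb Z\to\mathbb R$, $\langle\eta\rangle_{\mathcal P}=\frac1p\sum_{y=1}^p\eta(y)$, $\mathcal U_\#(\mathcal P)$ its zero-mean subspace, $D_{y,r}\eta(y)=\frac{\eta(y+r)-\eta(y)}{r}$, $D_y=D_{y,1}$. Norms: $\|u\|_q=\langle|u|^q\rangle^{1/q}$, $\|u\|_\infty=\max|u|$, $|u|_{m,q}=\|D^mu\|_q$ for integers $m\ge0$ (with $D_y$ on $\mathcal P$), $|u|_{-1,\infty}=\sup\{\langle u,v\rangle: v\in\mathcal U_\#,\ |v|_{1,1}=1\}$. Suprema over empty sets are $0$, infima over empty sets are $+\infty$. Potentials. For $1\le r\le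 R$ and $y\in\mathbb Z$ ($p$-periodically in $y$) $\Phi_r(\cdot;y)$ is a real function of one real variable on an open interval; $\delta\Phi_r,\delta^2\Phi_r$ are its first and second derivatives in that variable. $\Phi_r^\epsilon(z;x)=\Phi_r(z;x/\epsilon)$. The energy is $E(u)=\big\langle\sum_{r=1}^R\Phi_r^\epsilon(D_ru(x);x)\big\rangle_{x\in\mathcal L}$ and $\langle\delta E(u),v\rangle_{\mathcal L}=\frac{d}{dt}E(u+tv)|_{t=0}$. Assumptions. There are $\chi_*\in\mathcal U_\#(\mathcal P)$ and $\rho_\Phi>0$ with: (0) $y\mapsto y+\chi_*(y)$ is strictly increasing on $\mathbb Z$. (1) For all $r,y$, $\Phi_r(\cdot;y)$ is defined on the interval of radius $\rho_\Phi$ about $D_{y,r}\chi_*(y)$ and is $C^{2,1}$ there (second derivative Lipschitz). (2) $\sum_{r=1}^R\langle\delta\Phi_r(D_{y,r}\chi_*(y);y),D_{y,r}\eta(y)\rangle_{y\in\mathcal P}=0$ for all $\eta\in\mathcal U_\#(\mathcal P)$. (3) $\frac12\min_y\delta^2\Phi_1(D_{y,1}\chi_*(y);y)-\sum_{r=2}^R\max_y|\delta^2\Phi_r(D_{y,r}\chi_*(y);y)|>0$. Homogenization. $\rho_z,\rho_\chi>0$ are fixed, sufficiently small (with $\rho_\chi$ bounded by an absolute constant), so that for $|z|<\rho_z$ there is a unique $\chi(z)=\chi(z;\cdot)\in\mathcal U_\#(\mathcal P)$ with $|\chi(z)-\chi_*|_{1,\infty}<\rho_\chi$ and $\sum_{r=1}^R\langle\delta\Phi_r(z+D_{y,r}\chi(z;y);y),D_{y,r}\eta(y)\rangle_{y\in\mathcal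 P}=0$ for all $\eta\in\mathcal U_\#(\mathcal P)$; $\chi(0)=\chi_*$. $\Phi^0(z)=\sum_{r=1}^R\langle\Phi_r(z+D_{y,r}\chi(z;y);y)\rangle_{y\in\mathcal P}$ for $|z|<\rho_z$, and $\delta\Phi^0,\delta^2\Phi^0$ are its derivatives. $\chi^\epsilon(z;x)=\chi(z;x/\epsilon)$, $\chi_*^\epsilon(x)=\chi_*(x/\epsilon)$; $\chi^\epsilon(Du)$ is the function $x\mapsto\chi^\epsilon(Du(x);x)$. Constants. $c_0>0$ is a coercivity constant, i.e. a number (it exists by Assumption 3) such that: $\inf_{\eta\in\mathcal U_\#(\mathcal P),|\eta|_{1,\infty}=1}\sup_{\zeta\in\mathcal U_\#(\mathcal P),|\zeta|_{1,1}=1}\sum_{r=1}^R\langle\delta^2\Phi_r(D_{y,r}\chi_*;y)D_{y,r}\eta,D_{y,r}\zeta\rangle_{\mathcal P}\ge2c_0$; $\inf_{w\in\mathcal U_\#(\mathcal L),|w|_{1,\infty}=1}\sup_{v\in\mathcal U_\#(\mathcal L),|v|_{1,1}=1}\sum_{r=1}^R\langle\delta^2\Phi^\epsilon_r(D_r(\epsilon\chi^\epsilon_* ))D_rw,D_rv\rangle_{\mathcal L}\ge2c_0$; and $\inf_{|w|_{1,\infty}=1}\sup_{|v|_{1,1}=1}\langle\delta^2\Phi^0(0)Dw,Dv\rangle_{\mathcal L}\ge2c_0$, $\delta^2\Phi^0(0)\ge2c_0$. $|\cdot|_{C^{0,1}}$ is the smallest Lipschitz constant. $C_\Phi^{(1,1)}=\max_{y\in\mathcal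 P}\sum_{r=1}^R r\,|\delta\Phi_r(\cdot;y)|_{C^{0,1}}$ (Lipschitz constants on the intervals of Assumption 1). ''$\mathrm{Const}(a_1,\dots,a_k)$'' denotes a constant that may depend on $a_1,\dots,a_k$; it does not depend on $N$, the mesh or $f$ ($p$ and $R$ are fixed parameters of the problem). Mesh. $\mathcal N_h\subset\mathcal L$ is a nonempty set of nodes, extended $1$-periodically. Elements $T\in\mathcal T_h$ are $T=\epsilon\mathbb Z\cap[\xi,\eta)$ for consecutive nodes $\xi<\eta$ (modulo period), with $h_T=\eta-\xi$; $h\in\mathcal U(\mathcal L)$ is defined by $h(x)=h_T$ for $x\in T$. $\mathcal U_h(\mathcal L)=\{u\in\mathcal U(\mathcal L): Du(\xi-\epsilon)=Du(\xi)\ \forall\xi\in\mathcal L\setminus\mathcal N_h\}$ (piecewise affine functions), $\mathcal U_{h,\#}(\mathcal L)=\mathcal U_h(\mathcal L)\cap\mathcal U_\#(\mathcal L)$. *)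

(* Defs.v *)
From HB Require Import structures.
From mathcomp Require Import all_boot all_order all_algebra.
From mathcomp Require Import all_classical all_reals all_analysis.

Set Implicit Arguments.
Unset Strict Implicit.
Unset Printing Implicit Defensive.

Import Order.TTheory GRing.Theory Num.Theory.
Import numFieldNormedType.Exports.
Local Open Scope ring_scope.
Local Open Scope classical_set_scope.

(** A function on the lattice [e Z] is encoded as a function [int -> R] of the
    site number [i], standing for the site [x = i * e].  The macroscopic lattice
    has period [n = N] and spacing [e = 1/N]; the unit cell has period [n = p]
    and spacing [e = 1].  Thus [x / eps] is just [i], and one set of definitions
    serves both lattices. *)

Definition periodic (R : realType) (n : nat) (u : int -> R) : Prop :=
  forall i : int, u (i + n%:Z) = u i.

Definition avg (R : realType) (n : nat) (u : int -> R) : R :=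
  n%:R^-1 * \sum_(1 <= k < n.+1) u k%:Z.

Definition zero_mean (R : realType) (n : nat) : set (int -> R) :=
  [set u | periodic n u /\ avg n u = 0].

Definition recenter (R : realType) (n : nat) (u : int -> R) : int -> R :=
  fun i => u i - avg n u.

Definition diffq (R : realType) (e : R) (r : nat) (u : int -> R) : int -> R :=
  fun i => (u (i + r%:Z) - u i) / (r%:R * e).

Definition norm_1 (R : realType) (n : nat) (u : int -> R) : R :=
  avg n (fun i => `|u i|).

Definition norm_oo (R : realType) (n : nat) (u : int -> R) : R :=
  \big[Num.max/0]_(1 <= k < n.+1) `|u k%:Z|.

Definition seminorm_1_1 (R : realType) (n : nat) (e : R) (u : int -> R) : R :=
  norm_1 n (diffq e 1 u).

Definition seminorm_1_oo (R : realType) (n : nat) (e : R) (u : int -> R) : R :=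
  norm_oo n (diffq e 1 u).

(** For [n = 1] the set is empty, and [sup set0 = 0]. *)
Definition seminorm_m1_oo (R : realType) (n : nat) (e : R) (f : int -> R) : R :=
  sup [set s | exists2 v : int -> R,
         zero_mean n v /\ seminorm_1_1 n e v = 1 &
         s = avg n (fun i => f i * v i)].

(** Extended-real valued because the infimum over the empty set is [+oo]. *)
Definition inf_sup (R : realType) (n : nat) (e : R)
    (B : (int -> R) -> (int -> R) -> R) : \bar R :=
  ereal_inf [set s | exists2 w : int -> R,
    zero_mean n w /\ seminorm_1_oo n e w = 1 &
    s = (sup [set t | exists2 v : int -> R,
                zero_mean n v /\ seminorm_1_1 n e v = 1 & t = B w v])%:E].

(** [Phi r y z] is the potential [Phi_r(z; y)].  Potentials are total functions
    of [z]; only their values on the intervals of [regular_potentials] matter. *)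

Definition energy (R : realType) (rmax N : nat) (Phi : nat -> int -> R -> R)
    (u : int -> R) : R :=
  avg N (fun i => \sum_(1 <= r < rmax.+1) Phi r i (diffq N%:R^-1 r u i)).

Definition energy_variation (R : realType) (rmax N : nat)
    (Phi : nat -> int -> R -> R) (u v : int -> R) : R :=
  derive1 (fun t : R => energy rmax N Phi (fun i => u i + t * v i)) 0.

(** [F r y] is the strain at which [Phi r y] is evaluated. *)
Definition cell_work (R : realType) (p rmax : nat) (Phi : nat -> int -> R -> R)
    (F : nat -> int -> R) (eta : int -> R) : R :=
  \sum_(1 <= r < rmax.+1)
    avg p (fun y => derive1 (Phi r y) (F r y) * diffq 1 r eta y).

Definition hessian_form (R : realType) (rmax n : nat) (e : R)
    (Phi : nat -> int -> R -> R) (F : nat -> int -> R) (w v : int -> R) : R :=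
  \sum_(1 <= r < rmax.+1)
    avg n (fun i =>
      derive1n 2 (Phi r i) (F r i) * diffq e r w i * diffq e r v i).

Definition periodic_potentials (R : realType) (p rmax : nat)
    (Phi : nat -> int -> R -> R) : Prop :=
  forall (r : nat) (y : int), (1 <= r <= rmax)%N ->
    Phi r (y + p%:Z) = Phi r y.

Definition increasing_positions (R : realType) (chi_star : int -> R) : Prop :=
  forall y y' : int, y < y' -> y%:~R + chi_star y < y'%:~R + chi_star y'.

Definition regular_potentials (R : realType) (rmax : nat)
    (Phi : nat -> int -> R -> R) (chi_star : int -> R) (rho_Phi : R) : Prop :=
  forall (r : nat) (y : int), (1 <= r <= rmax)%N ->
    (forall z : R, ball (diffq 1 r chi_star y) rho_Phi z ->
       derivable (Phi r y) z 1 /\ derivable (derive1 (Phi r y)) z 1) /\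
    (exists k : R,
       k.-lipschitz_(ball (diffq 1 r chi_star y) rho_Phi) (derive1n 2 (Phi r y))).

Definition equilibrium (R : realType) (p rmax : nat)
    (Phi : nat -> int -> R -> R) (chi_star : int -> R) : Prop :=
  forall eta : int -> R, zero_mean p eta ->
    cell_work p rmax Phi (fun r y => diffq 1 r chi_star y) eta = 0.

(** [inf] is the minimum of a nonempty finite set here. *)
Definition stable (R : realType) (p rmax : nat)
    (Phi : nat -> int -> R -> R) (chi_star : int -> R) : Prop :=
  0 < 2^-1 * inf [set s | exists2 y : nat, (1 <= y <= p)%N &
                    s = derive1n 2 (Phi 1%N y%:Z) (diffq 1 1 chi_star y%:Z)]
      - \sum_(2 <= r < rmax.+1) \big[Num.max/0]_(1 <= y < p.+1)
          `|derive1n 2 (Phi r y%:Z) (diffq 1 r chi_star y%:Z)|.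

Definition lipschitz_const (R : realType) (A : set R) (g : R -> R) : R :=
  inf [set k : R | 0 <= k /\ k.-lipschitz_A g].

Definition C_Phi_11 (R : realType) (p rmax : nat)
    (Phi : nat -> int -> R -> R) (chi_star : int -> R) (rho_Phi : R) : R :=
  \big[Num.max/0]_(1 <= y < p.+1) \sum_(1 <= r < rmax.+1)
    r%:R * lipschitz_const (ball (diffq 1 r chi_star y%:Z) rho_Phi)
             (derive1 (Phi r y%:Z)).

Definition cell_solution (R : realType) (p rmax : nat)
    (Phi : nat -> int -> R -> R) (chi_star : int -> R) (rho_chi z : R)
    (chi : int -> R) : Prop :=
  [/\ zero_mean p chi,
      seminorm_1_oo p 1 (fun y => chi y - chi_star y) < rho_chi &
      forall eta : int -> R, zero_mean p eta ->
        cell_work p rmax Phi (fun r y => z + diffq 1 r chi y) eta = 0].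

(** [rho_z + rho_chi <= rho_Phi] keeps every strain [z + D_{y,r} chi(y)] that
    occurs inside the interval where [Phi r y] is defined. *)
Definition homogenization_map (R : realType) (p rmax : nat)
    (Phi : nat -> int -> R -> R) (chi_star : int -> R)
    (rho_Phi rho_z rho_chi : R) (chi : R -> int -> R) : Prop :=
  [/\ 0 < rho_z, 0 < rho_chi, rho_z + rho_chi <= rho_Phi &
      forall z : R, `|z| < rho_z ->
        unique (cell_solution p rmax Phi chi_star rho_chi z) (chi z)].

Definition Phi0 (R : realType) (p rmax : nat) (Phi : nat -> int -> R -> R)
    (chi : R -> int -> R) (z : R) : R :=
  \sum_(1 <= r < rmax.+1) avg p (fun y => Phi r y (z + diffq 1 r (chi z) y)).

(** [eps chi_*^eps] as a function of the site number. *)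
Definition scaled_chi_star (R : realType) (N : nat) (chi_star : int -> R) :
    int -> R :=
  fun i => N%:R^-1 * chi_star i.

Definition homogenized_form (R : realType) (N : nat) (a : R)
    (w v : int -> R) : R :=
  avg N (fun i => a * diffq N%:R^-1 1 w i * diffq N%:R^-1 1 v i).

Definition coercivity_constant (R : realType) (p rmax N : nat)
    (Phi : nat -> int -> R -> R) (chi_star : int -> R) (chi : R -> int -> R)
    (c0 : R) : Prop :=
  let eps : R := N%:R^-1 in
  let d2Phi0 : R := derive1n 2 (Phi0 p rmax Phi chi) 0 in
  [/\ 0 < c0,
      ((2 * c0)%:E <= inf_sup p 1
         (hessian_form rmax p 1 Phi (fun r y => diffq 1 r chi_star y)))%E,
      ((2 * c0)%:E <= inf_sup N eps
         (hessian_form rmax N eps Phi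
            (fun r i => diffq eps r (scaled_chi_star N chi_star) i)))%E,
      ((2 * c0)%:E <= inf_sup N eps
         (homogenized_form N d2Phi0))%E &
      2 * c0 <= d2Phi0].

(** The node set is given by site numbers, already extended periodically. *)
Definition is_mesh (N : nat) (nodes : set int) : Prop :=
  nodes !=set0 /\ forall i : int, nodes (i + N%:Z) <-> nodes i.

Definition consecutive_nodes (nodes : set int) (a b : int) : Prop :=
  [/\ nodes a, nodes b, a < b & forall c : int, a < c < b -> ~ nodes c].

(** Every site lies in exactly one element [[a, b)], so this determines [h]. *)
Definition is_mesh_size (R : realType) (N : nat) (nodes : set int)
    (h : int -> R) : Prop :=
  forall a b : int, consecutive_nodes nodes a b ->
    forall i : int, a <= i < b -> h i = (b - a)%:~R / N%:R.

Definition coarse_space (R : realType) (N : nat) (nodes : set int) :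
    set (int -> R) :=
  [set u | zero_mean N u /\
     forall i : int, ~ nodes i ->
       diffq N%:R^-1 1 u (i - 1) = diffq N%:R^-1 1 u i].

Definition coarse_solution (R : realType) (p rmax N : nat)
    (Phi : nat -> int -> R -> R) (chi : R -> int -> R) (nodes : set int)
    (f : int -> R) (uh : int -> R) : Prop :=
  coarse_space N nodes uh /\
  forall vh : int -> R, coarse_space N nodes vh ->
    avg N (fun i => derive1 (Phi0 p rmax Phi chi) (diffq N%:R^-1 1 uh i)
                    * diffq N%:R^-1 1 vh i)
    = avg N (fun i => f i * vh i).

Definition atomistic_solution (R : realType) (rmax N : nat)
    (Phi : nat -> int -> R -> R) (f : int -> R) (u : int -> R) : Prop :=
  zero_mean N u /\
  forall v : int -> R, zero_mean N v ->
    energy_variation rmax N Phi u v = avg N (fun i => f i * v i).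

Definition corrected (R : realType) (N : nat) (chi : R -> int -> R)
    (uh : int -> R) : int -> R :=
  recenter N (fun i => uh i + N%:R^-1 * chi (diffq N%:R^-1 1 uh i) i).

(* Main.v *)
(** Written for the strain [D u], every equilibrium problem here says that a
    stress field equals a given load up to a constant, where a load [g] is an
    antidifference of the force.  By Assumption 3 the stress is strongly monotone
    in the following pointwise sense: the difference of two stresses, taken at a
    maximum minus at a minimum of the zero-mean difference [Z] of the strains, is
    at least [2 c |Z|_oo].  This yields uniqueness, and existence because it keeps
    the energy minimizer over a small box away from the boundary.  The same
    statement solves the cell problem, the atomistic problem and, with one
    nearest-neighbour potential [Phi0] and the element averages of [g] as load,
    the coarse-grained problem.

    The derivative of [Phi0] is the constant stress of the cell solution; this
    only needs that [chi] is Lipschitz, since its variation is killed by the cell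
    problem.  The jumps of [D u_h^0] are bounded by jumps of that stress, that is,
    by the jumps of the averaged load, hence by [|h f|_oo / c0].  Therefore the
    strain of the corrected solution is, near each site, within [O(|h f|_oo)] of
    the cell strain with frozen macroscopic strain, its stress is within
    [O(|h f|_oo)] of the load, and coercivity of the atomistic stress with
    constant [c0] gives the estimate.  The radii depend on the
    potentials but not on [c0], because [2 c0] bounds the
    inf-sup constants of the linearized problems from below while the error of
    linearization is at most the intrinsic constant [c]. *)
Require Import Defs.
From HB Require Import structures.
From mathcomp Require Import all_boot all_order all_algebra.
From mathcomp Require Import all_classical all_reals all_analysis.
From mathcomp Require Import zify ring lra.
Require Import Defs.
Import Order.TTheory GRing.Theory Num.Theory.
Import numFieldNormedType.Exports.
Local Open Scope ring_scope.
Local Open Scope classical_set_scope.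

Set Implicit Arguments.
Unset Strict Implicit.
Unset Printing Implicit Defensive.

(** * Periodic functions on the integers *)

(** The order of the quantifiers shapes the proof. [Const] precedes the potentials and may see only
    [c0] and [C_Phi_11], whereas the radii precede [N] and [c0]. Two coercivity constants therefore
    run in parallel: [c] for the radii and for solvability, and [c0] for the error bound, which is
    why the Lipschitz bound on the correctors is proved for an arbitrary coercivity constant. The
    map [chi] is known only through uniqueness, with no regularity in [z]. The total expression
    [derive1n 2] of [Phi0] at 0 carries information only once that derivative is shown to exist. A
    Cauchy criterion for difference quotients of the homogenized stress gives strict
    differentiability at 0, and this replaces continuity of the second derivative of [Phi0]. Passing
    to strains loses nothing: every zero-mean periodic field is the difference quotient of a
    zero-mean function. Differences of two Kronecker spikes are thus test strains, and they turn
    weak equations into pointwise ones and the norm of [f] into a bound on the oscillation of the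
    load. *)

Section PeriodicFunctions.
Context {R : realType} (n : nat).
Implicit Types u v : int -> R.

Lemma periodicMz u : periodic n u -> forall (m i : int), u (i + m * n%:Z) = u i.
Proof.
move=> pu; have H (k : nat) i : u (i + k%:Z * n%:Z) = u i.
  elim: k i => [|k IH] i; first by rewrite mul0r addr0.
  by rewrite (_ : i + k.+1%:Z * n%:Z = i + k%:Z * n%:Z + n%:Z) ?pu ?IH //; lia.
move=> [k|k] i; first exact: H.
by rewrite -(H k.+1 (i + Negz k * n%:Z)); congr u; lia.
Qed.

Lemma periodic_modz u i : periodic n u -> u (i %% n%:Z)%Z = u i.
Proof.
by move=> pu; rewrite [in RHS](divz_eq i n%:Z) addrC periodicMz.
Qed.

Lemma periodic_ord u (P : R -> Prop) : (0 < n)%N -> periodic n u ->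
  (forall k : 'I_n, P (u k%:Z)) -> forall i, P (u i).
Proof.
move=> n0 pu H i; rewrite -(periodic_modz i pu).
have l : (`|(i %% n%:Z)%Z| < n)%N by lia.
by have := H (Ordinal l); rewrite /= (_ : _%:Z = (i %% n%:Z)%Z) //; lia.
Qed.

Lemma periodic_shift u c : periodic n u -> periodic n (fun i => u (i + c)).
Proof. by move=> pu i; rewrite addrAC pu. Qed.

Definition psum u : R := \sum_(k < n) u k%:Z.

Lemma psum_shift u c : periodic n u -> psum (fun i => u (i + c)) = psum u.
Proof.
move=> pu; have H1 v : periodic n v -> psum (fun i => v (i + 1)) = psum v.
  move=> pv; rewrite /psum; case: n pv => [|m] pv; first by rewrite !big_ord0.
  rewrite big_ord_recr /= [RHS]big_ord_recl /= addrC; congr (_ + _).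
    by rewrite -[RHS]pv; congr v; lia.
  by apply: eq_bigr => i _; congr v; rewrite /bump /=; lia.
have H (k : nat) v : periodic n v -> psum (fun i => v (i + k%:Z)) = psum v.
  elim: k v => [|k IH] v pv.
    by apply: eq_bigr => i _; rewrite addr0.
  rewrite -[RHS]H1 // -[RHS]IH; last exact: periodic_shift.
  by apply: eq_bigr => i _; congr v; lia.
case: c => k; first exact: H.
rewrite -(H k.+1); last exact: periodic_shift.
by apply: eq_bigr => i _; congr u; lia.
Qed.

(** Periodicity allows the window 1..n of [avg] to be replaced by 0..n-1, the range of ['I_n]. *)
Lemma avgE u : periodic n u -> avg n u = n%:R^-1 * psum u.
Proof.
move=> pu; rewrite /avg; congr (_ * _).
rewrite big_add1 /= big_mkord -(psum_shift 1 pu).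
by apply: eq_bigr => i _; congr u; lia.
Qed.

Lemma psum_ext u v : u =1 v -> psum u = psum v.
Proof. by move=> e; apply: eq_bigr => i _; rewrite e. Qed.

Lemma psumD u v : psum (fun i => u i + v i) = psum u + psum v.
Proof. exact: big_split. Qed.

Lemma psumZ c u : psum (fun i => c * u i) = c * psum u.
Proof. by rewrite /psum mulr_sumr. Qed.

Lemma psumN u : psum (fun i => - u i) = - psum u.
Proof. by rewrite /psum sumrN. Qed.

Lemma psumB u v : psum (fun i => u i - v i) = psum u - psum v.
Proof. by rewrite psumD psumN. Qed.

Lemma psum_const c : psum (fun=> c) = n%:R * c.
Proof. by rewrite /psum sumr_const card_ord mulr_natl. Qed.

Lemma ler_norm_psum u c : (forall i, `|u i| <= c) -> `|psum u| <= n%:R * c.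
Proof.
move=> H; apply: (le_trans (ler_norm_sum _ _ _)).
by rewrite -psum_const; apply: ler_sum.
Qed.

Lemma psum_by_parts u v : periodic n u -> periodic n v ->
  psum (fun i => (u (i + 1) - u i) * v i)
  = - psum (fun i => u i * (v i - v (i - 1))).
Proof.
move=> pu pv; rewrite -psumN.
have -> : psum (fun i => (u (i + 1) - u i) * v i) =
    psum (fun i => u (i + 1) * v (i + 1 - 1)) - psum (fun i => u i * v i).
  by rewrite -psumB; apply: psum_ext => i; rewrite addrK mulrBl.
rewrite (@psum_shift (fun i => u i * v (i - 1)) 1).
  by rewrite -psumB; apply: psum_ext => i; rewrite mulrBr opprB.
by move=> i; rewrite pu addrAC pv.
Qed.

Lemma ge_norm_oo u i : (0 < n)%N -> periodic n u -> `|u i| <= norm_oo n u.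
Proof.
move=> n0 pu; have [m lm ->] : exists2 m, (1 <= m < n.+1)%N & u i = u m%:Z.
  (* [norm_oo] runs over 1..n, so residue 0 is represented by the site [n]. *)
  case: (posnP `|(i %% n%:Z)%Z|%N) => e; [exists n; first by rewrite n0 /= | exists `|(i %% n%:Z)%Z|%N].
  - by rewrite -(periodic_modz i pu) -[RHS](periodicMz pu (- 1)); congr u; lia.
  - by lia.
  - by rewrite -(periodic_modz i pu); congr u; lia.
rewrite /norm_oo; apply: (@le_bigmax_seq _ _ _ _ 0 m xpredT (fun k : nat => `|u k%:Z|)) => //.
by rewrite mem_index_iota.
Qed.

Lemma norm_oo_le u c : 0 <= c -> (forall i, `|u i| <= c) -> norm_oo n u <= c.
Proof. by move=> c0 H; rewrite /norm_oo; elim/big_ind: _ => // x y xc yc; rewrite ge_max xc. Qed.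

Lemma norm_oo_lt u c : 0 < c -> (forall i, `|u i| < c) -> norm_oo n u < c.
Proof. by move=> c0 H; rewrite /norm_oo; elim/big_ind: _ => // x y xc yc; rewrite gt_max xc. Qed.

Lemma norm_oo_ge0 u : 0 <= norm_oo n u.
Proof. by rewrite /norm_oo; elim/big_ind: _ => // x y xc yc; rewrite le_max xc. Qed.

Lemma zero_meanP u : (0 < n)%N -> zero_mean n u <-> periodic n u /\ psum u = 0.
Proof.
move=> n0; rewrite /zero_mean /=; split => -[pu]; rewrite avgE // => H; split=> //.
  move/eqP: H; rewrite mulf_eq0 invr_eq0 pnatr_eq0 gtn_eqF //= => /eqP //.
by rewrite H mulr0.
Qed.

End PeriodicFunctions.

Lemma periodic_dvd (R : realType) (p n : nat) (u : int -> R) :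
  (p %| n)%N -> periodic p u -> periodic n u.
Proof. by move=> /dvdnP[k ->] pu i; rewrite PoszM (periodicMz pu). Qed.

(** * Strains and stresses *)

(** By [diffq_amean] this is the [r]-th neighbour strain when [G] is the nearest-neighbour strain.
    Being a mean, it does not increase maximum norms, so long ranges cost no factor [r]. *)
Definition amean (R : realType) (r : nat) (G : int -> R) (i : int) : R :=
  r%:R^-1 * \sum_(k < r) G (i + k%:Z).

(* The first variation: [psum_stress] turns [<dE(u), v>] into
   [<stress (D u), D v>], so that equilibria have a stress which differs from an
   antidifference of the force by a constant. *)
Definition stress (R : realType) (rmax : nat) (dPhi : nat -> int -> R -> R)
    (G : int -> R) (i : int) : R :=
  \sum_(1 <= r < rmax.+1)
    r%:R^-1 * \sum_(k < r) dPhi r (i - k%:Z) (amean r G (i - k%:Z)).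

(** The [n]-periodic Kronecker delta at [k]. *)
Definition spike (R : realType) (n : nat) (k i : int) : R :=
  (n%:Z %| i - k)%Z%:R.

Section StrainFields.
Context {R : realType}.
Implicit Types (u v G H V : int -> R) (r n : nat) (e : R).

Lemma diffq1E e u i : diffq e 1 u i = (u (i + 1) - u i) / e.
Proof. by rewrite /diffq mul1r. Qed.

Lemma diffq_amean e r u i : (0 < r)%N ->
  diffq e r u i = amean r (diffq e 1 u) i.
Proof.
move=> r0; rewrite /amean /diffq invfM mulrCA; congr (_ * _).
under eq_bigr do rewrite mul1r.
rewrite -mulr_suml; congr (_ * _).
rewrite -(big_mkord xpredT (fun k => u (i + k%:Z + 1) - u (i + k%:Z))).
rewrite (eq_bigr (fun k : nat => u (i + k.+1%:Z) - u (i + k%:Z))).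
  by rewrite (@telescope_sumr _ 0 r (fun k => u (i + k%:Z))) // addr0.
by move=> k _; congr (u _ - _); lia.
Qed.

Lemma ameanD r G H i : amean r (fun j => G j + H j) i = amean r G i + amean r H i.
Proof. by rewrite /amean big_split mulrDr. Qed.

Lemma ameanZ r c G i : amean r (fun j => c * G j) i = c * amean r G i.
Proof. by rewrite /amean -mulr_sumr mulrCA. Qed.

Lemma ameanB r G H i : amean r (fun j => G j - H j) i = amean r G i - amean r H i.
Proof. by rewrite /amean sumrB mulrBr. Qed.

Lemma amean_const r (c : R) i : (0 < r)%N -> amean r (fun=> c) i = c.
Proof.
by move=> r0; rewrite /amean sumr_const card_ord -[c *+ r]mulr_natl mulKf // pnatr_eq0 -lt0n.
Qed.

Lemma amean_ext r G H i : G =1 H -> amean r G i = amean r H i.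
Proof. by move=> e; rewrite /amean; congr (_ * _); apply: eq_bigr => k _. Qed.

Lemma amean1 G i : amean 1 G i = G i.
Proof. by rewrite /amean big_ord_recl big_ord0 invr1 mul1r addr0 addr0. Qed.

Lemma norm_window_mean r (F : 'I_r -> R) (c : R) : (0 < r)%N ->
  (forall k, `|F k| <= c) -> `|r%:R^-1 * \sum_(k < r) F k| <= c.
Proof.
move=> r0 H; rewrite normrM ger0_norm ?invr_ge0 ?ler0n //.
rewrite mulrC ler_pdivrMr ?ltr0n //.
apply: (le_trans (ler_norm_sum _ _ _)).
apply: (@le_trans _ _ (\sum_(k < r) c)); first by apply: ler_sum.
by rewrite sumr_const card_ord -[c *+ r]mulr_natr.
Qed.

Lemma norm_amean r G i (c : R) : (0 < r)%N ->
  (forall k : nat, (k < r)%N -> `|G (i + k%:Z)| <= c) -> `|amean r G i| <= c.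
Proof. by move=> r0 H; apply: norm_window_mean => // k; apply: H. Qed.

Lemma periodic_amean n r G : periodic n G -> periodic n (amean r G).
Proof.
move=> pG i; rewrite /amean; congr (_ * _); apply: eq_bigr => k _.
by rewrite addrAC pG.
Qed.

Lemma periodic_diffq n e r u : periodic n u -> periodic n (diffq e r u).
Proof. by move=> pu i; rewrite /diffq addrAC !pu. Qed.

Lemma psum_diffq1 n e u : periodic n u -> psum n (diffq e 1 u) = 0.
Proof.
move=> pu; rewrite (psum_ext n (v := fun i => e^-1 * (u (i + 1) - u i))).
  by rewrite psumZ psumB psum_shift // subrr mulr0.
by move=> i; rewrite diffq1E mulrC.
Qed.

Lemma periodic_stress n rmax dPhi G :
  (forall r i, (1 <= r <= rmax)%N -> dPhi r (i + n%:Z) = dPhi r i) ->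
  periodic n G -> periodic n (stress rmax dPhi G).
Proof.
move=> pP pG i; rewrite /stress big_nat_cond [RHS]big_nat_cond.
apply: eq_bigr => r; rewrite andbT ltnS => hr.
congr (_ * _); apply: eq_bigr => k _.
by rewrite addrAC pP // (periodic_amean r pG).
Qed.

(** Each of the [r] terms of [amean r V] is shifted back to the site where [V] is evaluated;
    periodicity leaves no boundary terms. *)
Lemma psum_stress n rmax dPhi G V :
  (forall r i, (1 <= r <= rmax)%N -> dPhi r (i + n%:Z) = dPhi r i) ->
  periodic n G -> periodic n V ->
  \sum_(1 <= r < rmax.+1)
     psum n (fun i => dPhi r i (amean r G i) * amean r V i)
  = psum n (fun i => stress rmax dPhi G i * V i).
Proof.
move=> pP pG pV.
rewrite [RHS](_ : _ = \sum_(1 <= r < rmax.+1) psum n (fun i => r%:R^-1 *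
    (\sum_(k < r) dPhi r (i - k%:Z) (amean r G (i - k%:Z)) * V i))); last first.
  rewrite /psum exchange_big; apply: eq_bigr => i _.
  rewrite /stress mulr_suml; apply: eq_bigr => r _.
  by rewrite -mulrA mulr_suml.
rewrite big_nat_cond [RHS]big_nat_cond.
apply: eq_bigr => r; rewrite andbT ltnS => hr.
rewrite psumZ [LHS](_ : _ = r%:R^-1 * \sum_(k < r) psum n (fun i =>
    dPhi r i (amean r G i) * V (i + k%:Z))); last first.
  rewrite /psum exchange_big mulr_sumr; apply: eq_bigr => i _ /=.
  by rewrite -mulr_sumr [in LHS]/amean mulrCA.
rewrite /psum [in RHS]exchange_big /=; congr (_ * _); apply: eq_bigr => k _.
rewrite -[RHS]/(psum n (fun j =>
  dPhi r (j - k%:Z) (amean r G (j - k%:Z)) * V j)).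
rewrite -[RHS](@psum_shift _ _ _ k%:Z).
  by apply: eq_bigr => i _; rewrite addrK.
by move=> i; rewrite pV addrAC pP // (periodic_amean r pG).
Qed.

Lemma antidifference n e (phi : int -> R) : (0 < n)%N -> e != 0 ->
  periodic n phi -> psum n phi = 0 ->
  exists2 u, zero_mean n u & forall i, diffq e 1 u i = phi i.
Proof.
move=> n0 e0 pphi s0.
(* Partial sums up to the residue of [i] are periodic by construction; the zero mean of [phi] makes
   the increment correct where the residue wraps around. *)
pose w (i : int) : R := e * \sum_(k < `|(i %% n%:Z)%Z|%N) phi k%:Z.
have pw : periodic n w by move=> i; rewrite /w modzDr.
pose u (i : int) : R := w i - n%:R^-1 * psum n w.
have pu : periodic n u by move=> i; rewrite /u pw.
exists u.
  apply/zero_meanP => //; split => //.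
  by rewrite psumB psum_const mulVKf ?subrr // pnatr_eq0 gtn_eqF.
move=> i; rewrite diffq1E /u opprB addrA subrK.
apply: (mulIf e0); rewrite divfK // /w.
rewrite -(periodic_modz i pphi).
set m := `|(i %% n%:Z)%Z|%N.
have mE : (i %% n%:Z)%Z = m%:Z by rewrite /m; lia.
have := ltn_pmod; have lm : (m < n)%N by rewrite /m; lia.
move=> _; rewrite mE.
have [lt|ge] := ltnP m.+1 n.
  rewrite (_ : `|((i + 1) %% n%:Z)%Z|%N = m.+1); last first.
    by rewrite -modzDml mE modz_small //=; lia.
  by rewrite big_ord_recr /= mulrDr addrAC subrr add0r mulrC.
have nE : n = m.+1 by lia.
rewrite (_ : `|((i + 1) %% n%:Z)%Z|%N = 0%N); last first.
  by rewrite -modzDml mE nE (_ : m%:Z + 1 = m.+1%:Z) ?modzz //; lia.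
rewrite big_ord0 mulr0 sub0r.
move: s0; rewrite /psum nE big_ord_recr /= => /eqP; rewrite addrC addr_eq0 => /eqP ->.
by rewrite mulNr mulrC.
Qed.

Lemma step_bound u (c : R) : (forall i, `|u (i + 1) - u i| <= c) ->
  forall i (k : nat), `|u (i + k%:Z) - u i| <= k%:R * c.
Proof.
move=> H i; elim=> [|k IH]; first by rewrite addr0 subrr normr0 mul0r.
rewrite -[k.+1]addn1 natrD mulrDl mul1r.
rewrite (_ : u (i + (k + 1)%:Z) - u i =
  (u (i + k%:Z) - u i) + (u (i + k%:Z + 1) - u (i + k%:Z))).
  by apply: (le_trans (ler_normD _ _)); apply: lerD.
by rewrite (_ : i + (k + 1)%:Z = i + k%:Z + 1); [ring | lia].
Qed.

(** A crude discrete Poincaré inequality. It is applied with [n = p], or with [c = 0], so its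
    constant never brings [N] into the estimates. *)
Lemma zero_mean_bound n u (c : R) : (0 < n)%N -> zero_mean n u ->
  (forall i, `|u (i + 1) - u i| <= c) -> forall i, `|u i| <= n%:R * c.
Proof.
move=> n0 /(zero_meanP _ n0)[pu su] H i.
have c0 : 0 <= c by apply: le_trans (H 0).
have n0' : (0 : R) < n%:R by rewrite ltr0n.
have E : n%:R * u i = - psum n (fun k => u (k + i) - u i).
  by rewrite psumB psum_const psum_shift // su sub0r opprK.
rewrite -(ler_pM2l n0') -{1}(ger0_norm (ltW n0')) -normrM E normrN.
apply: (le_trans (ler_norm_sum _ _ _)).
rewrite -[leRHS](psum_const n (n%:R * c)); apply: ler_sum => k _.
rewrite [k%:Z + i]addrC; apply: (le_trans (step_bound H _ _)).
by apply: ler_wpM2r => //; rewrite ler_nat ltnW.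
Qed.

Lemma periodic_spike n k : periodic n (spike R n k).
Proof.
by move=> i; rewrite /spike addrAC; congr (_ _)%:R; rewrite rpredDr // dvdzz.
Qed.

Lemma psum_spike n (psi : int -> R) k : (0 < n)%N -> periodic n psi ->
  psum n (fun i => psi i * spike R n k i) = psi k.
Proof.
move=> n0 pp; rewrite -(@psum_shift _ _ _ k); last first.
  by move=> i; rewrite pp periodic_spike.
case: n n0 pp => // n _ pp.
rewrite /psum big_ord_recl big1 ?addr0.
  by rewrite /spike /= add0r subrr dvdz0 mulr1.
move=> i _; rewrite /spike addrK.
rewrite (_ : (_ %| _)%Z = false) ?mulr0 //.
by rewrite /bump /= dvdzE /= gtnNdvd // ltnS.
Qed.

Lemma psum_spike1 n k : (0 < n)%N -> psum n (spike R n k) = 1.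
Proof.
move=> n0; rewrite -[RHS](@psum_spike n (fun=> 1) k n0) //.
by apply: psum_ext => i; rewrite mul1r.
Qed.

(** The discrete du Bois-Reymond lemma, by testing with the difference of two spikes. *)
Lemma const_of_spikes n (psi : int -> R) : (0 < n)%N -> periodic n psi ->
  (forall V, periodic n V -> psum n V = 0 -> psum n (fun i => psi i * V i) = 0) ->
  forall i j, psi i = psi j.
Proof.
move=> n0 pp H i j.
have := H (fun k => spike R n i k - spike R n j k).
rewrite psumB !psum_spike1 // subrr => /(_ _ erefl).
rewrite (psum_ext n (v := fun k => psi k * spike R n i k - psi k * spike R n j k)).
  rewrite psumB !psum_spike // => H'; apply/eqP; rewrite -subr_eq0; apply/eqP/H'.
  by move=> k; rewrite !periodic_spike.
by move=> k; rewrite mulrBr.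
Qed.

End StrainFields.

(** * Monotonicity of the stress *)

Section ScalarCalculus.
Context {R : realType}.
Implicit Types (f df : R -> R).

(** The little-o form of differentiability, with a weak inequality so that [h = 0] is allowed. It
    serves functions such as [Phi0] that are controlled only through estimates. *)
Lemma is_derive1P f (x d : R) : is_derive x 1 f d <->
  forall eps, 0 < eps -> exists2 del, 0 < del &
    forall h, `|h| < del -> `|f (x + h) - f x - d * h| <= eps * `|h|.
Proof.
have E eps h : 0 < eps -> h != 0 ->
    (`|d - h^-1 *: ((f \o shift x) (h *: 1) - f x)| < eps) =
    (`|f (x + h) - f x - d * h| < eps * `|h|).
  move=> e0 h0; rewrite /= -ltr_pdivrMr ?normr_gt0 // -normfV -normrM distrC.
  congr (`| _ | < _); rewrite /GRing.scale /= mulr1 [h + x]addrC.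
  by rewrite mulrBl mulfK // [in LHS]mulrC.
split=> [[df dE] eps e0|H].
  have /cvgr_dist_lt/(_ _ e0) : h^-1 *: ((f \o shift x) (h *: 1) - f x) @[h --> 0^'] --> d.
    by rewrite -dE; exact: df.
  case/nbhs_ballP => del /= d0 H; exists del => // h hd.
  have [->|h0] := eqVneq h 0; first by rewrite addr0 subrr mulr0 subrr normr0 mulr0.
  apply: ltW; rewrite -E //; apply: H => //=.
  by rewrite /ball /= sub0r normrN.
have C : h^-1 *: ((f \o shift x) (h *: 1) - f x) @[h --> 0^'] --> d.
  apply/cvgrPdist_lt => eps e0.
  have [del d0 Hd] := H (eps / 2) ltac:(by rewrite divr_gt0).
  apply/nbhs_ballP; exists del => //= h; rewrite /ball /= sub0r normrN => hd h0.
  rewrite E //; apply: (le_lt_trans (Hd h hd)).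
  by rewrite ltr_pM2r ?normr_gt0 //; lra.
by split; [apply/cvg_ex; exists d | apply: cvg_lim].
Qed.

Lemma is_derive1_unique f (x d : R) : is_derive x 1 f d -> derive1 f x = d.
Proof. by move=> df; rewrite derive1E; apply: derive_val. Qed.

Lemma is_derive1_derive1 f (x : R) :
  derivable f x 1 -> is_derive x 1 f (derive1 f x).
Proof. by move=> df; rewrite derive1E; apply: derivableP. Qed.

(** One-sided, because a minimizer over a box may only be varied in directions that point into the
    box. *)
Lemma right_min_derive_ge0 f (d t0 : R) : is_derive (0 : R) 1 f d -> 0 < t0 ->
  (forall t, 0 < t < t0 -> f 0 <= f t) -> 0 <= d.
Proof.
move=> /is_derive1P H t00 fm; rewrite leNgt; apply/negP => d0.
have [del del0 /(_ (Num.min del t0 / 2))] := H (- d / 2) ltac:(lra).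
set t := Num.min del t0 / 2.
have m0 : 0 < Num.min del t0 by rewrite lt_min del0.
have m1 : Num.min del t0 <= del by rewrite ge_min lexx.
have m2 : Num.min del t0 <= t0 by rewrite ge_min lexx orbT.
have t_gt0 : 0 < t by rewrite /t; lra.
rewrite gtr0_norm // add0r => /(_ ltac:(rewrite /t; lra)).
rewrite ler_norml => /andP[_].
have := fm t ltac:(apply/andP; split => //; rewrite /t; lra).
have : d * t < 0 by rewrite nmulr_rlt0.
nra.
Qed.

Lemma MVT_ball f df (c rho : R) :
  (forall z, ball c rho z -> is_derive z 1 f (df z)) ->
  forall s t, ball c rho s -> ball c rho t ->
  exists2 xi, `|xi - t| <= `|s - t| /\ `|xi - s| <= `|s - t| /\ ball c rho xi &
    f s - f t = df xi * (s - t).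
Proof.
move=> H.
have W : forall s t, s < t -> ball c rho s -> ball c rho t ->
    exists2 xi, s < xi < t & f t - f s = df xi * (t - s).
  move=> s t st bs bt.
  have I x : s <= x <= t -> ball c rho x.
    by move: bs bt; rewrite /ball /= !ltr_norml; lra.
  have [||xi] := @MVT R f df s t st.
  - by move=> x /[!in_itv] /= xst; apply/H/I; lra.
  - apply: derivable_within_continuous => x /[!in_itv] /= xst.
    by have [] := H x (I x xst).
  by rewrite in_itv; exists xi.
move=> s t bs bt; case: (ltgtP s t) => [st|ts|->]; last first.
- by exists t; rewrite ?subrr ?normr0 ?mulr0 //; split => //; split.
- have [xi xi1 xi2] := W t s ts bt bs; exists xi => //.
  by move: bs bt; rewrite /ball /= !ltr_norml !ler_norml ger0_norm; [split; [lra | split; lra]|lra].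
- have [xi xi1 xi2] := W s t st bs bt; exists xi.
    move: bs bt; rewrite /ball /= !ltr_norml !ler_norml ler0_norm; [split; [lra | split; lra]|lra].
  by rewrite -opprB xi2; ring.
Qed.

Lemma taylor2_ball f df (c rho L : R) :
  (forall z, ball c rho z -> is_derive z 1 f (df z)) ->
  (forall s t, ball c rho s -> ball c rho t -> `|df s - df t| <= L * `|s - t|) ->
  forall s t, ball c rho s -> ball c rho t ->
    `|f s - f t - df t * (s - t)| <= L * `|s - t| ^+ 2.
Proof.
move=> H HL s t bs bt.
have [xi [x1 [_ x2]] ->] := MVT_ball H bs bt.
rewrite -mulrBl normrM expr2 mulrA; apply: ler_wpM2r => //.
apply: (le_trans (HL _ _ x2 bt)); have [e|nst] := eqVneq s t.
  by move: x1; rewrite e subrr normr0 normr_le0 subr_eq0 => /eqP ->; rewrite subrr normr0.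
apply: ler_wpM2l => //.
have := HL _ _ bs bt; have : 0 < `|s - t| by rewrite normr_gt0 subr_eq0.
by move=> p0 /(le_trans (normr_ge0 _)); rewrite pmulr_lge0.
Qed.

End ScalarCalculus.

Section StressEstimates.
Context {R : realType}.
Variable rmax : nat.
Implicit Types (dPhi : nat -> int -> R -> R) (G H : int -> R)
  (dom : nat -> int -> R -> Prop).

Definition admissible dom G : Prop :=
  forall r i, (1 <= r <= rmax)%N -> dom r i (amean r G i).

(** The stress at [i] only sees sites at distance less than [rmax]. This locality later allows the
    macroscopic strain to be frozen near each site. *)
Lemma stress_linearize dPhi dom (a : nat -> int -> R) (kappa zeta : R) G H i :
  (forall r y s t, (1 <= r <= rmax)%N -> dom r y s -> dom r y t ->
     `|dPhi r y s - dPhi r y t - a r y * (s - t)| <= kappa * `|s - t|) ->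
  0 <= kappa -> admissible dom G -> admissible dom H ->
  (forall j, (`|j - i| < rmax)%N -> `|G j - H j| <= zeta) ->
  `|stress rmax dPhi G i - stress rmax dPhi H i
    - stress rmax (fun r y s => a r y * s) (fun j => G j - H j) i|
  <= rmax%:R * (kappa * zeta).
Proof.
move=> hP k0 aG aH hz.
rewrite /stress -!sumrB.
apply: (le_trans (ler_norm_sum _ _ _)).
rewrite (_ : rmax%:R * (kappa * zeta) = \sum_(1 <= r < rmax.+1) kappa * zeta);
  last by rewrite sumr_const_nat subSS subn0 -[RHS]mulr_natl.
rewrite big_nat_cond [leRHS]big_nat_cond.
apply: ler_sum => r; rewrite andbT ltnS => hr.
rewrite -!mulrBr -!sumrB; have r0 : (0 < r)%N by case/andP: hr.
apply: norm_window_mean => // k.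
rewrite ameanB; apply: (le_trans (hP _ _ _ _ hr (aG _ _ hr) (aH _ _ hr))).
apply: ler_wpM2l => //; rewrite -ameanB; apply: norm_amean => // l lr.
by apply: hz; have := ltn_ord k; lia.
Qed.

Lemma stress_lipschitz dPhi dom (L zeta : R) G H i :
  (forall r y s t, (1 <= r <= rmax)%N -> dom r y s -> dom r y t ->
     `|dPhi r y s - dPhi r y t| <= L * `|s - t|) ->
  0 <= L -> admissible dom G -> admissible dom H ->
  (forall j, (`|j - i| < rmax)%N -> `|G j - H j| <= zeta) ->
  `|stress rmax dPhi G i - stress rmax dPhi H i| <= rmax%:R * (L * zeta).
Proof.
move=> hP L0 aG aH hz.
(* A Lipschitz bound is a linearization error with zero slopes. *)
have := @stress_linearize dPhi dom (fun _ _ => 0) L zeta G H i _ L0 aG aH hz.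
rewrite (_ : stress rmax (fun _ _ s => 0 * s) _ i = 0) ?subr0; last first.
  by rewrite /stress big1 // => r _; rewrite big1 ?mulr0 // => k _; rewrite mul0r.
by apply => r y s t hr ds dt; rewrite mul0r subr0; exact: hP.
Qed.

Variable n : nat.

(* Assumption 3 in first-order form, hence also usable for [Phi0], whose
   second derivative is only known to exist at [0]. *)
Definition monotone_potentials dPhi dom (m : R) (M : nat -> R) : Prop :=
  [/\ forall r i, (1 <= r <= rmax)%N -> dPhi r (i + n%:Z) = dPhi r i,
      forall i s t, dom 1%N i s -> dom 1%N i t ->
        m * (s - t) ^+ 2 <= (dPhi 1%N i s - dPhi 1%N i t) * (s - t),
      forall r, (2 <= r <= rmax)%N -> 0 <= M r &
      forall r i s t, (2 <= r <= rmax)%N -> dom r i s -> dom r i t ->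
        `|dPhi r i s - dPhi r i t| <= M r * `|s - t|].

Hypotheses (n_gt0 : (0 < n)%N) (rmax_gt0 : (0 < rmax)%N).

Lemma stress_head dPhi G i : stress rmax dPhi G i = dPhi 1%N i (G i) +
  \sum_(2 <= r < rmax.+1)
    r%:R^-1 * \sum_(k < r) dPhi r (i - k%:Z) (amean r G (i - k%:Z)).
Proof.
by rewrite /stress big_ltn // big_ord1 invr1 mul1r amean1 subr0.
Qed.

(* Evaluate the stress difference at a maximum and at a minimum of the zero-mean
   field [G - H]: the nearest-neighbour terms add up, and each remaining
   potential costs at most [2 * M r] times the maximum norm. *)
Lemma osc_stress dPhi dom (m c : R) (M : nat -> R) G H (i0 j0 : int) :
  monotone_potentials dPhi dom m M ->
  2 * c <= m - 2 * \sum_(2 <= r < rmax.+1) M r -> 0 < c ->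
  admissible dom G -> admissible dom H ->
  psum n (fun i => G i - H i) = 0 ->
  (forall k, G k - H k <= G i0 - H i0) ->
  (forall k, G j0 - H j0 <= G k - H k) ->
  forall k, 2 * c * `|G k - H k| <=
    (stress rmax dPhi G i0 - stress rmax dPhi H i0)
    - (stress rmax dPhi G j0 - stress rmax dPhi H j0).
Proof.
move=> [_ hm M0 hM] hc c0 aG aH s0 hi hj k.
set SM := \sum_(2 <= r < rmax.+1) M r in hc.
have SM0 : 0 <= SM.
  by rewrite /SM big_nat_cond; apply: sumr_ge0 => r; rewrite andbT ltnS; apply: M0.
set Z := fun i => G i - H i.
have n0 : 0 < n%:R :> R by rewrite ltr0n.
have Zi0 : 0 <= Z i0.
  rewrite -(pmulr_rge0 _ n0) -psum_const -{1}s0.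
  by apply: ler_sum => l _; exact: hi.
have Zj0 : Z j0 <= 0.
  rewrite -(pmulr_rle0 _ n0) -psum_const -[leRHS]s0.
  by apply: ler_sum => l _; exact: hj.
set zeta := Num.max (Z i0) (- Z j0).
have zl l : `|G l - H l| <= zeta.
  rewrite /zeta le_max; apply/orP; have := hi l; have := hj l.
  rewrite -/(Z i0) -/(Z j0) => h1 h2; have [l0|l0] := leP 0 (G l - H l).
    by left; rewrite ger0_norm.
  by right; rewrite ltr0_norm // lerN2.
have hz : zeta <= Z i0 - Z j0 by rewrite /zeta ge_max; apply/andP; split; lra.
have z0 : 0 <= zeta by rewrite le_max Zi0.
have split_stress i : exists2 e, `|e| <= SM * zeta &
    stress rmax dPhi G i - stress rmax dPhi H i
    = dPhi 1%N i (G i) - dPhi 1%N i (H i) + e.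
  rewrite !stress_head //.
  set A := \sum_(2 <= r < _) _; set B := \sum_(2 <= r < _) _.
  exists (A - B); last by ring.
  rewrite -sumrB mulr_suml; apply: (le_trans (ler_norm_sum _ _ _)).
  rewrite big_nat_cond [leRHS]big_nat_cond.
  apply: ler_sum => r; rewrite andbT ltnS => hr.
  have hr1 : (1 <= r <= rmax)%N by lia.
  rewrite -mulrBr -sumrB; apply: norm_window_mean; first by lia.
  move=> l; apply: (le_trans (hM _ _ _ _ hr (aG _ _ hr1) (aH _ _ hr1))).
  apply: ler_wpM2l; first exact: M0.
  by rewrite -ameanB; apply: norm_amean => //; lia.
have h1 : (1 <= 1 <= rmax)%N by lia.
have [e1 be1 ->] := split_stress i0; have [e2 be2 ->] := split_stress j0.
have := hm i0 _ _ (aG 1%N i0 h1) (aH 1%N i0 h1).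
have := hm j0 _ _ (aG 1%N j0 h1) (aH 1%N j0 h1).
rewrite !amean1 -/(Z i0) -/(Z j0).
set d1 := dPhi _ i0 _ - _; set d2 := dPhi _ j0 _ - _ => hd2 hd1.
have m0 : 0 < m by lra.
(* Divide the quadratic monotonicity inequality by [Z i0]; where this vanishes, [G] and [H] agree
   and both sides are zero. *)
have D1 : m * Z i0 <= d1.
  have [e|ne] := eqVneq (Z i0) 0.
    have GH : G i0 = H i0 by apply/eqP; rewrite -subr_eq0; apply/eqP.
    by rewrite e mulr0 /d1 GH subrr.
  have p0 : 0 < Z i0 by rewrite lt_def ne.
  by rewrite -(ler_pM2r p0); move: hd1; rewrite expr2 mulrA.
have D2 : d2 <= m * Z j0.
  have [e|ne] := eqVneq (Z j0) 0.
    have GH : G j0 = H j0 by apply/eqP; rewrite -subr_eq0; apply/eqP.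
    by rewrite e mulr0 /d2 GH subrr.
  have p0 : Z j0 < 0 by rewrite lt_def eq_sym ne.
  by rewrite -(ler_nM2r p0); move: hd2; rewrite expr2 mulrA.
move: be1 be2; rewrite !ler_norml => /andP[b1 _] /andP[_ b2].
(* The products that [lra] needs for the chain: the oscillation is at least
   [m (Z i0 - Z j0) - 2 SM zeta], hence at least [(m - 2 SM) zeta], hence at least [2 c zeta]. *)
have P1 : 0 <= c * (zeta - `|G k - H k|) by rewrite mulr_ge0 ?subr_ge0 // ltW.
have P2 : 0 <= m * (Z i0 - Z j0 - zeta) by rewrite mulr_ge0 ?subr_ge0 // ltW.
have P3 : 0 <= (m - 2 * SM - 2 * c) * zeta by rewrite mulr_ge0 // subr_ge0.
lra.
Qed.

Lemma periodic_extrema G : periodic n G ->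
  exists i0 j0, forall k, G k <= G i0 /\ G j0 <= G k.
Proof.
move=> pG; pose x0 := Ordinal n_gt0.
exists [arg max_(i > x0) G i%:Z]%O%:Z, [arg min_(i < x0) G i%:Z]%O%:Z.
case: arg_maxP => // i _ hi; case: arg_minP => // j _ hj.
by apply: (@periodic_ord R n G (fun x => x <= G i /\ G j <= x)) => // k; split; [exact: hi | exact: hj].
Qed.

(** The unknown constant [mu] cancels between the maximum and the minimum of [G - H], leaving
    [2 nu]; the factor 2 in [2 * c] absorbs this. *)
Lemma monotone_coercive dPhi dom (m c mu nu : R) (M : nat -> R) G H :
  monotone_potentials dPhi dom m M ->
  2 * c <= m - 2 * \sum_(2 <= r < rmax.+1) M r -> 0 < c ->
  admissible dom G -> admissible dom H ->
  periodic n G -> periodic n H -> psum n (fun i => G i - H i) = 0 ->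
  (forall i, `|stress rmax dPhi G i - stress rmax dPhi H i - mu| <= nu) ->
  forall i, c * `|G i - H i| <= nu.
Proof.
move=> mP hc c0 aG aH pG pH s0 hb k.
have pZ : periodic n (fun i => G i - H i) by move=> i; rewrite pG pH.
have [i0 [j0 hij]] := periodic_extrema pZ.
have := osc_stress mP hc c0 aG aH s0 (fun k => (hij k).1) (fun k => (hij k).2) k.
by have := hb i0; have := hb j0; rewrite !ler_norml; lra.
Qed.

End StressEstimates.

Lemma monotone_subdomain (R : realType) rmax n (dPhi : nat -> int -> R -> R)
    (dom dom' : nat -> int -> R -> Prop) (m : R) (M : nat -> R) : (0 < rmax)%N ->
  (forall r i s, (1 <= r <= rmax)%N -> dom' r i s -> dom r i s) ->
  monotone_potentials rmax n dPhi dom m M -> monotone_potentials rmax n dPhi dom' m M.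
Proof.
move=> rmax0 H [m1 m2 m3 m4]; have h1 : (1 <= 1 <= rmax)%N by rewrite rmax0.
split => //; first by move=> i s t ds dt; exact: (m2 i s t (H _ _ _ h1 ds) (H _ _ _ h1 dt)).
move=> r i s t hr ds dt; have hr1 : (1 <= r <= rmax)%N by case/andP: hr => /ltnW -> ->.
exact: (m4 r i s t hr (H _ _ _ hr1 ds) (H _ _ _ hr1 dt)).
Qed.

(** * Solvability by energy minimization *)

Section FieldEnergy.
Context {R : realType}.
Variables (n rmax : nat).
Implicit Types (Phi dPhi : nat -> int -> R -> R) (G V W : int -> R).

Definition field_energy Phi G : R :=
  \sum_(1 <= r < rmax.+1) psum n (fun i => Phi r i (amean r G i)).

Lemma is_derive_sum_fun k (h : 'I_k -> R -> R) (x : R) (dh : 'I_k -> R) :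
  (forall i, is_derive x 1 (h i) (dh i)) ->
  is_derive x 1 (fun t => \sum_(i < k) h i t) (\sum_(i < k) dh i).
Proof. by move=> H; rewrite -fct_sumE; apply: is_derive_sum. Qed.

Lemma is_derive_affine_comp (f : R -> R) (a b d : R) :
  is_derive a 1 f d -> is_derive (0 : R) 1 (fun t => f (a + t * b)) (d * b).
Proof.
move=> df; apply: (@is_derive1_comp R f (fun t => a + t * b) 0 d b).
  by rewrite mul0r addr0.
by apply/is_derive1P => eps e0; exists 1 => // h _; rewrite (_ : _ - _ = 0) ?normr0; [rewrite mulr_ge0 // ltW | ring].
Qed.

Lemma is_derive_field_energy Phi dPhi G V :
  (forall r i, (1 <= r <= rmax)%N -> dPhi r (i + n%:Z) = dPhi r i) ->
  periodic n G -> periodic n V ->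
  (forall r i, (1 <= r <= rmax)%N ->
     is_derive (amean r G i) 1 (Phi r i) (dPhi r i (amean r G i))) ->
  is_derive (0 : R) 1 (fun t : R => field_energy Phi (fun i => G i + t * V i))
    (psum n (fun i => stress rmax dPhi G i * V i)).
Proof.
move=> pP pG pV dP.
rewrite -psum_stress // big_add1 /= big_mkord.
rewrite (_ : (fun t => _) = fun t : R => \sum_(r < rmax) \sum_(i < n)
    Phi r.+1 i%:Z (amean r.+1 G i%:Z + t * amean r.+1 V i%:Z)); last first.
  apply/funext => t; rewrite /field_energy big_add1 /= big_mkord.
  apply: eq_bigr => r _; apply: eq_bigr => i _.
  by rewrite ameanD ameanZ.
apply: is_derive_sum_fun => r; apply: is_derive_sum_fun => i.
by apply/is_derive_affine_comp/dP; rewrite /= ltn_ord.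
Qed.

Lemma continuous_sum_fun (T : topologicalType) (k : nat) (h : 'I_k -> T -> R) (x : T) :
  (forall i, {for x, continuous (h i)}) ->
  {for x, continuous (fun v => \sum_(i < k) h i v)}.
Proof.
elim: k h => [|k IH] h H.
  by rewrite (_ : (fun v => _) = cst 0); [exact: cst_continuous | apply/funext => v; rewrite big_ord0].
rewrite (_ : (fun v => _) = (fun v => \sum_(i < k) h (widen_ord (leqnSn k) i) v) + h ord_max); last first.
  by apply/funext => v; rewrite big_ord_recr.
by apply: continuousD; [apply: IH => i; exact: H | exact: H].
Qed.

Lemma continuous_amean (T : topologicalType) r (E : T -> int -> R) (x : T) i :
  (forall j, {for x, continuous (fun v => E v j)}) ->
  {for x, continuous (fun v => amean r (E v) i)}.
Proof.
move=> H; rewrite /amean.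
by apply: continuousM; [exact: cst_continuous | apply: continuous_sum_fun => k; exact: H].
Qed.

End FieldEnergy.

(** Fields are encoded as row vectors: the box cut by the zero-mean hyperplane is compact in finite
    dimension, so the extreme value theorem applies. *)
Lemma field_energy_minimizer (R : realType) (n rmax : nat)
    (Phi : nat -> int -> R -> R) (B g : int -> R) (rho : R) :
  (0 < n)%N -> 0 <= rho ->
  (forall r i z, (1 <= r <= rmax)%N -> `|z - amean r B i| <= rho ->
     {for z, continuous (Phi r i)}) ->
  exists W, [/\ periodic n W, psum n W = 0, forall i, `|W i| <= rho &
    forall V, periodic n V -> psum n V = 0 -> (forall i, `|V i| <= rho) ->
      field_energy n rmax Phi (fun i => B i + W i) - psum n (fun i => g i * W i)
      <= field_energy n rmax Phi (fun i => B i + V i) - psum n (fun i => g i * V i)].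
Proof.
move=> + rho0 cP; case: n => // m _.
pose E (v : 'rV[R]_m.+1) (i : int) : R := v ord0 (inord `|(i %% m.+1%:Z)%Z|%N).
have pE v : periodic m.+1 (E v) by move=> i; rewrite /E modzDr.
have EK v (k : 'I_m.+1) : E v k%:Z = v ord0 k.
  have kE : (k%:Z %% m.+1%:Z)%Z = k%:Z by rewrite modz_small //= ltz_nat ltn_ord.
  by rewrite /E kE /= inord_val.
have cE v j : {for v, continuous (fun v => E v j)} by exact: coord_continuous.
pose K : set 'rV[R]_m.+1 := [set v : 'rV[R]_m.+1 | forall i : 'I_m.+1, `[- rho, rho] (v ord0 i)] `&`
  [set v : 'rV[R]_m.+1 | psum m.+1 (E v) = 0].
have cK : compact K.
  apply: compact_closedI.
    by apply: (@rV_compact R m.+1 (fun=> `[- rho, rho]%classic)) => i; exact: segment_compact.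
  apply: (@preimage_closed _ _ (fun v => psum m.+1 (E v)) [set x | x = 0]).
    by move=> v _; apply: continuous_sum_fun => k; exact: cE.
  exact: closed_eq.
pose J v := field_energy m.+1 rmax Phi (fun i => B i + E v i) - psum m.+1 (fun i => g i * E v i).
have KE v : K v <-> psum m.+1 (E v) = 0 /\ forall i, `|E v i| <= rho.
  split=> [[vK vs]|[vs vK]]; split => // i.
    have := vK (inord `|(i %% m.+1%:Z)%Z|%N).
    by rewrite /= in_itv /= ler_norml.
  by have := vK i%:Z; rewrite EK /= in_itv /= ler_norml.
have [||v + vmin] := @compact_EVT_min _ R J K _ cK.
- exists 0; apply/KE; split; last by move=> i; rewrite /E mxE normr0.
  by rewrite /psum big1 // => i _; rewrite /E mxE.
- apply: continuous_in_subspaceT => v; rewrite inE => /KE[vs vb].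
  apply: continuousB; last first.
    apply: continuous_sum_fun => k; apply: continuousM; first exact: cst_continuous.
    exact: cE.
  rewrite /field_energy [X in {for _, continuous X}](_ : _ = fun v => \sum_(r < rmax) \sum_(i < m.+1)
      Phi r.+1 i%:Z (amean r.+1 (fun j => B j + E v j) i%:Z)); last first.
    by apply/funext => w; rewrite big_add1 /= big_mkord.
  apply: continuous_sum_fun => r; apply: continuous_sum_fun => i.
  apply: (@continuous_comp _ _ _ (fun v => amean r.+1 (fun j => B j + E v j) i%:Z)).
    by apply: continuous_amean => j; apply: continuousD; [exact: cst_continuous|exact: cE].
  apply: cP; first by rewrite /= ltn_ord.
  by rewrite ameanD addrC addKr; apply: norm_amean.
rewrite inE => /KE[vs vb]; exists (E v); split => // V pV Vs Vb.
pose w : 'rV[R]_m.+1 := \row_k V k%:Z.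
have wV : E w = V.
  apply/funext => i; rewrite -(periodic_modz i (pE w)) -[RHS](periodic_modz i pV).
  have l : (`|(i %% m.+1%:Z)%Z| < m.+1)%N by lia.
  have -> : (i %% m.+1%:Z)%Z = (Ordinal l)%:Z by rewrite /=; lia.
  by rewrite EK mxE.
have := vmin w; rewrite /J wV; apply; rewrite inE; apply/KE.
by rewrite wV.
Qed.

Section Solvability.
Context {R : realType}.
Variables (n rmax : nat).
Hypotheses (n_gt0 : (0 < n)%N) (rmax_gt0 : (0 < rmax)%N).
Implicit Types (Phi dPhi : nat -> int -> R -> R) (G V W : int -> R).

(* Minimize the energy over the box [|W| <= rho]. Moving strain from a maximum
   to a minimum of the minimizer stays in the box, and by [osc_stress] the
   resulting variational inequality puts the minimizer in the interior. *)
Lemma stress_solvable Phi dPhi (B g : int -> R) (rho m c tau : R) (M : nat -> R) :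
  let dom := fun r i z => `|z - amean r B i| <= rho in
  periodic n B -> periodic n g -> 0 < rho ->
  (forall r i z, (1 <= r <= rmax)%N -> dom r i z ->
     is_derive z 1 (Phi r i) (dPhi r i z)) ->
  monotone_potentials rmax n dPhi dom m M ->
  2 * c <= m - 2 * \sum_(2 <= r < rmax.+1) M r -> 0 < c ->
  (forall i j, (g i - stress rmax dPhi B i) - (g j - stress rmax dPhi B j)
     <= tau) ->
  tau < 2 * c * rho ->
  exists W, [/\ periodic n W, psum n W = 0, forall i, 2 * c * `|W i| <= tau &
    forall i j, stress rmax dPhi (fun k => B k + W k) i - g i
              = stress rmax dPhi (fun k => B k + W k) j - g j].
Proof.
move=> dom pB pg rho0 dP mP hc c0 htau taulo.
have [pP _ _ _] := mP.
have [|W [pW sW bW minW]] := @field_energy_minimizer R n rmax Phi B g rho n_gt0 (ltW rho0).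
  move=> r i z hr hz; have [dz _] := dP r i z hr hz.
  by apply/differentiable_continuous/derivable1_diffP.
set G := fun k => B k + W k.
have pG : periodic n G by move=> i; rewrite /G pB pW.
have aG : admissible rmax dom G.
  by move=> r i hr; rewrite /dom ameanD addrC addKr; apply: norm_amean; case/andP: hr.
have aB : admissible rmax dom B.
  by move=> r i hr; rewrite /dom subrr normr0 ltW.
(* The variational inequality for moving strain from [b] to [a], a direction that stays in the box
   for small positive [t]. *)
have VI a b : W a < rho -> - rho < W b ->
    0 <= (stress rmax dPhi G a - g a) - (stress rmax dPhi G b - g b).
  move=> Wa Wb; pose V i := spike R n a i - spike R n b i.
  have pV : periodic n V by move=> i; rewrite /V !periodic_spike.
  have sV : psum n V = 0 by rewrite psumB !psum_spike1 // subrr.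
  have psV psi : periodic n psi -> psum n (fun i => psi i * V i) = psi a - psi b.
    move=> pp; rewrite -(psum_spike a n_gt0 pp) -(psum_spike b n_gt0 pp) -psumB.
    by apply: psum_ext => i; rewrite mulrBr.
  pose f t := field_energy n rmax Phi (fun i => G i + t * V i)
    - psum n (fun i => g i * (W i + t * V i)).
  (* The load part is affine in [t]; writing it through [id] reuses [is_derive_affine_comp], whence
     the factor 1 below. *)
  have fE : f = (fun t => field_energy n rmax Phi (fun i => G i + t * V i))
      - (fun t => id (psum n (fun i => g i * W i) + t * psum n (fun i => g i * V i))).
    apply/funext => t; rewrite /f -[RHS]/(_ - _) /=; congr (_ - _).
    by rewrite -psumZ -psumD; apply: psum_ext => i; ring.
  have pst := periodic_stress pP pG.
  have df : is_derive (0 : R) 1 f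
      ((stress rmax dPhi G a - stress rmax dPhi G b) - 1 * (g a - g b)).
    rewrite fE -!psV //; apply: is_deriveB.
      by apply: is_derive_field_energy => // r i hr; apply: dP => //; exact: aG.
    by apply: is_derive_affine_comp; exact: is_derive_id.
  pose t0 := Num.min (rho - W a) (W b + rho).
  have t00 : 0 < t0 by rewrite lt_min; apply/andP; split; lra.
  have : 0 <= (stress rmax dPhi G a - stress rmax dPhi G b) - 1 * (g a - g b).
    apply: (right_min_derive_ge0 df t00) => t /andP[tp tt].
    have [ta tb] : t < rho - W a /\ t < W b + rho.
      by move: tt; rewrite lt_min => /andP.
    rewrite /f; under eq_fun do rewrite mul0r addr0.
    under [X in _ - psum n X]eq_fun do rewrite mul0r addr0.
    rewrite (_ : (fun i => G i + t * V i) = fun i => B i + (W i + t * V i)); last first.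
      by apply/funext => i; rewrite addrA.
    apply: minW.
    - by move=> i; rewrite pW pV.
    - by rewrite psumD psumZ sW sV mulr0 addr0.
    - have W_cong j i : (n%:Z %| i - j)%Z -> W i = W j.
        by move=> /dvdzP[q e]; rewrite -(periodicMz pW q j) -e addrC subrK.
      move=> i; rewrite /V /spike.
      have := bW i; rewrite !ler_norml => /andP[b1 b2].
      case da : (n%:Z %| i - a)%Z; case db : (n%:Z %| i - b)%Z; rewrite /= ?subrr ?mulr0 ?addr0 ?b1 ?b2 //.
        by rewrite subr0 mulr1; move: (W_cong _ _ da) => e; apply/andP; split; lra.
      by rewrite sub0r mulrN mulr1; move: (W_cong _ _ db) => e; apply/andP; split; lra.
  by lra.
have [i0 [j0 hij]] := periodic_extrema n_gt0 pW.
have n0 : 0 < n%:R :> R by rewrite ltr0n.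
have Wi0 : 0 <= W i0.
  rewrite -(pmulr_rge0 _ n0) -psum_const -{1}sW.
  by apply: ler_sum => l _; case: (hij l%:Z).
have Wj0 : W j0 <= 0.
  rewrite -(pmulr_rle0 _ n0) -psum_const -[leRHS]sW.
  by apply: ler_sum => l _; case: (hij l%:Z).
have GB k : G k - B k = W k by rewrite /G addrC addKr.
(* [VI] moves strain from the maximum [i0] to the minimum [j0], so the stress minus the load at [i0]
   does not exceed that at [j0]. The stress oscillation relative to [B] is then at most that of the
   residual load, hence at most [tau]. *)
have hW k : 2 * c * `|W k| <= tau.
  rewrite -GB; apply: le_trans (htau i0 j0).
  have := @osc_stress R rmax n n_gt0 rmax_gt0 dPhi dom m c M G B i0 j0 mP hc c0 aG aB _ _ _ k.
  rewrite (psum_ext n GB) => /(_ sW) H.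
  have {}H := H ltac:(by move=> l; rewrite !GB; case: (hij l)) ltac:(by move=> l; rewrite !GB; case: (hij l)).
  by have := VI j0 i0 ltac:(lra) ltac:(lra); lra.
have Wlt k : `|W k| < rho.
  have c20 : 0 < 2 * c by lra.
  by rewrite -(ltr_pM2l c20); apply: le_lt_trans (hW k) _.
exists W; split => // i j.
have lo k : - rho < W k by have := Wlt k; rewrite ltr_norml => /andP[].
have hi k : W k < rho by have := Wlt k; rewrite ltr_norml => /andP[].
by have := VI i j (hi _) (lo _); have := VI j i (hi _) (lo _); rewrite -/G; lra.
Qed.

End Solvability.

(** * Local bounds on the potentials *)

(** Representatives are taken in 1..n because the finite extrema in the assumptions run over that
    range. *)
Lemma periodic_prop (n : nat) (P : int -> Prop) : (0 < n)%N ->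
  (forall i, P (i + n%:Z) <-> P i) ->
  (forall k : nat, (1 <= k <= n)%N -> P k%:Z) -> forall i, P i.
Proof.
move=> n0 hP H i.
have pu k j : P (j + k%:Z * n%:Z) <-> P j.
  elim: k j => [|k IH] j; first by rewrite mul0r addr0.
  by rewrite (_ : j + k.+1%:Z * n%:Z = j + k%:Z * n%:Z + n%:Z) ?hP ?IH //; lia.
have [k lk [m e]] : exists2 k : nat, (1 <= k <= n)%N & exists m : nat,
    i + m%:Z * n%:Z = k%:Z \/ i = k%:Z + m%:Z * n%:Z.
  exists (absz (((i - 1) %% n%:Z)%Z + 1)); first by lia.
  exists (absz ((i - 1) %/ n%:Z)%Z).
  have := divz_eq (i - 1) n%:Z.
  set q := (_ %/ _)%Z; set t := (_ %% _)%Z => e.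
  have t0 : 0 <= t by rewrite /t; lia.
  have [q0|q0] := leP 0 q; [right|left].
    rewrite (_ : (`|q|%N)%:Z = q); last by lia.
    by rewrite (_ : (absz (t + 1))%:Z = t + 1); lia.
  rewrite (_ : (`|q|%N)%:Z = - q); last by lia.
  by rewrite (_ : (absz (t + 1))%:Z = t + 1); lia.
case: e => e; last by rewrite e; apply/pu/H.
by apply/(pu m); rewrite e; apply: H.
Qed.

Section LocalModel.
Context {R : realType}.
Variables (p rmax : nat) (Phi : nat -> int -> R -> R) (chi_star : int -> R)
  (rho_Phi : R).
Hypotheses (p_gt0 : (0 < p)%N) (rho_gt0 : 0 < rho_Phi)
  (per_Phi : periodic_potentials p rmax Phi) (zm_chi : zero_mean p chi_star)
  (reg : regular_potentials rmax Phi chi_star rho_Phi).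

Let dPhi r y := derive1 (Phi r y).
Let ctr r y := diffq 1 r chi_star y.
Let a r y := derive1n 2 (Phi r y) (ctr r y).

Lemma periodic_dPhi r y : (1 <= r <= rmax)%N -> dPhi r (y + p%:Z) = dPhi r y.
Proof. by move=> hr; rewrite /dPhi per_Phi. Qed.

Lemma periodic_centre r y : ctr r (y + p%:Z) = ctr r y.
Proof. by rewrite /ctr (periodic_diffq 1 r zm_chi.1). Qed.

Lemma potential_derive r y z : (1 <= r <= rmax)%N -> ball (ctr r y) rho_Phi z ->
  is_derive z 1 (Phi r y) (dPhi r y z).
Proof.
by move=> hr hz; have [/(_ _ hz)[d1 _] _] := reg y hr; exact: is_derive1_derive1.
Qed.

Lemma potential_derive2 r y z : (1 <= r <= rmax)%N -> ball (ctr r y) rho_Phi z ->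
  is_derive z 1 (dPhi r y) (derive1n 2 (Phi r y) z).
Proof.
move=> hr hz; have [/(_ _ hz)[_ d2] _] := reg y hr.
by rewrite derive1nS derive1n1; exact: is_derive1_derive1.
Qed.

Lemma second_derivative_lipschitz : exists2 K, 0 <= K &
  forall r y s t, (1 <= r <= rmax)%N -> ball (ctr r y) rho_Phi s ->
    ball (ctr r y) rho_Phi t ->
    `|derive1n 2 (Phi r y) s - derive1n 2 (Phi r y) t| <= K * `|s - t|.
Proof.
have H0 (q : nat * nat) : exists k : R, (1 <= q.1 <= rmax)%N -> forall s t,
    ball (ctr q.1 q.2%:Z) rho_Phi s -> ball (ctr q.1 q.2%:Z) rho_Phi t ->
    `|derive1n 2 (Phi q.1 q.2%:Z) s - derive1n 2 (Phi q.1 q.2%:Z) t| <= k * `|s - t|.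
  case: (boolP (1 <= q.1 <= rmax)%N) => hr; last by exists 0.
  have [_ [k hk]] := reg q.2%:Z hr; exists k => _ s t bs bt.
  exact: (hk (s, t)).
have [k hk] := boolp.choice H0.
(* The sum of all the individual constants serves as a uniform one. *)
exists (\sum_(r < rmax.+1) \sum_(y < p.+1) `|k (r : nat, y : nat)|).
  by apply: sumr_ge0 => r _; apply: sumr_ge0.
move=> r y s t hr; move: y; apply: (periodic_prop p_gt0).
  by move=> y; rewrite periodic_centre per_Phi.
move=> y hy bs bt; apply: (le_trans (hk (r, y) hr s t bs bt)) => /=.
apply: ler_wpM2r => //; apply: (le_trans (ler_norm _)).
have lr : (r < rmax.+1)%N by lia.
have ly : (y < p.+1)%N by lia.
rewrite (bigD1 (Ordinal lr)) //= (bigD1 (Ordinal ly)) //= -addrA lerDl.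
by rewrite addr_ge0 ?sumr_ge0 // => i _; apply: sumr_ge0.
Qed.

(** The mean value theorem gives the slope at a point within [rho] of the centre, where the second
    derivative is within [K rho] of its central value. Both [s] and [t] may move. *)
Lemma strict_differentiability : exists2 K, 0 <= K &
  forall rho r y s t, rho <= rho_Phi -> (1 <= r <= rmax)%N ->
    `|s - ctr r y| < rho -> `|t - ctr r y| < rho ->
    `|dPhi r y s - dPhi r y t - a r y * (s - t)| <= K * rho * `|s - t|.
Proof.
have [K K0 hK] := second_derivative_lipschitz; exists K => //.
move=> rho r y s t hrho hr hs ht.
have rho0 : 0 < rho by apply: le_lt_trans hs.
have B z : `|z - ctr r y| < rho -> ball (ctr r y) rho z by rewrite /ball /= distrC.
have [xi [_ [_ bxi]] ->] := @MVT_ball R (dPhi r y) (derive1n 2 (Phi r y)) (ctr r y) rho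
  (fun z hz => potential_derive2 hr (le_ball hrho hz)) s t (B _ hs) (B _ ht).
rewrite -mulrBl normrM; apply: ler_wpM2r => //.
apply: (le_trans (hK _ _ _ _ hr (le_ball hrho bxi) _)).
  exact: ballxx.
by apply: ler_wpM2l => //; rewrite distrC ltW.
Qed.

(** The infimum is itself a Lipschitz constant: each difference quotient is a lower bound of the
    set. The set must be nonempty, since the infimum of the empty set is 0. *)
Lemma lipschitz_constP (A : set R) (g : R -> R) s t :
  (exists2 k, 0 <= k & k.-lipschitz_A g) -> A s -> A t ->
  0 <= lipschitz_const A g /\ `|g s - g t| <= lipschitz_const A g * `|s - t|.
Proof.
move=> [k k0 kl] As At; rewrite /lipschitz_const; set S := [set _ | _].
have S0 : S !=set0 by exists k; split.
split; first by apply: lb_le_inf => // x [].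
have [->|st] := eqVneq s t; first by rewrite !subrr normr0 mulr0.
have d0 : 0 < `|s - t| by rewrite normr_gt0 subr_eq0.
rewrite -ler_pdivrMr //; apply: lb_le_inf => // x [x0 xl].
by rewrite ler_pdivrMr //; apply: (xl (s, t)).
Qed.

(** [C_Phi_11] is a maximum of sums with weights [r >= 1] and nonnegative terms, so it dominates
    each single Lipschitz constant. *)
Lemma derivative_lipschitz :
  0 <= C_Phi_11 p rmax Phi chi_star rho_Phi /\
  forall r y s t, (1 <= r <= rmax)%N ->
    ball (ctr r y) rho_Phi s -> ball (ctr r y) rho_Phi t ->
    `|dPhi r y s - dPhi r y t| <= C_Phi_11 p rmax Phi chi_star rho_Phi * `|s - t|.
Proof.
have [K K0 hK] := second_derivative_lipschitz.
have L r y : (1 <= r <= rmax)%N ->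
    exists2 k, 0 <= k & k.-lipschitz_(ball (ctr r y) rho_Phi) (dPhi r y).
  (* A bound for the second derivative on the ball: its central value plus its variation. *)
  move=> hr; exists (`|a r y| + K * rho_Phi); first by rewrite addr_ge0 ?mulr_ge0 // ltW.
  move=> [s t] [/= bs bt].
  have [xi [_ [_ bxi]] ->] := @MVT_ball R (dPhi r y) (derive1n 2 (Phi r y)) (ctr r y) rho_Phi
    (fun z hz => potential_derive2 hr hz) s t bs bt.
  rewrite normrM; apply: ler_wpM2r => //.
  rewrite -lerBlDl; apply: (le_trans (lerB_dist _ _)).
  apply: (le_trans (hK _ _ _ _ hr bxi (ballxx _ rho_gt0))).
  by apply: ler_wpM2l => //; move: bxi; rewrite /ball /= distrC => /ltW.
have lc0 r y : (1 <= r <= rmax)%N ->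
    0 <= lipschitz_const (ball (ctr r y) rho_Phi) (dPhi r y).
  move=> hr; have b := ballxx (ctr r y) rho_gt0.
  by case: (lipschitz_constP (L r y hr) b b).
have [C0 hC] : 0 <= C_Phi_11 p rmax Phi chi_star rho_Phi /\ forall y : nat, (1 <= y <= p)%N ->
    \sum_(1 <= r < rmax.+1) r%:R * lipschitz_const (ball (ctr r y%:Z) rho_Phi) (dPhi r y%:Z)
    <= C_Phi_11 p rmax Phi chi_star rho_Phi.
  split.
    rewrite /C_Phi_11; elim/big_ind: _ => // [x z xc zc|y _]; first by rewrite le_max xc.
    rewrite big_nat_cond; apply: sumr_ge0 => r; rewrite andbT ltnS => hr.
    by rewrite mulr_ge0 // lc0.
  move=> y hy; rewrite /C_Phi_11.
  apply: (@le_bigmax_seq _ _ _ _ 0 y xpredT (fun y : nat => \sum_(1 <= r < rmax.+1)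
    r%:R * lipschitz_const (ball (ctr r y%:Z) rho_Phi) (dPhi r y%:Z))) => //.
  by rewrite mem_index_iota.
split=> // r y s t hr; move: y; apply: (periodic_prop p_gt0).
  by move=> y; rewrite periodic_centre periodic_dPhi.
move=> y hy bs bt; have [l0 hl] := lipschitz_constP (L r y%:Z hr) bs bt.
apply: (le_trans hl); apply: ler_wpM2r => //; apply: le_trans (hC y hy).
rewrite (bigD1_seq r) /= ?iota_uniq // ?mem_index_iota //.
apply: (@le_trans _ _ (r%:R * lipschitz_const (ball (ctr r y%:Z) rho_Phi) (dPhi r y%:Z))).
  by rewrite ler_peMl // ler1n; case/andP: hr.
rewrite lerDl big_seq_cond; apply: sumr_ge0 => q /andP[].
by rewrite mem_index_iota ltnS => hq _; apply: mulr_ge0 => //; exact: lc0.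
Qed.

Lemma stability_bounds : (0 < rmax)%N -> stable p rmax Phi chi_star ->
  exists (m : R) (M : nat -> R),
    [/\ forall y, m <= a 1%N y,
        forall r, 0 <= M r,
        forall r y, (2 <= r <= rmax)%N -> `|a r y| <= M r &
        0 < m / 2 - \sum_(2 <= r < rmax.+1) M r].
Proof.
rewrite /stable => rmax_gt0; set S := [set _ | _].
set M := fun r => \big[Num.max/0]_(1 <= y < p.+1) `|derive1n 2 (Phi r y%:Z) (diffq 1 r chi_star y%:Z)|.
rewrite mulrC => st; exists (inf S), M; split => //.
- have [lbS Sy] : has_lbound S /\ forall y : nat, (1 <= y <= p)%N -> S (a 1%N y%:Z).
    split; last by move=> y hy; exists y.
    (* A crude lower bound, needed only for [inf] to be a lower bound of the set. *)
    exists (- \sum_(1 <= y < p.+1) `|a 1%N y%:Z|) => _ [y hy ->].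
    rewrite lerNl (bigD1_seq y) /= ?iota_uniq // ?mem_index_iota //.
    apply: le_trans (_ : `|a 1%N y%:Z| <= _); first by rewrite -normrN ler_norm.
    by rewrite lerDl sumr_ge0.
  apply: (periodic_prop p_gt0).
    by move=> y; rewrite /a periodic_centre per_Phi.
  by move=> y hy; apply: ge_inf => //; apply: Sy.
- by move=> r; rewrite /M; elim/big_ind: _ => // x z xc zc; rewrite le_max xc.
- move=> r + hr; apply: (periodic_prop p_gt0).
    by move=> y; rewrite /a periodic_centre per_Phi //; lia.
  move=> y hy; rewrite /M.
  apply: (@le_bigmax_seq _ _ _ _ 0 y xpredT (fun y : nat => `|a r y%:Z|)) => //.
  by rewrite mem_index_iota.
Qed.

End LocalModel.

(** * Coercivity and inf-sup constants *)

Section Coercivity.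
Context {R : realType}.
Implicit Types (n rmax : nat) (Phi dPhi : nat -> int -> R -> R)
  (a : nat -> int -> R) (G H Z : int -> R) (dom : nat -> int -> R -> Prop).

Definition linear_response a : nat -> int -> R -> R := fun r y s => a r y * s.

(** The test strains of zero mean do not see the constant [mu], so the least [nu] over all [mu] is
    the norm of the stress difference dual to [seminorm_1_1], up to the scaling of [avg]. *)
Definition coercive n rmax dPhi dom (c : R) : Prop :=
  forall G H mu nu, admissible rmax dom G -> admissible rmax dom H ->
  periodic n G -> periodic n H -> psum n (fun i => G i - H i) = 0 ->
  (forall i, `|stress rmax dPhi G i - stress rmax dPhi H i - mu| <= nu) ->
  forall i, c * `|G i - H i| <= nu.

Lemma stress_linearZ rmax a k Z i :
  stress rmax (linear_response a) (fun j => k * Z j) i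
  = k * stress rmax (linear_response a) Z i.
Proof.
rewrite /stress mulr_sumr; apply: eq_bigr => r _.
rewrite mulrCA; congr (_ * _); rewrite mulr_sumr; apply: eq_bigr => l _.
by rewrite /linear_response ameanZ mulrCA.
Qed.

Lemma stress_linearB rmax a G H i :
  stress rmax (linear_response a) (fun j => G j - H j) i
  = stress rmax (linear_response a) G i - stress rmax (linear_response a) H i.
Proof.
rewrite /stress -sumrB; apply: eq_bigr => r _.
rewrite -mulrBr; congr (_ * _); rewrite -sumrB; apply: eq_bigr => l _.
by rewrite /linear_response ameanB mulrBr.
Qed.

Lemma stress_linear0 rmax a i :
  stress rmax (linear_response a) (fun=> 0) i = 0.
Proof.
have := stress_linearZ rmax a 0 (fun=> 0) i.
by rewrite !mul0r.
Qed.

(** Normalize [Z] to maximum norm 1 and integrate it to [w]. Against a test strain of unit mean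
    modulus the constant [mu] drops out, so the supremum is at most [nu / zeta]. *)
Lemma inf_sup_coercive n rmax (e x : R) a (B : (int -> R) -> (int -> R) -> R) :
  (0 < n)%N -> e != 0 -> 
  (forall r i, (1 <= r <= rmax)%N -> a r (i + n%:Z) = a r i) ->
  (forall w v, zero_mean n w -> zero_mean n v -> B w v = n%:R^-1 * psum n (fun i =>
     stress rmax (linear_response a) (diffq e 1 w) i * diffq e 1 v i)) ->
  (x%:E <= inf_sup n e B)%E ->
  coercive n rmax (linear_response a) (fun _ _ _ => True) x.
Proof.
move=> n0 e0 pa BE hx G H mu nu _ _ pG pH s0 hb i.
set Z := fun i => G i - H i in s0 *; rewrite -/(Z i).
have pZ : periodic n Z by move=> k; rewrite /Z pG pH.
have hbZ k : `|stress rmax (linear_response a) Z k - mu| <= nu.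
  by rewrite stress_linearB.
have nu0 : 0 <= nu by apply: le_trans (hbZ 0).
set zeta := norm_oo n Z.
have Zle k : `|Z k| <= zeta by exact: ge_norm_oo.
have [zE|zn] := eqVneq zeta 0.
  by have := Zle i; rewrite zE normr_le0 => /eqP ->; rewrite normr0 mulr0.
have z0 : 0 < zeta by rewrite lt_def zn norm_oo_ge0.
have iz0 : 0 <= zeta^-1 by rewrite invr_ge0 ltW.
have [w zmw Dw] := @antidifference R n e (fun k => zeta^-1 * Z k) n0 e0
   ltac:(by move=> k; rewrite pZ) ltac:(by rewrite psumZ s0 mulr0).
have wE : seminorm_1_oo n e w = 1.
  rewrite /seminorm_1_oo (_ : diffq e 1 w = fun k => zeta^-1 * Z k); last exact/funext.
  apply/eqP; rewrite eq_le; apply/andP; split.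
    apply: norm_oo_le => // k; rewrite normrM ger0_norm //.
    by rewrite mulrC ler_pdivrMr // mul1r.
  rewrite -(ler_pM2l z0) mulr1; apply: norm_oo_le; first by rewrite mulr_ge0 ?norm_oo_ge0 // ltW.
  move=> k; rewrite -ler_pdivrMl // -[X in X * _](ger0_norm iz0) -normrM.
  by apply: (@ge_norm_oo R n (fun k => zeta^-1 * Z k)) => // l; rewrite pZ.
have : x <= nu / zeta.
  rewrite -lee_fin; apply: (le_trans hx); apply: (@le_trans _ _ (sup [set t |
      exists2 v, zero_mean n v /\ seminorm_1_1 n e v = 1 & t = B w v])%:E).
    by apply: ereal_inf_lbound; exists w.
  rewrite lee_fin; set T := [set _ | _].
  (* Without test functions of unit seminorm the supremum is 0 by convention, still below the
     nonnegative right-hand side. *)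
  have [->|/set0P T0] := eqVneq T set0; first by rewrite sup0 divr_ge0 // ltW.
  apply: ge_sup => // _ [v [zmv v1] ->]; have [pv _] := zmv.
  have {}v1 : n%:R^-1 * psum n (fun k => `|diffq e 1 v k|) = 1.
    by rewrite -avgE // => k; rewrite (periodic_diffq e 1 pv).
  rewrite BE // -[leRHS]mulr1 -[X in _ <= _ * X]v1.
  rewrite mulrCA ler_wpM2l ?invr_ge0 ?ler0n //.
  have -> : psum n (fun i => stress rmax (linear_response a) (diffq e 1 w) i * diffq e 1 v i)
    = psum n (fun i => zeta^-1 * (stress rmax (linear_response a) Z i - mu) * diffq e 1 v i).
    apply/eqP; rewrite -subr_eq0 -psumB.
    rewrite (psum_ext n (v := fun i => zeta^-1 * mu * diffq e 1 v i)).
      by rewrite psumZ psum_diffq1 // mulr0.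
    move=> k; rewrite (_ : diffq e 1 w = fun k => zeta^-1 * Z k); last exact/funext.
    by rewrite stress_linearZ; ring.
  rewrite -psumZ; apply: ler_sum => k _; apply: (le_trans (ler_norm _)).
  rewrite normrM; apply: ler_wpM2r => //; rewrite normrM ger0_norm // mulrC.
  by apply: ler_wpM2r.
rewrite ler_pdivlMr // => h; have [x0|x0] := leP 0 x; last first.
  by apply: le_trans nu0; rewrite nmulr_rle0.
by apply: le_trans h; apply: ler_wpM2l.
Qed.

Lemma hessian_form_stress n rmax (e : R) Phi (F : nat -> int -> R) a w v :
  (0 < n)%N -> (forall r i, (1 <= r <= rmax)%N -> derive1n 2 (Phi r i) (F r i) = a r i) ->
  (forall r i, (1 <= r <= rmax)%N -> a r (i + n%:Z) = a r i) ->
  zero_mean n w -> zero_mean n v ->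
  hessian_form rmax n e Phi F w v = n%:R^-1 * psum n (fun i =>
     stress rmax (linear_response a) (diffq e 1 w) i * diffq e 1 v i).
Proof.
move=> n0 aE pa [pw _] [pv _]; rewrite -psum_stress; last 3 first.
- by move=> r i hr; rewrite /linear_response pa.
- exact: periodic_diffq.
- exact: periodic_diffq.
rewrite mulr_sumr /hessian_form big_nat_cond [RHS]big_nat_cond.
apply: eq_bigr => r; rewrite andbT ltnS => hr.
rewrite avgE; last first.
  by move=> i; rewrite !aE // pa // (periodic_diffq e r pw) (periodic_diffq e r pv).
congr (_ * _); apply: psum_ext => i; rewrite aE // /linear_response.
by have r0 : (0 < r)%N by [case/andP: hr]; rewrite -!diffq_amean.
Qed.

(* If the linearization is coercive with [2 c0] and the linearization error is
   at most [c], then either [c >= c0] and there is nothing to prove, or the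
   error is at most [c0]. *)
Lemma coercive_perturb n rmax dPhi dom a (kappa c c0 : R) :
  (0 < n)%N ->
  (forall r y s t, (1 <= r <= rmax)%N -> dom r y s -> dom r y t ->
     `|dPhi r y s - dPhi r y t - a r y * (s - t)| <= kappa * `|s - t|) ->
  0 <= kappa -> rmax%:R * kappa <= c ->
  coercive n rmax dPhi dom c ->
  coercive n rmax (linear_response a) (fun _ _ _ => True) (2 * c0) ->
  0 < c0 ->
  coercive n rmax dPhi dom c0.
Proof.
move=> n0 hd k0 kc hc hl c00 G H mu nu aG aH pG pH s0 hb i.
set Z := fun i => G i - H i in s0 *; rewrite -/(Z i).
have pZ : periodic n Z by move=> k; rewrite /Z pG pH.
set zeta := norm_oo n Z.
have Zle k : `|Z k| <= zeta by exact: ge_norm_oo.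
have z0 : 0 <= zeta by exact: norm_oo_ge0.
have cZ k : c * `|Z k| <= nu by exact: hc hb k.
have nu0 : 0 <= nu by apply: le_trans (hb 0).
have cz : c * zeta <= nu.
  have [->|zn] := eqVneq zeta 0; first by rewrite mulr0.
  have c_ge0 : 0 <= c by apply: le_trans kc; rewrite mulr_ge0.
  have [->|cn] := eqVneq c 0; first by rewrite mul0r.
  have c_gt0 : 0 < c by rewrite lt_def cn.
  by rewrite -ler_pdivlMl //; apply: norm_oo_le;
     [rewrite mulr_ge0 ?invr_ge0 | move=> k; rewrite ler_pdivlMl].
have hl1 k : 2 * c0 * `|Z k| <= nu + rmax%:R * (kappa * zeta).
  rewrite -[Z k]subr0; apply: (hl Z (fun=> 0) mu (nu + rmax%:R * (kappa * zeta))) => //.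
  - by rewrite (psum_ext n (v := Z)) // => l; rewrite subr0.
  - move=> l; rewrite stress_linear0 subr0.
    have h1 := @stress_linearize _ _ dPhi dom a kappa zeta G H l hd k0 aG aH (fun j _ => Zle j).
    have h2 := hb l; rewrite -/(linear_response a) -/Z in h1.
    by move: h1 h2; rewrite !ler_norml; lra.
(* Coercivity with [c] bounds the linearization error [c * zeta] by [nu]. The total is [2 * nu], and
   halving leaves [c0]. *)
have : 2 * c0 * `|Z i| <= nu + c * zeta.
  apply: (le_trans (hl1 i)); rewrite lerD2l mulrA; exact: ler_wpM2r.
lra.
Qed.

End Coercivity.

(** A Cauchy criterion. Intervals of radius [K d] around the quotients at scale [d] meet pairwise,
    so the supremum of their left ends lies in all of them; it is the strict derivative at 0. *)
Lemma strict_derivative_of_quotients (R : realType) (f : R -> R) (rho K : R) :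
  0 < rho -> 0 <= K ->
  (forall d z z' w w', d <= rho -> `|z| < d -> `|z'| < d -> `|w| < d -> `|w'| < d ->
     z != z' -> w != w' ->
     `|(f z - f z') / (z - z') - (f w - f w') / (w - w')| <= K * d) ->
  exists a, forall d z z', d <= rho -> `|z| < d -> `|z'| < d ->
     `|f z - f z' - a * (z - z')| <= K * d * `|z - z'|.
Proof.
move=> rho0 K0 H.
pose Q z z' := (f z - f z') / (z - z').
pose S : set R := [set x | exists d z z', [/\ d <= rho, `|z| < d, `|z'| < d, z != z' &
   x = Q z z' - K * d]].
have S0 : S !=set0.
  exists (Q (rho / 2) 0 - K * rho); exists rho, (rho / 2), 0; split => //.
  - by rewrite ger0_norm; lra.
  - by rewrite normr0.
  - by rewrite gt_eqF //; lra.
have ubS d w w' : d <= rho -> `|w| < d -> `|w'| < d -> w != w' ->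
    ubound S (Q w w' + K * d).
  move=> hd hw hw' ww' _ [d' [z [z' [hd' hz hz' zz' ->]]]].
  pose m := Num.max d d'.
  have := H m z z' w w'; rewrite ge_max !lt_max hd hd' hz hz' hw hw' !orbT /=.
  move=> /(_ _ _ _ _ _ zz' ww') H1.
  have {}H1 := H1 isT isT isT isT isT.
  have d0 : 0 < d by apply: le_lt_trans hw.
  have d0' : 0 < d' by apply: le_lt_trans hz.
  have : m <= d + d' by rewrite ge_max; apply/andP; split; lra.
  move=> /(ler_wpM2l K0); move: H1; rewrite ler_norml /Q; lra.
exists (sup S) => d z z' hd hz hz'.
have [->|zz'] := eqVneq z z'; first by rewrite !subrr mulr0 subrr normr0 mulr0.
have u1 : sup S <= Q z z' + K * d by apply: ge_sup => //; exact: ubS.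
have u2 : Q z z' - K * d <= sup S.
  apply: ub_le_sup; first by exists (Q z z' + K * d); exact: ubS.
  by exists d, z, z'.
have dz : z - z' != 0 by rewrite subr_eq0.
rewrite (_ : f z - f z' - _ = (Q z z' - sup S) * (z - z')); last by rewrite /Q mulrBl divfK.
by rewrite normrM; apply: ler_wpM2r => //; rewrite ler_norml; lra.
Qed.

(** * The homogenized stress *)

Section Homogenization.
Context {R : realType}.
Variables (p rmax : nat) (Phi dPhi : nat -> int -> R -> R) (Fs : int -> R)
  (a : nat -> int -> R) (C K c rho m m' : R) (M M' : nat -> R).
Let dom r y s := `|s - amean r Fs y| < rho.
Hypotheses (p_gt0 : (0 < p)%N) (rmax_gt0 : (0 < rmax)%N)
  (rho_gt0 : 0 < rho) (C_ge0 : 0 <= C) (K_ge0 : 0 <= K) (c_gt0 : 0 < c)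
  (per_F : periodic p Fs)
  (derive_Phi : forall r y z, (1 <= r <= rmax)%N -> dom r y z ->
     is_derive z 1 (Phi r y) (dPhi r y z))
  (strict_dPhi : forall d r y s t, d <= rho -> (1 <= r <= rmax)%N ->
     `|s - amean r Fs y| < d -> `|t - amean r Fs y| < d ->
     `|dPhi r y s - dPhi r y t - a r y * (s - t)| <= K * d * `|s - t|)
  (lip_dPhi : forall r y s t, (1 <= r <= rmax)%N -> dom r y s -> dom r y t ->
     `|dPhi r y s - dPhi r y t| <= C * `|s - t|)
  (mono : monotone_potentials rmax p dPhi dom m M)
  (mono_c : 2 * c <= m - 2 * \sum_(2 <= r < rmax.+1) M r)
  (mono_lin : monotone_potentials rmax p (linear_response a)
     (fun _ _ _ => True) m' M')
  (mono_lin_c : 2 * c <= m' - 2 * \sum_(2 <= r < rmax.+1) M' r)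
  (equil : forall i j, stress rmax dPhi Fs i = stress rmax dPhi Fs j).

(** The Lipschitz constant in [z] of the cell fluctuation: a shift by [z] changes the stress by at
    most [rmax C |z|], and coercivity divides by [c]. *)
Let L : R := rmax%:R * C / c.

Let L_ge0 : 0 <= L.
Proof. by rewrite /L divr_ge0 ?mulr_ge0 // ltW. Qed.

Lemma near_admissible (G : int -> R) (zeta : R) :
  (forall i, `|G i - Fs i| <= zeta) -> zeta < rho -> admissible rmax dom G.
Proof.
move=> hG hz r i hr; rewrite /dom -ameanB; apply: le_lt_trans hz.
by apply: norm_amean; case/andP: hr.
Qed.

Lemma mono_coercive : coercive p rmax dPhi dom c.
Proof. by move=> G H mu nu aG aH pG pH; exact: monotone_coercive mono mono_c c_gt0 aG aH pG pH. Qed.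

(** The uniform shift [Fs + z] has a stress within [rmax C |z|] of a constant, so solving with zero
    load corrects it by at most [L |z|]. The shift and the box radius, at most [rho / 4] each, keep
    all strains within [rho] of [Fs]. *)
Lemma cell_strain_exists (z : R) :
  `|z| < rho / 4 -> rmax%:R * C * `|z| < c * (rho / 4) ->
  exists W, [/\ periodic p W, psum p W = 0, forall i, `|W i| <= L * `|z| &
    forall i j, stress rmax dPhi (fun k => Fs k + z + W k) i
              = stress rmax dPhi (fun k => Fs k + z + W k) j].
Proof.
move=> hz1 hz2; set B := fun k => Fs k + z.
have aB r i : (1 <= r <= rmax)%N -> amean r B i = amean r Fs i + z.
  by move=> /andP[r0 _]; rewrite ameanD amean_const.
have domB r i s : (1 <= r <= rmax)%N -> `|s - amean r B i| <= rho / 4 -> dom r i s.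
  move=> hr; rewrite aB // /dom; move: hz1; rewrite !ltr_norml !ler_norml.
  by have := rho_gt0; lra.
have BF j : B j - Fs j = z by rewrite /B addrAC subrr add0r.
have hst i : `|stress rmax dPhi B i - stress rmax dPhi Fs i| <= rmax%:R * (C * `|z|).
  apply: (stress_lipschitz lip_dPhi) => //.
  - by apply: (@near_admissible B `|z|) => [j|]; [rewrite BF | have := rho_gt0; lra].
  - by apply: (@near_admissible Fs 0) => // j; rewrite subrr normr0.
  - by move=> j _; rewrite BF.
have monoB := monotone_subdomain rmax_gt0 domB mono.
have [W [pW sW bW eW]] := @stress_solvable R p rmax p_gt0 rmax_gt0 Phi dPhi B (fun=> 0)
  (rho / 4) m c (2 * (rmax%:R * (C * `|z|))) M ltac:(by move=> i; rewrite /B per_F)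
  ltac:(by []) ltac:(have := rho_gt0; lra)
  (fun r i s hr hs => derive_Phi hr (domB r i s hr hs)) monoB mono_c c_gt0
  ltac:(move=> i j; have := hst i; have := hst j; rewrite !ler_norml (equil i j); lra)
  ltac:(lra).
exists W; split => //.
  by move=> i; rewrite /L mulrAC ler_pdivlMr //; have := bW i; lra.
by move=> i j; have := eW i j; rewrite !subr0.
Qed.

Variables (X : R -> int -> R) (rho1 : R).
Hypotheses (rho1_gt0 : 0 < rho1) (rho1_small : (3 + L) * rho1 <= rho)
  (per_X : forall z, `|z| < rho1 -> periodic p (X z))
  (mean_X : forall z, `|z| < rho1 -> psum p (X z) = p%:R * z)
  (stress_X : forall z, `|z| < rho1 -> forall i j,
     stress rmax dPhi (X z) i = stress rmax dPhi (X z) j)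
  (X_near : forall z, `|z| < rho1 -> forall i, `|X z i - Fs i| <= (1 + L) * `|z|).

Let S z := stress rmax dPhi (X z) 0.

Lemma admissible_X z : `|z| < rho1 -> admissible rmax dom (X z).
Proof.
move=> hz; apply: (near_admissible (X_near hz)).
have h0 : 0 <= (1 + L) by rewrite addr_ge0.
have : (1 + L) * `|z| <= (1 + L) * rho1 by apply: ler_wpM2l => //; exact: ltW.
by have := rho1_gt0; have := rho1_small; lra.
Qed.

(* Compare the two strains [z' + (X z - z)] and [X z'] of equal mean. *)
Lemma X_fluctuation_lipschitz (c1 z z' : R) i :
  coercive p rmax dPhi dom c1 -> `|z| < rho1 -> `|z'| < rho1 ->
  c1 * `|(X z i - z) - (X z' i - z')| <= rmax%:R * C * `|z - z'|.
Proof.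
move=> hc hz hz'; pose G k := X z k - z + z'.
have pn0 : p%:R != 0 :> R by rewrite pnatr_eq0 -lt0n.
have aG : admissible rmax dom G.
  (* Exchanging the means costs up to [2 rho1] beyond [(1 + L) rho1]: the origin of [3 + L] in
     [rho1_small]. *)
  apply: (@near_admissible G ((1 + L) * `|z| + (`|z| + `|z'|))).
    move=> k; rewrite (_ : G k - Fs k = (X z k - Fs k) + (z' - z)); last by rewrite /G; ring.
    apply: (le_trans (ler_normD _ _)); apply: lerD; first exact: X_near.
    by rewrite distrC ler_normB.
  have : (1 + L) * `|z| <= (1 + L) * rho1 by apply: ler_wpM2l; [rewrite addr_ge0 | exact: ltW].
  by have := rho1_small; have := rho1_gt0; lra.
have := hc G (X z') (S z - S z') (rmax%:R * (C * `|z - z'|)) aG (admissible_X hz').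
rewrite -mulrA (_ : X z i - z - _ = G i - X z' i); last by rewrite /G; ring.
apply.
- by move=> k; rewrite /G per_X.
- exact: per_X.
- rewrite psumB /G psumD psumB !psum_const !mean_X //; ring.
move=> k; rewrite /S (stress_X hz 0 k) (stress_X hz' 0 k).
rewrite (_ : _ - _ = stress rmax dPhi G k - stress rmax dPhi (X z) k); last by ring.
apply: (stress_lipschitz lip_dPhi) => //; first exact: admissible_X.
move=> j _; rewrite (_ : _ - _ = - (z - z')) ?normrN //; by rewrite /G; ring.
Qed.

Lemma X_lipschitz z z' i : `|z| < rho1 -> `|z'| < rho1 ->
  `|X z i - X z' i| <= (1 + L) * `|z - z'|.
Proof.
move=> hz hz'; have := X_fluctuation_lipschitz i mono_coercive hz hz'.
rewrite -ler_pdivlMl // mulrA [c^-1 * _]mulrC -/L => h.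
rewrite (_ : X z i - X z' i = (X z i - z - (X z' i - z')) + (z - z')); last by ring.
by apply: (le_trans (ler_normD _ _)); rewrite mulrDl mul1r addrC lerD2l.
Qed.

(* The first-order term in the fluctuation vanishes by the cell problem, so no
   differentiability of [X] is needed. *)
Lemma derive_homogenized (z : R) : `|z| < rho1 ->
  is_derive z 1 (fun z : R => p%:R^-1 * field_energy p rmax Phi (X z)) (S z).
Proof.
move=> hz; apply/is_derive1P => eps eps0.
have p0 : 0 < p%:R :> R by rewrite ltr0n.
(* [D |h|^2] bounds the Taylor remainders, [C ((1 + L) |h|)^2] for each of the [rmax] ranges;
   [D + 1] below avoids dividing by 0. *)
set D := rmax%:R * (C * (1 + L) ^+ 2).
have D0 : 0 <= D by rewrite !mulr_ge0 ?exprn_ge0 ?addr_ge0.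
exists (Num.min (rho1 - `|z|) (eps / (D + 1))).
  by rewrite lt_min subr_gt0 hz divr_gt0 //; lra.
move=> h; rewrite lt_min => /andP[h1]; rewrite ltr_pdivlMr; last by lra.
move=> h2; have hzh : `|z + h| < rho1 by apply: (le_lt_trans (ler_normD _ _)); lra.
set V := fun k => X (z + h) k - X z k.
have bV k : `|V k| <= (1 + L) * `|h|.
  by rewrite /V; apply: (le_trans (X_lipschitz _ _ _)) => //; rewrite addrAC subrr add0r.
have pdPhi : forall r i, (1 <= r <= rmax)%N -> dPhi r (i + p%:Z) = dPhi r i by case: mono.
have pV : periodic p V by move=> k; rewrite /V !per_X.
(* The stress of [X z] is constant, so it sees [V] only through its mean, which is [h]. *)
have SV : S z * h = p%:R^-1 * psum p (fun k => stress rmax dPhi (X z) k * V k).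
  rewrite (psum_ext p (v := fun k => S z * V k)); last by move=> k; rewrite /S (stress_X hz 0 k).
  rewrite psumZ psumB !mean_X // -mulrBr [z + h - z]addrAC subrr add0r.
  by rewrite mulrCA mulKf // gt_eqF.
rewrite SV -psum_stress //; last exact: per_X.
rewrite -!mulrBr /field_energy -!sumrB normrM ger0_norm ?invr_ge0 ?ler0n //.
rewrite ler_pdivrMl //.
apply: (@le_trans _ _ (p%:R * (D * `|h| ^+ 2))); last first.
  rewrite ler_pM2l // expr2 mulrA; apply: ler_wpM2r => //.
  by have := normr_ge0 h; nra.
have -> : p%:R * (D * `|h| ^+ 2) = \sum_(1 <= r < rmax.+1) (p%:R * (C * ((1 + L) * `|h|) ^+ 2)).
  by rewrite sumr_const_nat subSS subn0 -[RHS]mulr_natl /D exprMn; ring.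
apply: (le_trans (ler_norm_sum _ _ _)).
rewrite big_nat_cond [leRHS]big_nat_cond; apply: ler_sum => r; rewrite andbT ltnS => hr.
rewrite -!psumB; apply: ler_norm_psum => i.
rewrite ameanB.
have B s : dom r i s -> ball (amean r Fs i) rho s by rewrite /dom /ball /= distrC.
have := @taylor2_ball R (Phi r i) (dPhi r i) (amean r Fs i) rho C _ _
  (amean r (X (z + h)) i) (amean r (X z) i) (B _ (admissible_X hzh _ hr)) (B _ (admissible_X hz _ hr)).
move=> H; apply: (le_trans (H _ _)).
- by move=> s; rewrite /ball /= distrC; exact: derive_Phi.
- by move=> s t; rewrite /ball /= ![`|amean _ _ _ - _|]distrC; exact: lip_dPhi.
apply: ler_wpM2l => //; rewrite ler_pXn2r ?nnegrE ?mulr_ge0 ?addr_ge0 //.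
rewrite -ameanB; apply: norm_amean => [|l _]; first by case/andP: hr.
exact: bV.
Qed.

Lemma linear_response_bound r y : (1 <= r <= rmax)%N -> `|a r y| <= C + K * rho.
Proof.
move=> hr; have r0 := rho_gt0; set t := amean r Fs y.
have dt : `|t - amean r Fs y| < rho by rewrite subrr normr0.
have ds : `|t + rho / 2 - amean r Fs y| < rho.
  by rewrite addrAC subrr add0r ger0_norm; lra.
have h1 := lip_dPhi hr ds dt; have h2 := strict_dPhi (lexx _) hr ds dt.
move: h1 h2; rewrite (_ : t + rho / 2 - t = rho / 2); last by rewrite addrAC subrr add0r.
have rp : 0 < rho / 2 by lra.
rewrite (ger0_norm (ltW rp)) => h1 h2.
rewrite -(ler_pM2r rp) -{1}(ger0_norm (ltW rp)) -normrM mulrDl.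
by move: h1 h2; rewrite !ler_norml; lra.
Qed.

(** [X] need not be differentiable. Its difference quotients [Y] have mean 1 and linearized stress
    within [E d] of a constant, so coercivity of the linearized stress brings any two of them
    together, and with them the quotients of [S]. *)
Lemma strict_derivative_homogenized_stress : exists2 K1, 0 <= K1 &
  exists a0, forall d z z', d <= rho1 -> `|z| < d -> `|z'| < d ->
    `|S z - S z' - a0 * (z - z')| <= K1 * d * `|z - z'|.
Proof.
set Ca := C + K * rho; set E := rmax%:R * (K * (1 + L) * (1 + L)).
have Ca0 : 0 <= Ca by rewrite addr_ge0 ?mulr_ge0 // ltW.
have L1 : 0 <= 1 + L by rewrite addr_ge0.
have E0 : 0 <= E by rewrite !mulr_ge0.
have Ec0 : 0 <= 2 * E / c by rewrite divr_ge0 ?mulr_ge0 // ltW.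
have K10 : 0 <= 2 * E + rmax%:R * (Ca * (2 * E / c)).
  by apply: addr_ge0; [exact: mulr_ge0 | do 2! [apply: mulr_ge0 => //]].
(* [2 E] for replacing two quotients of [S] by linearized stresses, and the rest for the distance
   [2 E d / c] between the two fields [Y]. *)
exists (2 * E + rmax%:R * (Ca * (2 * E / c))) => //.
apply: strict_derivative_of_quotients => // d z z' w w' hd hz hz' hw hw' zz' ww'.
pose Y z z' k := (z - z')^-1 * (X z k - X z' k).
have d0 : 0 < d by apply: le_lt_trans hz.
have p0 : p%:R != 0 :> R by rewrite pnatr_eq0 -lt0n.
have lt1 (s : R) : `|s| < d -> `|s| < rho1 by move=> h; apply: lt_le_trans hd.
have quot (s s' : R) k : `|s| < d -> `|s'| < d -> s != s' ->
    `|(S s - S s') / (s - s') - stress rmax (linear_response a) (Y s s') k| <= E * d.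
  move=> hs hs' ss'; have q0 : 0 < `|s - s'| by rewrite normr_gt0 subr_eq0.
  have dq : s - s' != 0 by rewrite subr_eq0.
  have near (s1 : R) : `|s1| < d -> admissible rmax (fun r y x => `|x - amean r Fs y| < (1 + L) * d) (X s1).
    move=> h1 r i hr; rewrite -ameanB; apply: (@le_lt_trans _ _ ((1 + L) * `|s1|)).
      by apply: norm_amean; [case/andP: hr | move=> l _; exact: (X_near (lt1 _ h1))].
    by rewrite ltr_pM2l //; apply: ltr_wpDr.
  have hd' : (1 + L) * d <= rho.
    have : (1 + L) * d <= (1 + L) * rho1 by exact: ler_wpM2l.
    by have := rho1_small; have := rho1_gt0; lra.
  have := @stress_linearize R rmax dPhi _ a (K * ((1 + L) * d)) ((1 + L) * `|s - s'|)
    (X s) (X s') k (fun r y x t hr hx ht => strict_dPhi hd' hr hx ht)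
    ltac:(by rewrite !mulr_ge0 // ltW) (near s hs) (near s' hs')
    (fun j _ => X_lipschitz j (lt1 _ hs) (lt1 _ hs')).
  rewrite -/(linear_response a) (stress_X (lt1 _ hs) k 0) (stress_X (lt1 _ hs') k 0) -/(S s) -/(S s') => H.
  rewrite /Y stress_linearZ [(S s - S s') / _]mulrC -mulrBr normrM normfV.
  rewrite ler_pdivrMl //; apply: (le_trans H); rewrite /E.
  by rewrite le_eqVlt; apply/orP; left; apply/eqP; ring.
have meanY (s s' : R) : `|s| < d -> `|s'| < d -> s != s' -> psum p (Y s s') = p%:R.
  move=> hs hs' ss'; rewrite psumZ psumB !mean_X; [|exact: lt1|exact: lt1].
  by rewrite -mulrBr mulrCA mulVf ?mulr1 // subr_eq0.
have perY (s s' : R) : `|s| < d -> `|s'| < d -> periodic p (Y s s').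
  by move=> hs hs' k; rewrite /Y !per_X //; exact: lt1.
set Q := (S z - S z') / _; set Q' := (S w - S w') / _.
have hY k : c * `|Y z z' k - Y w w' k| <= 2 * E * d.
  apply: (monotone_coercive p_gt0 rmax_gt0 mono_lin mono_lin_c c_gt0 (mu := Q - Q')) => //.
  - exact: perY.
  - exact: perY.
  - by rewrite psumB !meanY // subrr.
  move=> l; have := quot z z' l hz hz' zz'; have := quot w w' l hw hw' ww'.
  by rewrite -/Q -/Q' !ler_norml; lra.
have := @stress_lipschitz R rmax (linear_response a) (fun _ _ _ => True) Ca (2 * E / c * d)
  (Y z z') (Y w w') 0 _ Ca0.
have -> : (2 * E + rmax%:R * (Ca * (2 * E / c))) * d
    = 2 * E * d + rmax%:R * (Ca * (2 * E / c * d)) by ring.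
move=> H; have {}H := H ltac:(by move=> r y s t hr _ _;
   rewrite /linear_response -mulrBr normrM; apply: ler_wpM2r => //; exact: linear_response_bound)
   ltac:(by []) ltac:(by [])
   ltac:(by move=> j _; rewrite mulrAC ler_pdivlMr // mulrC; exact: hY).
have := quot z z' 0 hz hz' zz'; have := quot w w' 0 hw hw' ww'.
by move: H; rewrite -/Q -/Q' !ler_norml; lra.
Qed.

End Homogenization.

(** * Element averages of the load *)

Section Mesh.
Context {R : realType}.
Variables (N : nat) (nodes : set int) (h : int -> R).
Hypotheses (N_gt0 : (0 < N)%N) (meshN : is_mesh N nodes)
  (sizeh : is_mesh_size N nodes h).

Lemma element_exists (i : int) : exists ab : int * int,
  consecutive_nodes nodes ab.1 ab.2 /\ ab.1 <= i < ab.2.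
Proof.
have [[x0 hx0] per] := meshN.
have perk (k : nat) j : nodes (j + k%:Z * N%:Z) <-> nodes j.
  elim: k j => [|k IH] j; first by rewrite mul0r addr0.
  by rewrite (_ : j + k.+1%:Z * N%:Z = j + k%:Z * N%:Z + N%:Z) ?per ?IH //; lia.
have perz (q j : int) : nodes j -> nodes (j + q * N%:Z).
  case: q => k; first by move=> hj; apply/perk.
  by move=> hj; apply/(perk k.+1); rewrite NegzE mulNr subrK.
have lo : exists k : nat, `[< nodes (i - k%:Z) >].
  exists (absz (i - (x0 + ((i - x0) %/ N%:Z)%Z * N%:Z))%R); apply/asboolP.
  rewrite (_ : i - _ = x0 + ((i - x0) %/ N%:Z)%Z * N%:Z); first exact: perz.
  by have := divz_eq (i - x0) N%:Z; have := modz_ge0 (i - x0) (_ : N%:Z != 0); lia.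
have hi : exists k : nat, `[< nodes (i + 1 + k%:Z) >].
  exists (absz (x0 + (((i - x0) %/ N%:Z)%Z + 1) * N%:Z - (i + 1))%R); apply/asboolP.
  rewrite (_ : i + 1 + _ = x0 + (((i - x0) %/ N%:Z)%Z + 1) * N%:Z); first exact: perz.
  by have := divz_eq (i - x0) N%:Z; have := ltz_pmod (i - x0) (_ : 0 < N%:Z); lia.
exists (i - (ex_minn lo)%:Z, i + 1 + (ex_minn hi)%:Z) => /=.
case: ex_minnP => a /asboolP na mina; case: ex_minnP => b /asboolP nb minb.
split; last by lia.
split => //; first by lia.
move=> c hc nc; have [ci|ci] := lerP c i.
  have := mina (absz (i - c)); rewrite (_ : i - (absz (i - c))%:Z = c); last by lia.
  by move=> H; have := H (asboolT nc); lia.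
have := minb (absz (c - (i + 1))%R); rewrite (_ : i + 1 + (absz (c - (i + 1))%R)%:Z = c); last by lia.
by move=> H; have := H (asboolT nc); lia.
Qed.

Lemma element_unique i a b a' b' :
  consecutive_nodes nodes a b -> a <= i < b ->
  consecutive_nodes nodes a' b' -> a' <= i < b' -> a = a' /\ b = b'.
Proof.
move=> [na nb ab hab] hi [na' nb' ab' hab'] hi'.
have [l1|l1|e1] := ltgtP a a'; first by case: (hab a') => //; lia.
  by case: (hab' a) => //; lia.
have [l2|l2|//] := ltgtP b b'; first by case: (hab' b) => //; lia.
by case: (hab b') => //; lia.
Qed.

Lemma consecutive_shift a b :
  consecutive_nodes nodes a b -> consecutive_nodes nodes (a + N%:Z) (b + N%:Z).
Proof.
have [_ per] := meshN; move=> [na nb ab hab]; split; [exact/per | exact/per | lia |].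
move=> c hc nc; apply: (hab (c - N%:Z)); first by lia.
by apply/per; rewrite subrK.
Qed.

Lemma periodic_mesh_size : periodic N h.
Proof.
move=> i; have [[a b] /= [cab hi]] := element_exists i.
rewrite (sizeh cab hi) (sizeh (consecutive_shift cab)); last by lia.
by congr (_%:~R / _); lia.
Qed.

Variables (f g : int -> R) (eta : R).
Hypotheses (per_g : periodic N g) (eta_bound : forall i, `|h i * f i| <= eta)
  (g_step : forall i, g (i - 1) - g i = N%:R^-1 * f i).

(** The element has [b - a] sites and size [(b - a) / N], so the factor [1 / N] in the step of [g]
    cancels against [h]. *)
Lemma load_step a b j : consecutive_nodes nodes a b -> a <= j < b ->
  `|g j - g (j - 1)| <= eta / (b - a)%:~R.
Proof.
move=> cab hj; have ab : 0 < (b - a)%:~R :> R by rewrite ltr0z; lia.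
have iN0 : 0 <= N%:R^-1 :> R by rewrite invr_ge0.
rewrite distrC g_step ler_pdivlMr //; have := eta_bound j; rewrite (sizeh cab hj).
apply: le_trans; rewrite !normrM (ger0_norm (ltW ab)) (ger0_norm iN0).
by rewrite le_eqVlt; apply/orP; left; apply/eqP; ring.
Qed.

Lemma load_bound_ge0 : 0 <= eta.
Proof. by apply: le_trans (eta_bound 0). Qed.

Lemma load_jump i : `|g (i + 1) - g i| <= eta.
Proof.
have [[a b] /= [cab hi]] := element_exists (i + 1).
have := load_step cab hi; rewrite addrK => H; apply: (le_trans H).
have ab : 0 < (b - a)%:~R :> R by rewrite ltr0z; lia.
rewrite ler_pdivrMr // ler_peMr ?load_bound_ge0 //.
by rewrite -[1]/(1%:~R) ler_int; lia.
Qed.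

(** Fewer than [b - a] steps, each at most [eta / (b - a)]. *)
Lemma load_osc_element a b i j : consecutive_nodes nodes a b ->
  a <= i < b -> a <= j < b -> `|g j - g i| <= eta.
Proof.
move=> cab; wlog : i j / i <= j => [H hi hj|ij hi hj].
  by case: (lerP i j) => [|/ltW] ij; [exact: H | rewrite distrC; exact: H].
have ab : 0 < (b - a)%:~R :> R by rewrite ltr0z; lia.
have K (k : nat) : i + k%:Z < b -> `|g (i + k%:Z) - g i| <= k%:R * (eta / (b - a)%:~R).
  elim: k => [|k IH] hk; first by rewrite addr0 subrr normr0 mul0r.
  rewrite (_ : g (i + k.+1%:Z) - g i =
    (g (i + k%:Z) - g i) + (g (i + k.+1%:Z) - g (i + k.+1%:Z - 1))); last first.
    by rewrite (_ : i + k.+1%:Z - 1 = i + k%:Z); [ring | lia].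
  apply: (le_trans (ler_normD _ _)); rewrite -[k.+1]addn1 natrD mulrDl mul1r.
  by apply: lerD; [apply: IH; lia | apply: load_step => //; lia].
have jE : j = i + (absz (j - i))%:Z by lia.
rewrite jE; apply: (le_trans (K _ _)); first by lia.
rewrite mulrCA ler_piMr ?load_bound_ge0 // ler_pdivrMr // mul1r.
by rewrite -[(absz _)%:R]/((absz (j - i))%:Z%:~R) ler_int; lia.
Qed.

(** Element averages, unlike point values, leave the pairing with coarse strains exact while moving
    the load by at most [eta]. *)
Lemma element_average : exists gb : int -> R,
  [/\ periodic N gb, forall i, ~ nodes i -> gb (i - 1) = gb i,
      forall i, `|gb i - g i| <= eta,
      forall tau, (forall i j, g i - g j <= tau) -> forall i j, gb i - gb j <= tau &
      forall V, periodic N V -> (forall i, ~ nodes i -> V (i - 1) = V i) ->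
        psum N (fun i => gb i * V i) = psum N (fun i => g i * V i)].
Proof.
have [E hE] := boolp.choice element_exists.
pose A i := (E i).1; pose B i := (E i).2.
have cE i : consecutive_nodes nodes (A i) (B i) by case: (hE i).
have iE i : A i <= i < B i by case: (hE i).
pose len i := absz (B i - A i).
have len_gt0 i : (0 < len i)%N by rewrite /len; have := iE i; lia.
pose gb i := (len i)%:R^-1 * \sum_(k < len i) g (A i + k%:Z).
have EN i : A (i + N%:Z) = A i + N%:Z /\ B (i + N%:Z) = B i + N%:Z.
  apply: (element_unique (cE _) (iE _) (consecutive_shift (cE i))).
  by have := iE i; lia.
have ES i : ~ nodes i -> A (i - 1) = A i /\ B (i - 1) = B i.
  move=> ni; apply: (element_unique (cE _) (iE _) (cE i)).
  have [na _ _ _] := cE i; have : A i != i by apply/eqP => e; apply: ni; rewrite -e.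
  by have := iE i; lia.
have Av c i : (forall k : nat, (k < len i)%N -> `|g (A i + k%:Z) - c| <= eta) -> `|gb i - c| <= eta.
  move=> H; have l0 : (len i)%:R != 0 :> R by rewrite pnatr_eq0 -lt0n.
  rewrite (_ : gb i - c = (len i)%:R^-1 * \sum_(k < len i) (g (A i + k%:Z) - c)).
    by apply: norm_window_mean => // k; apply: H.
  by rewrite sumrB sumr_const card_ord mulrBr -[c *+ _]mulr_natl mulKf.
have gb_le i c : (forall j, g j <= c) -> gb i <= c.
  move=> H; rewrite /gb ler_pdivrMl ?ltr0n // -[_ * c]/(_ * c).
  apply: (@le_trans _ _ (\sum_(k < len i) c)); first by apply: ler_sum.
  by rewrite sumr_const card_ord -[c *+ _]mulr_natl.
have gb_ge i c : (forall j, c <= g j) -> c <= gb i.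
  move=> H; rewrite /gb ler_pdivlMl ?ltr0n //.
  apply: (@le_trans _ _ (\sum_(k < len i) c)); last by apply: ler_sum.
  by rewrite sumr_const card_ord -[c *+ _]mulr_natl.
have pgb : periodic N gb.
  move=> i; rewrite /gb /len; have [-> ->] := EN i.
  rewrite (_ : B i + N%:Z - (A i + N%:Z) = B i - A i); last by lia.
  by congr (_ * _); apply: eq_bigr => k _; rewrite addrAC per_g.
have sgb i : ~ nodes i -> gb (i - 1) = gb i.
  by move=> ni; rewrite /gb /len; have [-> ->] := ES i ni.
exists gb; split => //.
- move=> i; apply: Av => k hk; apply: (load_osc_element (cE i)) => //.
  by move: hk; rewrite /len; have := iE i; lia.
- move=> tau H i j; rewrite lerBlDr; apply: gb_le => k.
  by rewrite -lerBlDl; apply: gb_ge => l; rewrite lerBlDl -lerBlDr.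
move=> V pV sV.
(* [Gam] is the antidifference of [g - gb] that vanishes at the nodes, so
   summation by parts kills it against piecewise constant [V]. *)
pose phi i := g i - gb i.
pose Gam i := \sum_(k < absz (i - A i)) phi (A i + k%:Z).
have gbA i k : (k < len i)%N -> gb (A i + k%:Z) = gb i.
  move=> hk; rewrite /gb /len.
  have [-> -> //] := element_unique (cE (A i + k%:Z)) (iE _) (cE i)
    ltac:(by move: hk; rewrite /len; have := iE i; lia).
have GamS i : Gam (i + 1) - Gam i = phi i.
  have GS : \sum_(k < (absz (i - A i)).+1) phi (A i + k%:Z) = Gam i + phi i.
    by rewrite big_ord_recr /=; congr (_ + phi _); have := iE i; lia.
  (* If [i] is the last site of its element, the sum of [phi] over the whole element vanishes, which
     matches the restart of [Gam] at 0. *)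
  have [ni|ni] := pselect (nodes (i + 1)).
    have Ai : A (i + 1) = i + 1.
      have [_ _ _ H] := cE (i + 1); apply/eqP/negPn/negP => /eqP ne.
      by apply: (H (i + 1)) => //; have := iE (i + 1); lia.
    have Bi : B i = i + 1.
      have [_ _ _ H] := cE i; apply/eqP/negPn/negP => /eqP ne.
      by apply: (H (i + 1)) => //; have := iE i; lia.
    have lE : (absz (i - A i)).+1 = len i by rewrite /len Bi; have := iE i; lia.
    rewrite {1}/Gam Ai subrr big_ord0 sub0r; apply/eqP; rewrite eq_sym -addr_eq0 addrC -GS lE.
    rewrite /phi sumrB [X in _ - X](eq_bigr (fun=> gb i)); last by move=> k _; rewrite gbA.
    rewrite sumr_const card_ord -[gb i *+ _]mulr_natl.
    by rewrite [X in _ * X]/gb mulVKf ?subrr // pnatr_eq0 -lt0n.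
  have [AS _] := ES (i + 1) ni; rewrite addrK in AS.
  rewrite {1}/Gam -AS (_ : absz (i + 1 - A i)%R = (absz (i - A i)%R).+1); last by have := iE i; lia.
  by rewrite GS addrC addKr.
have pGam : periodic N Gam.
  move=> i; rewrite /Gam; have [-> _] := EN i.
  rewrite (_ : i + N%:Z - (A i + N%:Z) = i - A i); last by lia.
  by apply: eq_bigr => k _; rewrite /phi addrAC per_g pgb.
apply/eqP; rewrite eq_sym -subr_eq0 -psumB.
rewrite (psum_ext N (v := fun i => (Gam (i + 1) - Gam i) * V i)); last first.
  by move=> i; rewrite GamS mulrBl.
rewrite psum_by_parts // oppr_eq0 /psum big1 // => k _.
have [nk|nk] := pselect (nodes k%:Z); last by rewrite sV // subrr mulr0.
rewrite /Gam (_ : A k%:Z = k%:Z) ?subrr ?big_ord0 ?mul0r //.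
have [_ _ _ H] := cE k%:Z; apply/eqP/negPn/negP => /eqP ne.
by apply: (H k%:Z) => //; have := iE k%:Z; lia.
Qed.

End Mesh.

(** * Variations and loads *)

Section Variations.
Context {R : realType}.
Implicit Types (u v w f g : int -> R).

Lemma psum_load (N : nat) f g v : (0 < N)%N -> periodic N g -> periodic N v ->
  (forall i, g (i - 1) - g i = N%:R^-1 * f i) ->
  psum N (fun i => f i * v i) = psum N (fun i => g i * diffq N%:R^-1 1 v i).
Proof.
move=> N0 pg pv H; have Nn : N%:R != 0 :> R by rewrite pnatr_eq0 -lt0n.
rewrite (psum_ext N (v := fun i => - (N%:R * ((g i - g (i - 1)) * v i)))); last first.
  move=> i; have -> : f i = N%:R * (g (i - 1) - g i) by rewrite H mulVKf.
  by ring.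
rewrite psumN psumZ.
have := @psum_by_parts R N (fun i => g (i - 1)) v ltac:(by move=> i; rewrite addrAC pg) pv.
rewrite (psum_ext N (v := fun i => (g i - g (i - 1)) * v i)); last by move=> i; rewrite addrK.
move=> ->; rewrite mulrN opprK -psumZ.
rewrite -(@psum_shift R N _ 1); last by move=> i; rewrite -addrA (addrC N%:Z) addrA pg !pv // addrAC pv.
by apply: psum_ext => i; rewrite addrK diffq1E invrK; ring.
Qed.

Lemma load_exists (N : nat) f : (0 < N)%N -> zero_mean N f ->
  exists2 g, periodic N g & forall i, g (i - 1) - g i = N%:R^-1 * f i.
Proof.
move=> N0 /(zero_meanP _ N0)[pf sf].
have [w [pw _] Dw] := @antidifference R N 1 (fun i => - (N%:R^-1 * f (i + 1))) N0 (oner_neq0 _)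
  ltac:(by move=> i; rewrite addrAC pf) ltac:(by rewrite psumN psumZ psum_shift // sf mulr0 oppr0).
exists w => // i; have := Dw (i - 1); rewrite diffq1E divr1 subrK => e.
by apply: oppr_inj; rewrite -e opprB.
Qed.

(** A test function whose strain is a positive spike at [i] and a negative one at [j] pairs with [f]
    to half of [g i - g j]. *)
Lemma norm_load_osc (N : nat) f g (rho : R) : (0 < N)%N -> zero_mean N f ->
  periodic N g -> (forall i, g (i - 1) - g i = N%:R^-1 * f i) ->
  0 <= rho -> seminorm_m1_oo N N%:R^-1 f <= rho -> forall i j, g i - g j <= 2 * rho.
Proof.
move=> N0 zf pg H rho0 hf i j.
have Nn : N%:R != 0 :> R by rewrite pnatr_eq0 -lt0n.
have Np : 0 < N%:R :> R by rewrite ltr0n.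
have [e|ne] := boolP (N%:Z %| i - j)%Z.
  case/dvdzP: e => q e; have -> : g i = g j.
    by rewrite -(periodicMz pg q j) -e; congr g; lia.
  by rewrite subrr mulr_ge0.
(* The factor [N / 2] gives the test function unit [seminorm_1_1]. *)
pose V k := N%:R / 2 * (spike R N i k - spike R N j k).
have pV : periodic N V by move=> k; rewrite /V !periodic_spike.
have sV : psum N V = 0 by rewrite psumZ psumB !psum_spike1 // subrr mulr0.
have [v zv Dv] := @antidifference R N N%:R^-1 V N0 (invr_neq0 Nn) pV sV.
have nV : psum N (fun k => `|V k|) = N%:R.
  rewrite (psum_ext N (v := fun k => N%:R / 2 * (spike R N i k + spike R N j k))).
    by rewrite psumZ psumD !psum_spike1 // -mulrA mulVf ?mulr1 // gt_eqF.
  move=> k; rewrite normrM ger0_norm ?divr_ge0 //; congr (_ * _).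
  rewrite /spike; case di : (N%:Z %| k - i)%Z; case dj : (N%:Z %| k - j)%Z => /=.
  - case/negP: ne; rewrite (_ : i - j = (k - j) - (k - i)); last by lia.
    by rewrite rpredB.
  - by rewrite subr0 addr0 normr1.
  - by rewrite sub0r add0r normrN normr1.
  - by rewrite subrr addr0 normr0.
have pv : periodic N v by case: zv.
have pairing w : zero_mean N w ->
    avg N (fun k => f k * w k) = N%:R^-1 * psum N (fun k => g k * diffq N%:R^-1 1 w k).
  move=> [pw _]; have [pf _] := zf.
  by rewrite avgE ?(psum_load N0 pg pw H) // => k; rewrite pf pw.
have gv : avg N (fun k => f k * v k) = (g i - g j) / 2.
  rewrite pairing // (psum_ext N (v := fun k => N%:R / 2 * (g k * spike R N i k - g k * spike R N j k))).
    by rewrite psumZ psumB !psum_spike // -[N%:R / 2 * _]mulrA mulKf // mulrC.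
  by move=> k; rewrite Dv /V; ring.
suff : (g i - g j) / 2 <= rho by lra.
apply: le_trans hf; rewrite -gv /seminorm_m1_oo; apply: ub_le_sup; last first.
  exists v => //; split => //; rewrite /seminorm_1_1 /norm_1 avgE.
    by rewrite (psum_ext N (v := fun k => `|V k|)) ?nV ?mulVf // => k; rewrite Dv.
  by move=> k; rewrite (periodic_diffq _ 1 pv).
(* The set must be bounded above for [sup] to dominate its elements. *)
exists (norm_oo N g) => _ [w [zw w1] ->]; have [pw _] := zw.
rewrite pairing // -[leRHS]mulr1; rewrite /seminorm_1_1 /norm_1 avgE in w1; last first.
  by move=> k; rewrite (periodic_diffq _ 1 pw).
rewrite -[X in _ <= _ * X]w1 mulrCA ler_pM2l ?invr_gt0 // -psumZ.
apply: ler_sum => k _; apply: (le_trans (ler_norm _)); rewrite normrM.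
by apply: ler_wpM2r => //; exact: ge_norm_oo.
Qed.

Lemma zero_mean_eq (N : nat) (e : R) u v : (0 < N)%N -> e != 0 -> zero_mean N u -> zero_mean N v ->
  (forall i, diffq e 1 u i = diffq e 1 v i) -> u = v.
Proof.
move=> N0 e0 zu zv D; have [pu su] := (zero_meanP u N0).1 zu; have [pv sv] := (zero_meanP v N0).1 zv.
have zw : zero_mean N (fun i => u i - v i).
  by apply/zero_meanP => //; split; [move=> i; rewrite pu pv | rewrite psumB su sv subrr].
apply/funext => i; apply/eqP; rewrite -subr_eq0 -normr_le0.
rewrite -(mulr0 N%:R); apply: (zero_mean_bound N0 zw) => k.
rewrite normr_le0; apply/eqP; have := D k; rewrite !diffq1E => /(mulIf (invr_neq0 e0)) E.
by rewrite (_ : _ - _ = (u (k + 1) - u k) - (v (k + 1) - v k)); [rewrite E subrr | ring].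
Qed.

Lemma diffqDZ (e : R) r u v t i :
  diffq e r (fun k => u k + t * v k) i = diffq e r u i + t * diffq e r v i.
Proof. by rewrite /diffq; ring. Qed.

Lemma diffqB (e : R) r u v i :
  diffq e r (fun k => u k - v k) i = diffq e r u i - diffq e r v i.
Proof. by rewrite /diffq; ring. Qed.

Lemma energy_field (rmax N : nat) (Phi : nat -> int -> R -> R) u : (0 < N)%N ->
  (forall r i, (1 <= r <= rmax)%N -> Phi r (i + N%:Z) = Phi r i) -> periodic N u ->
  energy rmax N Phi u = N%:R^-1 * field_energy N rmax Phi (diffq N%:R^-1 1 u).
Proof.
move=> N0 pP pu; rewrite /energy avgE.
  congr (_ * _); rewrite /psum /field_energy exchange_big /=.
  rewrite big_nat_cond [RHS]big_nat_cond; apply: eq_bigr => r; rewrite andbT ltnS => /andP[r0 _].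
  by apply: eq_bigr => i _; rewrite diffq_amean.
move=> i; rewrite big_nat_cond [RHS]big_nat_cond; apply: eq_bigr => r; rewrite andbT ltnS => hr.
by rewrite pP // (periodic_diffq _ r pu).
Qed.

Lemma energy_variationE (rmax N : nat) (Phi dPhi : nat -> int -> R -> R) u v :
  (0 < N)%N ->
  (forall r i, (1 <= r <= rmax)%N -> Phi r (i + N%:Z) = Phi r i) ->
  (forall r i, (1 <= r <= rmax)%N -> dPhi r (i + N%:Z) = dPhi r i) ->
  periodic N u -> periodic N v ->
  (forall r i, (1 <= r <= rmax)%N -> is_derive (amean r (diffq N%:R^-1 1 u) i) 1
     (Phi r i) (dPhi r i (amean r (diffq N%:R^-1 1 u) i))) ->
  energy_variation rmax N Phi u v = N%:R^-1 * psum N (fun i =>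
    stress rmax dPhi (diffq N%:R^-1 1 u) i * diffq N%:R^-1 1 v i).
Proof.
move=> N0 pP pdP pu pv dP; rewrite /energy_variation; apply: is_derive1_unique.
rewrite (_ : (fun t => _) = N%:R^-1 \*: (fun t : R => field_energy N rmax Phi
    (fun i => diffq N%:R^-1 1 u i + t * diffq N%:R^-1 1 v i))); last first.
  apply/funext => t; rewrite energy_field //; last by move=> i; rewrite pu pv.
  by rewrite /GRing.scale_fun /=; congr (_ * field_energy _ _ _ _); apply/funext => i; rewrite diffqDZ.
apply: is_deriveZ; apply: is_derive_field_energy => //; exact: periodic_diffq.
Qed.

Lemma const_of_test (N : nat) (e : R) (psi : int -> R) : (0 < N)%N -> e != 0 -> periodic N psi ->
  (forall v, zero_mean N v -> psum N (fun i => psi i * diffq e 1 v i) = 0) ->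
  forall i j, psi i = psi j.
Proof.
move=> N0 e0 pp H; apply: (const_of_spikes N0 pp) => V pV sV.
have [v zv Dv] := antidifference N0 e0 pV sV; rewrite -(H v zv).
by apply: psum_ext => i; rewrite Dv.
Qed.

Lemma psum_const_test (N : nat) (e : R) (psi : int -> R) v : periodic N v ->
  (forall i j, psi i = psi j) -> psum N (fun i => psi i * diffq e 1 v i) = 0.
Proof.
move=> pv H; rewrite (psum_ext N (v := fun i => psi 0 * diffq e 1 v i)).
  by rewrite psumZ psum_diffq1 // mulr0.
by move=> i; rewrite (H i 0).
Qed.

Lemma cell_workE (p rmax : nat) (Phi : nat -> int -> R -> R) G (F : nat -> int -> R) eta :
  (0 < p)%N ->
  (forall r y, (1 <= r <= rmax)%N -> Phi r (y + p%:Z) = Phi r y) ->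
  periodic p G -> periodic p eta ->
  (forall r y, (1 <= r <= rmax)%N -> F r y = amean r G y) ->
  cell_work p rmax Phi F eta = p%:R^-1 * psum p (fun y =>
    stress rmax (fun r y => derive1 (Phi r y)) G y * diffq 1 1 eta y).
Proof.
move=> p0 pP pG pe FE; rewrite -psum_stress //; last 2 first.
- by move=> r i hr; rewrite pP.
- exact: periodic_diffq.
rewrite /cell_work mulr_sumr big_nat_cond [RHS]big_nat_cond.
apply: eq_bigr => r; rewrite andbT ltnS => hr; have r0 : (0 < r)%N by case/andP: hr.
rewrite avgE; last first.
  by move=> i; rewrite !FE // pP // (periodic_amean r pG) (periodic_diffq 1 r pe).
by congr (_ * _); apply: psum_ext => i; rewrite FE // diffq_amean.
Qed.

End Variations.

(** * The cell problem *)

Section CellProblem.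
Context {R : realType}.
Variables (p rmax : nat) (Phi : nat -> int -> R -> R) (chi_star : int -> R)
  (rho_Phi rho_z rho_chi : R) (chi : R -> int -> R).
Hypotheses (p_gt0 : (0 < p)%N) (rmax_gt0 : (0 < rmax)%N)
  (per_Phi : periodic_potentials p rmax Phi)
  (zm_star : zero_mean p chi_star) (rho_Phi_gt0 : 0 < rho_Phi)
  (reg : regular_potentials rmax Phi chi_star rho_Phi)
  (equil : equilibrium p rmax Phi chi_star)
  (homog : homogenization_map p rmax Phi chi_star rho_Phi rho_z rho_chi chi).

Let dPhi r y := derive1 (Phi r y).
Let Fs := diffq 1 1 chi_star.
Let a r y := derive1n 2 (Phi r y) (diffq 1 r chi_star y).
Let dom (rho : R) r y s := `|s - amean r Fs y| < rho.
Let C := C_Phi_11 p rmax Phi chi_star rho_Phi.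

Lemma second_derivative_periodic r y : (1 <= r <= rmax)%N -> a r (y + p%:Z) = a r y.
Proof. by move=> hr; rewrite /a (per_Phi y hr); congr (_ _); exact: (periodic_diffq 1 r zm_star.1 y). Qed.

(** One set of constants serves the cell and every lattice whose period is a multiple of [p]; this
    makes the radii independent of [N]. *)
Lemma local_constants : stable p rmax Phi chi_star -> exists (K c rho m m' : R) (M M' : nat -> R),
  [/\ [/\ 0 <= K, 0 < c, 0 < rho, rho <= rho_Phi & rmax%:R * (K * rho) <= c],
      forall d r y s t, d <= rho -> (1 <= r <= rmax)%N ->
        `|s - amean r Fs y| < d -> `|t - amean r Fs y| < d ->
        `|dPhi r y s - dPhi r y t - a r y * (s - t)| <= K * d * `|s - t|,
      forall n, (p %| n)%N -> monotone_potentials rmax n dPhi (dom rho) m M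
        /\ monotone_potentials rmax n (linear_response a) (fun _ _ _ => True) m' M',
      2 * c <= m - 2 * \sum_(2 <= r < rmax.+1) M r &
      2 * c <= m' - 2 * \sum_(2 <= r < rmax.+1) M' r].
Proof.
move=> stab; have [K K0 hK] := strict_differentiability p_gt0 rho_Phi_gt0 per_Phi zm_star reg.
have [m' [M' [hm hM0 hM st]]] := stability_bounds p_gt0 rho_Phi_gt0 per_Phi zm_star rmax_gt0 stab.
set SM := \sum_(2 <= r < rmax.+1) M' r in st.
(* Thus [m' - 2 SM = 4 c]: one half is kept, the other pays for the linearization error [K rho] of
   each range within [rho]. *)
pose c := (m' / 2 - SM) / 2; have c0 : 0 < c by rewrite divr_gt0.
have r0 : 1 <= rmax%:R :> R by rewrite ler1n.
pose rho := Num.min rho_Phi (c / (rmax%:R * K + 1)).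
have rK : 0 <= rmax%:R * K by rewrite mulr_ge0.
have rho0 : 0 < rho by rewrite lt_min rho_Phi_gt0 divr_gt0 //; lra.
have rho_le : rho <= rho_Phi by rewrite ge_min lexx.
have Krho : rmax%:R * (K * rho) <= c.
  have : rho <= c / (rmax%:R * K + 1) by rewrite ge_min lexx orbT.
  rewrite ler_pdivlMr; last by lra.
  by rewrite mulrA; lra.
have Kr0 : 0 <= K * rho by rewrite mulr_ge0 // ltW.
have sd d r y s t : d <= rho -> (1 <= r <= rmax)%N ->
    `|s - amean r Fs y| < d -> `|t - amean r Fs y| < d ->
    `|dPhi r y s - dPhi r y t - a r y * (s - t)| <= K * d * `|s - t|.
  move=> hd hr; have rp : (0 < r)%N by case/andP: hr.
  by rewrite -!diffq_amean // => hs ht; apply: hK => //; exact: le_trans rho_le.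
have per_n n r y : (p %| n)%N -> (1 <= r <= rmax)%N ->
    dPhi r (y + n%:Z) = dPhi r y /\ a r (y + n%:Z) = a r y.
  move=> /dvdnP[k ->] hr; elim: k => [|k [IH1 IH2]]; first by rewrite mul0n addr0.
  rewrite (_ : y + (k.+1 * p)%:Z = y + (k * p)%:Z + p%:Z); last by rewrite mulSn PoszD [p%:Z + _]addrC addrA.
  split; first by rewrite -IH1 /dPhi (per_Phi (y + (k * p)%:Z) hr).
  by rewrite -IH2; exact: second_derivative_periodic.
exists K, c, rho, (m' - K * rho), m', (fun r => M' r + K * rho), M'; split.
- by split.
- exact: sd.
- move=> n pn; split; split.
  + by move=> r i hr; case: (per_n n r i pn hr).
  + move=> i s t ds dt; have h1 : (1 <= 1 <= rmax)%N by rewrite rmax_gt0.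
    have := sd rho 1%N i s t (lexx _) h1 ds dt; set x := s - t; set e := _ - _ - _ => he.
    rewrite (_ : dPhi 1%N i s - dPhi 1%N i t = e + a 1%N i * x); last by rewrite /e; ring.
    have he2 : - (K * rho * x ^+ 2) <= e * x.
      have : `|e * x| <= K * rho * x ^+ 2.
        by rewrite normrM -[x ^+ 2]real_normK ?num_real // expr2 mulrA; apply: ler_wpM2r.
      by rewrite ler_norml => /andP[].
    have : m' * x ^+ 2 <= a 1%N i * x ^+ 2 by apply: ler_wpM2r; [exact: sqr_ge0 | exact: hm].
    by rewrite !expr2 in he2 *; lra.
  + by move=> r hr; rewrite addr_ge0.
  + move=> r i s t hr ds dt; have hr1 : (1 <= r <= rmax)%N by case/andP: hr => /ltnW -> ->.
    have := sd rho r i s t (lexx _) hr1 ds dt.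
    have : `|a r i * (s - t)| <= M' r * `|s - t|.
      by rewrite normrM; apply: ler_wpM2r => //; exact: hM.
    move=> h1 h2; rewrite mulrDl -[X in `|X|](subrK (a r i * (s - t))).
    by apply: (le_trans (ler_normD _ _)); rewrite addrC; exact: lerD.
  + by move=> r i hr; apply/funext => s; rewrite /linear_response; case: (per_n n r i pn hr) => _ ->.
  + move=> i s t _ _; rewrite /linear_response -mulrBr -mulrA -expr2.
    by apply: ler_wpM2r; [exact: sqr_ge0 | exact: hm].
  + by move=> r _; exact: hM0.
  + move=> r i s t hr _ _; rewrite /linear_response -mulrBr normrM.
    by apply: ler_wpM2r => //; exact: hM.
- rewrite big_split /= sumr_const_nat -/SM -[K * rho *+ _]mulr_natl subSS.
  have -> : (rmax - 1)%:R = rmax%:R - 1 :> R by rewrite natrB.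
  by rewrite /c; move: Krho; rewrite /c; lra.
- by rewrite -/SM /c; lra.
Qed.

Definition cell_strain (z : R) (y : int) : R := z + diffq 1 1 (chi z) y.

Lemma homogenized_potential (K c rho m m' : R) (M M' : nat -> R) :
  0 <= K -> 0 < c -> 0 < rho -> rho <= rho_Phi ->
  (forall d r y s t, d <= rho -> (1 <= r <= rmax)%N ->
     `|s - amean r Fs y| < d -> `|t - amean r Fs y| < d ->
     `|dPhi r y s - dPhi r y t - a r y * (s - t)| <= K * d * `|s - t|) ->
  monotone_potentials rmax p dPhi (dom rho) m M ->
  monotone_potentials rmax p (linear_response a) (fun _ _ _ => True) m' M' ->
  2 * c <= m - 2 * \sum_(2 <= r < rmax.+1) M r ->
  2 * c <= m' - 2 * \sum_(2 <= r < rmax.+1) M' r ->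
  let L := rmax%:R * C / c in
  exists2 rho1 : R, 0 < rho1 /\ (3 + L) * rho1 <= rho &
  [/\ forall z : R, `|z| < rho1 -> zero_mean p (chi z),
      forall z : R, `|z| < rho1 -> forall i, `|cell_strain z i - Fs i| <= (1 + L) * `|z|,
      forall z : R, `|z| < rho1 -> forall i,
        stress rmax dPhi (cell_strain z) i = derive1 (Phi0 p rmax Phi chi) z,
      forall z : R, `|z| < rho1 -> is_derive z 1 (Phi0 p rmax Phi chi)
        (derive1 (Phi0 p rmax Phi chi) z) &
      (forall (c1 z z' : R) (i : int), coercive p rmax dPhi (dom rho) c1 -> `|z| < rho1 -> `|z'| < rho1 ->
        c1 * `|diffq 1 1 (chi z) i - diffq 1 1 (chi z') i| <= rmax%:R * C * `|z - z'|) /\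
      (exists2 K1 : R, 0 <= K1 & forall d z z' : R, d <= rho1 -> `|z| < d -> `|z'| < d ->
        `|derive1 (Phi0 p rmax Phi chi) z - derive1 (Phi0 p rmax Phi chi) z'
          - derive1n 2 (Phi0 p rmax Phi chi) 0 * (z - z')| <= K1 * d * `|z - z'|)].
Proof.
move=> K0 c0 rho0 rho_le sd mono mono_lin mono_c mono_lin_c L.
have [rz0 rc0 rzc hchi] := homog.
have [C0 lipC] := derivative_lipschitz p_gt0 rho_Phi_gt0 per_Phi zm_star reg.
have L0 : 0 <= L by rewrite divr_ge0 ?mulr_ge0 // ltW.
have one0 : (1 : R) != 0 by exact: oner_neq0.
have pFs : periodic p Fs by apply: periodic_diffq; case: zm_star.
have sFs : psum p Fs = 0 by apply: psum_diffq1; case: zm_star.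
have B r y s : (1 <= r <= rmax)%N -> dom rho r y s -> ball (diffq 1 r chi_star y) rho_Phi s.
  move=> /andP[r0 _]; rewrite /dom -diffq_amean // /ball /= distrC => h.
  exact: lt_le_trans rho_le.
have dP r y z : (1 <= r <= rmax)%N -> dom rho r y z -> is_derive z 1 (Phi r y) (dPhi r y z).
  by move=> hr hz; exact: (potential_derive reg hr (B r y z hr hz)).
have lip r y s t : (1 <= r <= rmax)%N -> dom rho r y s -> dom rho r y t ->
    `|dPhi r y s - dPhi r y t| <= C * `|s - t|.
  by move=> hr hs ht; apply: lipC => //; exact: B.
have pP r y : (1 <= r <= rmax)%N -> Phi r (y + p%:Z) = Phi r y by move=> hr; exact: per_Phi.
have pdP r y : (1 <= r <= rmax)%N -> dPhi r (y + p%:Z) = dPhi r y by move=> hr; rewrite /dPhi per_Phi.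
have p0 : p%:R != 0 :> R by rewrite pnatr_eq0 -lt0n.
have cell_stress z u : zero_mean p u -> (forall eta, zero_mean p eta ->
    cell_work p rmax Phi (fun r y => z + diffq 1 r u y) eta = 0) <->
    (forall i j, stress rmax dPhi (fun y => z + diffq 1 1 u y) i
       = stress rmax dPhi (fun y => z + diffq 1 1 u y) j).
  move=> [pu _]; have pG : periodic p (fun y => z + diffq 1 1 u y).
    by move=> i; rewrite (periodic_diffq 1 1 pu).
  have W eta : zero_mean p eta -> cell_work p rmax Phi (fun r y => z + diffq 1 r u y) eta =
      p%:R^-1 * psum p (fun y => stress rmax dPhi (fun y => z + diffq 1 1 u y) y * diffq 1 1 eta y).
    move=> [pe _]; apply: cell_workE => // r y /andP[r0 _].
    by rewrite ameanD amean_const // -diffq_amean.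
  split=> [H|H eta zeta].
    apply: (const_of_test p_gt0 one0); first exact: periodic_stress.
    move=> v zv; have := H v zv; rewrite W // => /eqP.
    by rewrite mulf_eq0 invr_eq0 (negbTE p0) /= => /eqP.
  by rewrite W // (psum_const_test _ _ H) ?mulr0 //; case: zeta.
have equilF i j : stress rmax dPhi Fs i = stress rmax dPhi Fs j.
  have E : Fs = fun y => 0 + diffq 1 1 chi_star y by apply/funext => y; rewrite add0r.
  rewrite E; apply: (cell_stress 0 chi_star zm_star).1 => eta zeta.
  rewrite (_ : (fun r y => _) = fun r y => diffq 1 r chi_star y); first exact: equil.
  by apply/funext => r; apply/funext => y; rewrite add0r.
pose t := Num.min rho_z (Num.min rho rho_chi).
have t0 : 0 < t by rewrite !lt_min rz0 rho0 rc0.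
have [t1 t2 t3] : [/\ t <= rho_z, t <= rho & t <= rho_chi].
  by rewrite /t !ge_min !lexx !orbT.
pose rho1 := t / (4 * (3 + L)).
have L3 : 0 < 4 * (3 + L) by lra.
have rho10 : 0 < rho1 by rewrite divr_gt0.
have rho1E : (3 + L) * rho1 = t / 4 by rewrite /rho1; field; rewrite gt_eqF //; lra.
have Lrho1 : 0 <= L * rho1 by rewrite mulr_ge0 // ltW.
have X_spec z : `|z| < rho1 -> [/\ zero_mean p (chi z),
    forall i j, stress rmax dPhi (cell_strain z) i = stress rmax dPhi (cell_strain z) j &
    forall i, `|cell_strain z i - Fs i| <= (1 + L) * `|z|].
  move=> hz; have Lz : L * `|z| <= L * rho1 by apply: ler_wpM2l => //; exact: ltW.
  have [||W [pW sW bW eW]] := cell_strain_exists (z := z) p_gt0 rmax_gt0 rho0 C0 c0 pFs dP lip mono mono_c equilF.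
  - by lra.
  - rewrite mulrC -ltr_pdivrMl //.
    by rewrite (_ : c^-1 * _ = L * `|z|); [lra | rewrite /L -/C; ring].
  have {}bW i : `|W i| <= L * `|z| by exact: bW.
  have [u zu Du] := @antidifference R p 1 (fun k => Fs k + W k) p_gt0 one0
    ltac:(by move=> k; rewrite pFs pW) ltac:(by rewrite psumD sFs sW addr0).
  have EX : (fun y => z + diffq 1 1 u y) = (fun k => Fs k + z + W k).
    by apply/funext => k; rewrite Du; ring.
  have sol : cell_solution p rmax Phi chi_star rho_chi z u.
    split => //; last by apply/cell_stress => //; rewrite EX.
    apply: norm_oo_lt => // k; rewrite diffqB Du -/Fs addrAC subrr add0r.
    by apply: (le_lt_trans (bW k)); lra.
  (* Uniqueness identifies the constructed solution with [chi z], which thereby inherits its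
     bounds. *)
  have [_ /(_ _ sol) chiE] := hchi z ltac:(lra).
  have XE : cell_strain z = fun k => Fs k + z + W k by rewrite /cell_strain chiE EX.
  rewrite XE chiE; split => // i.
  rewrite (_ : _ - _ = W i + z); last by ring.
  by apply: (le_trans (ler_normD _ _)); have := bW i; lra.
have zmX z : `|z| < rho1 -> zero_mean p (chi z) by move=> /X_spec[].
have sX z : `|z| < rho1 -> forall i j,
    stress rmax dPhi (cell_strain z) i = stress rmax dPhi (cell_strain z) j by move=> /X_spec[].
have nX z : `|z| < rho1 -> forall i, `|cell_strain z i - Fs i| <= (1 + L) * `|z| by move=> /X_spec[].
have pX z : `|z| < rho1 -> periodic p (cell_strain z).
  by move=> /zmX[pc _] i; rewrite /cell_strain (periodic_diffq 1 1 pc).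
have mX z : `|z| < rho1 -> psum p (cell_strain z) = p%:R * z.
  by move=> /zmX[pc _]; rewrite psumD psum_const psum_diffq1 // addr0.
have rho1s : (3 + L) * rho1 <= rho by lra.
have Phi0E z : `|z| < rho1 -> Phi0 p rmax Phi chi z = p%:R^-1 * field_energy p rmax Phi (cell_strain z).
  move=> hz; have [pc _] := zmX z hz.
  rewrite /Phi0 /field_energy mulr_sumr big_nat_cond [RHS]big_nat_cond.
  apply: eq_bigr => r; rewrite andbT ltnS => hr; have r0 : (0 < r)%N by case/andP: hr.
  have E : (fun y => Phi r y (z + diffq 1 r (chi z) y)) = fun y => Phi r y (amean r (cell_strain z) y).
    by apply/funext => y; rewrite ameanD amean_const // -diffq_amean.
  by rewrite E avgE // => y; rewrite pP // (periodic_amean r (pX z hz)).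
have dPhi0 (z : R) : `|z| < rho1 ->
    is_derive z 1 (Phi0 p rmax Phi chi) (stress rmax dPhi (cell_strain z) 0).
  move=> hz.
  have /is_derive1P D := derive_homogenized p_gt0 rmax_gt0 C0 c0 dP lip mono mono_c rho10 rho1s pX mX sX nX hz.
  apply/is_derive1P => eps e0; have [del d0 Hd] := D eps e0.
  exists (Num.min del (rho1 - `|z|)); first by rewrite lt_min d0 subr_gt0.
  move=> h; rewrite lt_min => /andP[h1 h2].
  have hzh : `|z + h| < rho1 by apply: (le_lt_trans (ler_normD _ _)); lra.
  by rewrite !Phi0E //; exact: Hd.
have S0 (z : R) : `|z| < rho1 -> derive1 (Phi0 p rmax Phi chi) z = stress rmax dPhi (cell_strain z) 0.
  by move=> hz; exact: (is_derive1_unique (dPhi0 z hz)).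
have [K1 K10 [a0 Ha0]] := strict_derivative_homogenized_stress p_gt0 rmax_gt0 rho0 C0 K0 c0 sd lip
  mono mono_c mono_lin mono_lin_c rho10 rho1s pX mX sX nX.
have Ha (d z z' : R) : d <= rho1 -> `|z| < d -> `|z'| < d ->
    `|derive1 (Phi0 p rmax Phi chi) z - derive1 (Phi0 p rmax Phi chi) z' - a0 * (z - z')|
    <= K1 * d * `|z - z'|.
  move=> hd hz hz'; rewrite !S0; [exact: Ha0 | exact: lt_le_trans hd | exact: lt_le_trans hd].
(* A strict derivative is a derivative, so the total expression [derive1n 2] has the value [a0]. *)
have a0E : derive1n 2 (Phi0 p rmax Phi chi) 0 = a0.
  rewrite derive1nS derive1n1; apply: is_derive1_unique; apply/is_derive1P => eps e0.
  exists (Num.min rho1 (eps / (K1 + 1)) / 2).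
    by rewrite divr_gt0 // lt_min rho10 divr_gt0 //; lra.
  set b := Num.min _ _ => h hh.
  have b0 : 0 < b by rewrite lt_min rho10 divr_gt0 //; lra.
  have hb : b <= rho1 by rewrite ge_min lexx.
  have hb2 : b <= eps / (K1 + 1) by rewrite ge_min lexx orbT.
  rewrite ler_pdivlMr in hb2; last by lra.
  have := Ha b h 0 hb ltac:(lra) ltac:(by rewrite normr0).
  rewrite subr0 add0r => H; apply: (le_trans H); apply: ler_wpM2r => //; lra.
exists rho1; first by split.
split => //.
- by move=> z hz i; rewrite S0 // (sX z hz i 0).
- by move=> z hz; rewrite S0 //; exact: dPhi0.
split; last by exists K1 => // d z z' hd hz hz'; rewrite a0E; exact: Ha.
move=> c1 z z' i hc hz hz'.
have := X_fluctuation_lipschitz p_gt0 C0 c0 lip rho10 rho1s pX mX sX nX i hc hz hz'.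
have E x j : cell_strain x j - x = diffq 1 1 (chi x) j.
  by rewrite /cell_strain addrAC subrr add0r.
by rewrite !E.
Qed.

End CellProblem.

(** * The coarse and the atomistic problem *)

Lemma stress_first_neighbours (R : realType) (dPhi : nat -> int -> R -> R) G i :
  stress 1 dPhi G i = dPhi 1%N i (G i).
Proof. by rewrite stress_head // big_geq // addr0. Qed.

Lemma corrected_strain (R : realType) (N : nat) (chi : R -> int -> R) (u : int -> R) i :
  (0 < N)%N ->
  diffq N%:R^-1 1 (corrected N chi u) i = diffq N%:R^-1 1 u i
    + (chi (diffq N%:R^-1 1 u (i + 1)) (i + 1) - chi (diffq N%:R^-1 1 u i) i).
Proof.
move=> N0; have Nn : N%:R != 0 :> R by rewrite pnatr_eq0 -lt0n.
by rewrite /corrected /recenter !(diffq1E _ _ i) invrK; field.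
Qed.

Lemma periodic_potentials_dvd (R : realType) p n rmax (Phi : nat -> int -> R -> R) :
  (p %| n)%N -> periodic_potentials p rmax Phi -> periodic_potentials n rmax Phi.
Proof.
move=> /dvdnP[k ->] pP r y hr; elim: k => [|k IH]; first by rewrite mul0n addr0.
by rewrite -IH -(pP r (y + (k * p)%:Z) hr); congr Phi; rewrite mulSn PoszD; ring.
Qed.

Lemma window_bound (R : realType) (U : int -> R) (n : nat) (del : R) i j :
  (forall i, `|U (i + 1) - U i| <= del) -> (absz (j - i)%R < n)%N ->
  `|U j - U i| <= n%:R * del.
Proof.
move=> H hij; have del0 : 0 <= del by apply: le_trans (H 0).
apply: (@le_trans _ _ ((absz (j - i)%R)%:R * del)); last first.
  by apply: ler_wpM2r => //; rewrite ler_nat ltnW.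
have [ij|ji] := lerP i j.
  by have := step_bound H i (absz (j - i)%R); rewrite (_ : i + _ = j) //; lia.
by have := step_bound H j (absz (j - i)%R); rewrite (_ : j + (absz (j - i)%R)%:Z = i); [rewrite distrC | lia].
Qed.


Section Problems.
Context {R : realType}.
Variables (p N rmax : nat) (Phi : nat -> int -> R -> R) (nodes : set int) (f g : int -> R).
Hypotheses (N_gt0 : (0 < N)%N) (zf : zero_mean N f) (per_g : periodic N g)
  (g_step : forall i, g (i - 1) - g i = N%:R^-1 * f i).

Let e : R := N%:R^-1.

Let e_neq0 : e != 0.
Proof. by rewrite invr_eq0 pnatr_eq0 -lt0n. Qed.

Lemma avg_load v : zero_mean N v ->
  avg N (fun i => f i * v i) = e * psum N (fun i => g i * diffq e 1 v i).
Proof.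
move=> [pv _]; rewrite avgE; first by rewrite (psum_load N_gt0 per_g pv g_step).
by case: zf => pf _ k; rewrite pf pv.
Qed.

(** With the load [gb] the equation is solved at every site, not just against coarse tests. Strict
    monotonicity then makes the strain constant wherever [gb] is, so the solution lies in the coarse
    space by itself. *)
Lemma coarse_problem (chi : R -> int -> R) (gb : int -> R) (A rho tau : R) :
  let dPhi0 := derive1 (Phi0 p rmax Phi chi) in
  0 < A -> 0 < rho -> tau < A * rho ->
  periodic N gb -> (forall i, ~ nodes i -> gb (i - 1) = gb i) ->
  (forall i j, gb i - gb j <= tau) ->
  (forall V, periodic N V -> (forall i, ~ nodes i -> V (i - 1) = V i) ->
     psum N (fun i => gb i * V i) = psum N (fun i => g i * V i)) ->
  (forall z : R, `|z| <= rho -> is_derive z 1 (Phi0 p rmax Phi chi) (dPhi0 z)) ->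
  (forall z z' : R, `|z| <= rho -> `|z'| <= rho ->
     A * (z - z') ^+ 2 <= (dPhi0 z - dPhi0 z') * (z - z')) ->
  exists uh, [/\ unique (fun w => coarse_solution p rmax N Phi chi nodes f w /\
      seminorm_1_oo N e w < rho) uh,
    forall i, `|diffq e 1 uh i| < rho &
    forall i j, dPhi0 (diffq e 1 uh i) - dPhi0 (diffq e 1 uh j) = gb i - gb j].
Proof.
move=> dPhi0 A0 rho0 tau_lt pgb sgb oscgb testgb dX monoS.
have am0 r i : amean r (fun=> 0 : R) i = 0 by rewrite /amean big1 ?mulr0.
have monoC : monotone_potentials 1 N (fun _ _ => dPhi0)
    (fun r i z => `|z - amean r (fun=> 0) i| <= rho) A (fun=> 0).
  split => //; last by move=> r i s s' /andP[h2 h1]; have := leq_trans h2 h1.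
  by move=> i s s'; rewrite am0 !subr0; exact: monoS.
have dX0 (r : nat) (i : int) z : (1 <= r <= 1)%N -> `|z - amean r (fun=> 0) i| <= rho ->
    is_derive z 1 (Phi0 p rmax Phi chi) (dPhi0 z).
  by move=> _; rewrite am0 subr0; exact: dX.
have A20 : 0 < A / 2 by rewrite divr_gt0.
have AE : 2 * (A / 2) = A by rewrite mulrCA divff ?mulr1.
have hA : 2 * (A / 2) <= A - 2 * \sum_(2 <= r < 2) 0 by rewrite AE big_geq // mulr0 subr0.
have osc0 i j : (gb i - stress 1 (fun _ _ => dPhi0) (fun=> 0) i)
    - (gb j - stress 1 (fun _ _ => dPhi0) (fun=> 0) j) <= tau.
  by rewrite !stress_first_neighbours opprB addrA subrK.
have tau_lt' : tau < 2 * (A / 2) * rho by rewrite AE.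
have p0 : periodic N (fun=> 0 : R) by [].
have [U [pU sU bU eU]] := @stress_solvable R N 1 N_gt0 isT (fun _ _ => Phi0 p rmax Phi chi)
  (fun _ _ => dPhi0) (fun=> 0) gb rho A (A / 2) tau (fun=> 0) p0 pgb rho0 dX0 monoC hA A20
  osc0 tau_lt'.
have {}bU i : `|U i| < rho.
  by rewrite -(ltr_pM2l A0); have := bU i; rewrite AE; move/le_lt_trans; apply.
have {}eU i j : dPhi0 (U i) - gb i = dPhi0 (U j) - gb j.
  by have := eU i j; rewrite !stress_first_neighbours !add0r.
have Udiff i j : dPhi0 (U i) - dPhi0 (U j) = gb i - gb j by have := eU i j; lra.
have [uh zuh Duh] := @antidifference R N e U N_gt0 e_neq0 pU sU.
have puh : periodic N uh by case: zuh.
have uh_coarse : coarse_space N nodes uh.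
  split => // i ni; rewrite -/e !Duh; apply/eqP.
  rewrite -subr_eq0 -sqrf_eq0 eq_le sqr_ge0 andbT -(pmulr_rle0 _ A0).
  by apply: (le_trans (monoS _ _ (ltW (bU _)) (ltW (bU _)))); rewrite Udiff sgb // subrr mul0r.
have coarse_rhs v : coarse_space N nodes v ->
    avg N (fun i => f i * v i) = e * psum N (fun i => gb i * diffq e 1 v i).
  move=> [zv sv]; rewrite avg_load // testgb //.
  by apply: periodic_diffq; case: zv.
have coarse_lhs w v : periodic N w -> periodic N v ->
    avg N (fun i => dPhi0 (diffq e 1 w i) * diffq e 1 v i)
    = e * psum N (fun i => dPhi0 (diffq e 1 w i) * diffq e 1 v i).
  by move=> pw pv; rewrite avgE // => i; rewrite (periodic_diffq e 1 pw) (periodic_diffq e 1 pv).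
have solh : coarse_solution p rmax N Phi chi nodes f uh.
  split => // v cv; have [[pv _] _] := cv.
  rewrite -/dPhi0 -/e coarse_lhs // coarse_rhs //; congr (_ * _).
  apply/eqP; rewrite -subr_eq0 -psumB; apply/eqP.
  rewrite (psum_ext N (v := fun i => (dPhi0 (U i) - gb i) * diffq e 1 v i)).
    exact: psum_const_test.
  by move=> i; rewrite Duh mulrBl.
exists uh; split; last 2 first.
- by move=> i; rewrite Duh.
- by move=> i j; rewrite !Duh.
split; first by split => //; apply: norm_oo_lt => // i; rewrite Duh.
move=> w [[cw hw] bw]; have [zw sw] := cw; have pw : periodic N w by case: zw.
have Dw i : `|diffq e 1 w i| < rho.
  by apply: le_lt_trans bw; apply: ge_norm_oo => //; exact: periodic_diffq.
have pV : periodic N (fun i => w i - uh i) by move=> i; rewrite pw puh.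
have cV : coarse_space N nodes (fun i => w i - uh i).
  split; last by move=> i ni; rewrite !diffqB sw // uh_coarse.2.
  apply/zero_meanP => //; split => //.
  have [_ s1] := (zero_meanP w N_gt0).1 zw; have [_ s2] := (zero_meanP uh N_gt0).1 zuh.
  by rewrite psumB s1 s2 subrr.
(* A competitor satisfies only the equation against coarse tests. Testing with the difference gives
   a zero sum of terms that monotonicity makes nonnegative. *)
have E1 : psum N (fun i => (dPhi0 (diffq e 1 w i) - dPhi0 (U i)) * (diffq e 1 w i - U i)) = 0.
  have := etrans (hw _ cV) (esym (solh.2 _ cV)).
  rewrite -/dPhi0 -/e !coarse_lhs // => /(mulfI e_neq0) E.
  rewrite (psum_ext N (v := fun i => dPhi0 (diffq e 1 w i) * diffq e 1 (fun i => w i - uh i) i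
    - dPhi0 (diffq e 1 uh i) * diffq e 1 (fun i => w i - uh i) i)).
    by rewrite psumB E subrr.
  by move=> i; rewrite diffqB !Duh mulrBl.
have T i : A * (diffq e 1 w i - U i) ^+ 2 <=
    (dPhi0 (diffq e 1 w i) - dPhi0 (U i)) * (diffq e 1 w i - U i).
  by apply: monoS; apply: ltW.
apply: (zero_mean_eq N_gt0 e_neq0 zuh zw) => i; rewrite Duh; apply/eqP; rewrite eq_sym -subr_eq0; apply/eqP.
move: i; apply: (@periodic_ord R N (fun i => diffq e 1 w i - U i) (fun x => x = 0)) => //.
  by move=> i; rewrite (periodic_diffq e 1 pw) pU.
move=> k; apply/eqP; rewrite -sqrf_eq0 eq_le sqr_ge0 andbT -(pmulr_rle0 _ A0).
apply: (le_trans (T _)).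
have T0 (j : 'I_N) : true -> 0 <= (dPhi0 (diffq e 1 w j%:Z) - dPhi0 (U j%:Z)) * (diffq e 1 w j%:Z - U j%:Z).
  by move=> _; apply: le_trans (T _); rewrite mulr_ge0 ?sqr_ge0 // ltW.
by rewrite (psumr_eq0P T0 E1 (i := k)).
Qed.

Lemma scaled_strain (chi_star : int -> R) i :
  diffq e 1 (scaled_chi_star N chi_star) i = diffq 1 1 chi_star i.
Proof. by rewrite !diffq1E /scaled_chi_star -/e -mulrBr divr1 mulrC mulKf. Qed.

(** All zero-mean tests are available here, so every solution has a pointwise stress equation, and
    uniqueness is coercivity with [nu = 0]. The margin [rho_u < rho] keeps the closed box inside
    [dom]. *)
Lemma atomistic_problem (dPhi : nat -> int -> R -> R) (chi_star : int -> R)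
    (rho rho_u m c tau : R) (M : nat -> R) :
  let Fs := diffq 1 1 chi_star in
  let dom := fun (r : nat) (y : int) (s : R) => `|s - amean r Fs y| < rho in
  (0 < rmax)%N -> 0 < rho_u -> rho_u < rho -> 0 < c -> tau < 2 * c * rho_u ->
  periodic N chi_star ->
  (forall r i, (1 <= r <= rmax)%N -> Phi r (i + N%:Z) = Phi r i) ->
  (forall r i s, (1 <= r <= rmax)%N -> dom r i s -> is_derive s 1 (Phi r i) (dPhi r i s)) ->
  monotone_potentials rmax N dPhi dom m M ->
  2 * c <= m - 2 * \sum_(2 <= r < rmax.+1) M r ->
  (forall i j, stress rmax dPhi Fs i = stress rmax dPhi Fs j) ->
  (forall i j, g i - g j <= tau) ->
  exists u, [/\ unique (fun w => atomistic_solution rmax N Phi f w /\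
      seminorm_1_oo N e (fun i => w i - scaled_chi_star N chi_star i) < rho_u) u,
    forall i, `|diffq e 1 u i - Fs i| < rho_u &
    forall i j, stress rmax dPhi (diffq e 1 u) i - g i
              = stress rmax dPhi (diffq e 1 u) j - g j].
Proof.
move=> Fs dom rmax0 ru0 rurho c0 tau_lt ps PN dP monoN mc stF oscg.
have [dPN _ _ _] := monoN.
have pFs : periodic N Fs by exact: periodic_diffq.
have sFs : psum N Fs = 0 by exact: psum_diffq1.
have domu r i s : (1 <= r <= rmax)%N -> `|s - amean r Fs i| <= rho_u -> dom r i s.
  by move=> _ H; exact: le_lt_trans H rurho.
have osc0 i j : (g i - stress rmax dPhi Fs i) - (g j - stress rmax dPhi Fs j) <= tau.
  by rewrite (stF i j) opprB addrA subrK.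
have [W [pW sW bW eW]] := @stress_solvable R N rmax N_gt0 rmax0 Phi dPhi Fs g rho_u m c tau M
  pFs per_g ru0 (fun r i s hr hs => dP r i s hr (domu r i s hr hs))
  (monotone_subdomain rmax0 domu monoN) mc c0 osc0 tau_lt.
have c20 : 0 < 2 * c by rewrite mulr_gt0.
have {}bW i : `|W i| < rho_u.
  by rewrite -(ltr_pM2l c20); apply: le_lt_trans (bW i) tau_lt.
have [u zu Du] := @antidifference R N e (fun i => Fs i + W i) N_gt0 e_neq0
  ltac:(by move=> i; rewrite pFs pW) ltac:(by rewrite psumD sFs sW addr0).
have DuE : diffq e 1 u = fun i => Fs i + W i by apply/funext.
have adm w : (forall i, `|diffq e 1 w i - Fs i| < rho_u) -> admissible rmax dom (diffq e 1 w).
  by move=> H; apply: (near_admissible (zeta := rho_u)) => // i; exact: ltW.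
have var w v : zero_mean N w -> zero_mean N v -> (forall i, `|diffq e 1 w i - Fs i| < rho_u) ->
    energy_variation rmax N Phi w v
    = e * psum N (fun i => stress rmax dPhi (diffq e 1 w) i * diffq e 1 v i).
  move=> [pw _] [pv _] near; apply: energy_variationE => // r i hr.
  by apply: dP => //; exact: adm.
have near_u i : `|diffq e 1 u i - Fs i| < rho_u by rewrite Du addrC addKr.
have eu i j : stress rmax dPhi (diffq e 1 u) i - g i = stress rmax dPhi (diffq e 1 u) j - g j.
  by rewrite DuE; exact: eW.
exists u; split => //; split; first split.
- split => // v zv; rewrite var // avg_load //; congr (_ * _).
  apply/eqP; rewrite -subr_eq0 -psumB; apply/eqP.
  rewrite (psum_ext N (v := fun i => (stress rmax dPhi (diffq e 1 u) i - g i) * diffq e 1 v i)).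
    by apply: psum_const_test => //; case: zv.
  by move=> i; rewrite mulrBl.
- apply: norm_oo_lt => // i; rewrite diffqB scaled_strain; exact: near_u.
move=> w [[zw hw] bw]; have pw : periodic N w by case: zw.
have near_w i : `|diffq e 1 w i - Fs i| < rho_u.
  apply: le_lt_trans bw; have := @ge_norm_oo R N (diffq e 1 (fun i => w i - scaled_chi_star N chi_star i)) i N_gt0.
  rewrite diffqB scaled_strain; apply; apply: periodic_diffq => k.
  by rewrite pw /scaled_chi_star ps.
have ew i j : stress rmax dPhi (diffq e 1 w) i - g i = stress rmax dPhi (diffq e 1 w) j - g j.
  move: i j; apply: (const_of_test N_gt0 e_neq0).
    by move=> i; rewrite per_g (periodic_stress dPN (periodic_diffq e 1 pw)).
  move=> v zv; rewrite (psum_ext N (v := fun i => stress rmax dPhi (diffq e 1 w) i * diffq e 1 v i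
     - g i * diffq e 1 v i)); last by move=> i; rewrite mulrBl.
  rewrite psumB; apply/eqP; rewrite subr_eq0; apply/eqP; apply: (mulfI e_neq0).
  by rewrite -var // hw // avg_load.
have pu : periodic N u by case: zu.
apply: (zero_mean_eq N_gt0 e_neq0 zu zw) => i; apply/eqP; rewrite -subr_eq0 -normr_le0.
rewrite -(pmulr_rle0 _ c0).
apply: (monotone_coercive N_gt0 rmax0 monoN mc c0
  (mu := (stress rmax dPhi (diffq e 1 u) 0 - g 0) - (stress rmax dPhi (diffq e 1 w) 0 - g 0))).
- exact: adm.
- exact: adm.
- exact: periodic_diffq.
- exact: periodic_diffq.
- by rewrite psumB !psum_diffq1 // subrr.
- by move=> k; rewrite normr_le0; apply/eqP; have := eu k 0; have := ew k 0; lra.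
Qed.

End Problems.

Lemma coercive_of_inf_sup (R : realType) (n rmax : nat) (e : R) (Phi : nat -> int -> R -> R)
    (chi_star : int -> R) (F : nat -> int -> R) (dPhi : nat -> int -> R -> R) (dom : nat -> int -> R -> Prop)
    (kappa c c0 : R) :
  let a := fun r y => derive1n 2 (Phi r y) (diffq 1 r chi_star y) in
  (0 < n)%N -> e != 0 -> 0 < c0 ->
  (forall r i, (1 <= r <= rmax)%N -> F r i = diffq 1 r chi_star i) ->
  (forall r i, (1 <= r <= rmax)%N -> a r (i + n%:Z) = a r i) ->
  (forall r y s t, (1 <= r <= rmax)%N -> dom r y s -> dom r y t ->
     `|dPhi r y s - dPhi r y t - a r y * (s - t)| <= kappa * `|s - t|) ->
  0 <= kappa -> rmax%:R * kappa <= c -> coercive n rmax dPhi dom c ->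
  ((2 * c0)%:E <= inf_sup n e (hessian_form rmax n e Phi F))%E ->
  coercive n rmax dPhi dom c0.
Proof.
move=> a n0 e0 c00 FE pa hd k0 kc hc his.
apply: (coercive_perturb n0 hd k0 kc hc) => //.
apply: (inf_sup_coercive n0 e0 pa _ his) => w v zw zv.
exact: (@hessian_form_stress R n rmax e Phi F a w v n0
  (fun r i hr => congr1 (derive1n 2 (Phi r i)) (FE r i hr)) pa zw zv).
Qed.

(** * The error of the corrected solution *)

Lemma quadratic_expansive (R : realType) (A c x y : R) :
  c <= A -> A * x ^+ 2 <= y * x -> c * `|x| <= `|y|.
Proof.
move=> cA H; have [->|x0] := eqVneq x 0; first by rewrite normr0 mulr0.
have nx0 : 0 < `|x| by rewrite normr_gt0.
rewrite -(ler_pM2r nx0) -[leLHS]mulrA -expr2 real_normK ?num_real //.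
apply: (@le_trans _ _ (A * x ^+ 2)); first by apply: ler_wpM2r => //; exact: sqr_ge0.
by apply: (le_trans H); rewrite -normrM ler_norm.
Qed.

(** [d] makes the homogenized stress monotone with constant [A / 2]; [rho_u] keeps the corrected
    strain, with [q = p], within [rho] of [Fs]; [rho_f] keeps the load oscillation [2 rho_f] below
    the solvability thresholds of both problems. *)
Lemma small_radii (R : realType) (A K rho1 rho c L q : R) :
  0 < A -> 0 <= K -> 0 < rho1 -> 0 < rho -> 0 < c -> 0 <= L -> 0 <= q ->
  exists d rho_u rho_f : R,
    [/\ [/\ 0 < rho_u, 0 < rho_f, rho_u < d & d <= rho1],
        rho_u < rho /\ K * d <= A / 2,
        q * (L * (2 * rho_u)) + (1 + L) * rho_u < rho,
        2 * rho_f < A / 2 * rho_u & 2 * rho_f < 2 * c * rho_u].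
Proof.
move=> A0 K0 r10 rho0 c0 L0 q0.
pose d := Num.min rho1 (A / (2 * K + 1)).
have d0 : 0 < d by rewrite lt_min r10 divr_gt0 //; lra.
have Kd : K * d <= A / 2.
  have : d <= A / (2 * K + 1) by rewrite ge_min lexx orbT.
  by rewrite ler_pdivlMr; lra.
pose t := Num.min d rho.
have t0 : 0 < t by rewrite lt_min d0.
have td : t <= d by rewrite ge_min lexx.
have tr : t <= rho by rewrite ge_min lexx orbT.
pose Q := 4 * (1 + L + 2 * (q * L)).
have qL0 : 0 <= q * L by rewrite mulr_ge0.
have Q0 : 4 <= Q by rewrite /Q; lra.
pose rho_u := t / Q.
have ru0 : 0 < rho_u by rewrite divr_gt0 //; lra.
have ruQ : Q * rho_u = t by rewrite /rho_u mulrCA divff ?mulr1 // gt_eqF //; lra.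
have Lru : 0 <= L * rho_u by rewrite mulr_ge0 // ltW.
have qLru : 0 <= q * L * rho_u by rewrite mulr_ge0 // ltW.
have ru4 : 4 * rho_u + 4 * (L * rho_u) + 8 * (q * L * rho_u) = t.
  by rewrite -ruQ /Q; ring.
pose cmin := Num.min c (A / 4).
have cmin0 : 0 < cmin by rewrite lt_min c0 /=; lra.
have cminc : cmin <= c by rewrite ge_min lexx.
have cminA : cmin <= A / 4 by rewrite ge_min lexx orbT.
have cu0 : 0 < cmin * rho_u by rewrite mulr_gt0.
have cuc : cmin * rho_u <= c * rho_u by apply: ler_wpM2r => //; exact: ltW.
have cuA : cmin * rho_u <= A / 4 * rho_u by apply: ler_wpM2r => //; exact: ltW.
have d_le : d <= rho1 by rewrite ge_min lexx.
exists d, rho_u, (cmin * rho_u / 2); split; last 3 first.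
- by rewrite (_ : _ + _ = t / 4); [lra | rewrite -ru4; field].
- by lra.
- by lra.
- by split => //; lra.
- by split => //; lra.
Qed.

Section CorrectionError.
Context {R : realType}.
Variables (p N rmax : nat) (dPhi : nat -> int -> R -> R)
  (dom : nat -> int -> R -> Prop) (dPhi0 : R -> R) (chi : R -> int -> R)
  (uh u gb g : int -> R) (rho1 C L c0 del eta : R).
Let e : R := N%:R^-1.
Let U := diffq e 1 uh.
Hypotheses (p_gt0 : (0 < p)%N) (N_gt0 : (0 < N)%N) (pN : (p %| N)%N)
  (C_ge0 : 0 <= C) (L_ge0 : 0 <= L)
  (per_uh : periodic N uh) (per_u : periodic N u)
  (zm_chi : forall z, `|z| < rho1 -> zero_mean p (chi z))
  (lip_chi : forall (z z' : R) i, `|z| < rho1 -> `|z'| < rho1 ->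
     `|diffq 1 1 (chi z) i - diffq 1 1 (chi z') i| <= L * `|z - z'|)
  (U_small : forall i, `|U i| < rho1).

(** Zero mean over one cell turns a bound on differences into one on values, at the cost of [p]
    rather than [N]. *)
Lemma corrector_lipschitz (z z' : R) i : `|z| < rho1 -> `|z'| < rho1 ->
  `|chi z i - chi z' i| <= p%:R * (L * `|z - z'|).
Proof.
move=> hz hz'; have [pz sz] := (zero_meanP _ p_gt0).1 (zm_chi hz).
have [pz' sz'] := (zero_meanP _ p_gt0).1 (zm_chi hz').
apply: (@zero_mean_bound R p (fun k => chi z k - chi z' k) _ p_gt0).
  apply/zero_meanP => //; split; first by move=> k; rewrite pz pz'.
  by rewrite psumB sz sz' subrr.
move=> k; have := lip_chi k hz hz'; rewrite !diffq1E !divr1.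
by rewrite (_ : _ - _ - _ = chi z (k + 1) - chi z' (k + 1) - (chi z k - chi z' k)) //; ring.
Qed.

(** The factor [1 / N] of the corrector cancels against the spacing. Freezing the macroscopic strain
    at [i] leaves only the change of the argument of [chi] at the site [i + 1]. *)
Lemma corrected_strain_defect i :
  `|diffq e 1 (corrected N chi uh) i - cell_strain chi (U i) i|
  <= p%:R * (L * `|U (i + 1) - U i|).
Proof.
rewrite corrected_strain // -/e -/U /cell_strain diffq1E divr1.
rewrite (_ : _ - _ = chi (U (i + 1)) (i + 1) - chi (U i) (i + 1)); last by ring.
exact: corrector_lipschitz.
Qed.

Lemma corrected_near (Fs : int -> R) (rho_u : R) :
  (forall z, `|z| < rho1 -> forall i, `|cell_strain chi z i - Fs i| <= (1 + L) * `|z|) ->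
  (forall i, `|U i| <= rho_u) ->
  forall i, `|diffq e 1 (corrected N chi uh) i - Fs i|
    <= p%:R * (L * (2 * rho_u)) + (1 + L) * rho_u.
Proof.
move=> nX hU i; rewrite -(subrKA (cell_strain chi (U i) i)).
apply: (le_trans (ler_normD _ _)); apply: lerD.
  apply: (le_trans (corrected_strain_defect i)); apply: ler_wpM2l => //; apply: ler_wpM2l => //.
  by apply: (le_trans (ler_normB _ _)); rewrite mulr2n mulrDl mul1r; apply: lerD.
by apply: (le_trans (nX _ (U_small i) i)); apply: ler_wpM2l => //; rewrite addr_ge0.
Qed.

Lemma periodic_corrected : periodic N (corrected N chi uh).
Proof.
have pU : periodic N U by exact: periodic_diffq.
move=> i; rewrite /corrected /recenter -/e -/U per_uh pU.
by have [pz _] := zm_chi (U_small i); rewrite (periodic_dvd pN pz).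
Qed.

Hypotheses
  (lip_dPhi : forall r y s t, (1 <= r <= rmax)%N -> dom r y s -> dom r y t ->
     `|dPhi r y s - dPhi r y t| <= C * `|s - t|)
  (adm_X : forall z, `|z| < rho1 -> admissible rmax dom (cell_strain chi z))
  (adm_c : admissible rmax dom (diffq e 1 (corrected N chi uh)))
  (adm_u : admissible rmax dom (diffq e 1 u))
  (stress_X : forall z, `|z| < rho1 -> forall i,
     stress rmax dPhi (cell_strain chi z) i = dPhi0 z)
  (U_jump : forall i, `|U (i + 1) - U i| <= del)
  (eq_uh : forall i j, dPhi0 (U i) - dPhi0 (U j) = gb i - gb j)
  (eq_u : forall i j, stress rmax dPhi (diffq e 1 u) i - g i
     = stress rmax dPhi (diffq e 1 u) j - g j)
  (gb_g : forall i, `|gb i - g i| <= eta)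
  (coer : coercive N rmax dPhi dom c0).

(* Near the site [i] the corrected strain is close to the cell strain with the
   frozen macroscopic strain [U i], whose stress is exactly [dPhi0 (U i)]. *)
Lemma correction_error i :
  c0 * `|diffq e 1 (corrected N chi uh) i - diffq e 1 u i|
  <= eta + rmax%:R * (C * (del * (p%:R * L + (1 + L) * rmax%:R))).
Proof.
(* [p L] is the defect at [j] itself, and [(1 + L) rmax] the change of the cell strain as [U] varies
   over the interaction window. *)
set zeta := del * _.
have del0 : 0 <= del by apply: le_trans (U_jump 0).
have freeze k j : (absz (j - k)%R < rmax)%N ->
    `|diffq e 1 (corrected N chi uh) j - cell_strain chi (U k) j| <= zeta.
  move=> hjk.
  rewrite (_ : _ - _ = (diffq e 1 (corrected N chi uh) j - cell_strain chi (U j) j)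
     + ((U j - U k) + (diffq 1 1 (chi (U j)) j - diffq 1 1 (chi (U k)) j))); last first.
    by rewrite /cell_strain; ring.
  apply: (le_trans (ler_normD _ _)).
  rewrite /zeta mulrDr; apply: lerD.
    apply: (le_trans (corrected_strain_defect j)).
    rewrite mulrA mulrC; apply: ler_wpM2r; [exact: mulr_ge0 | exact: U_jump].
  have W := window_bound U_jump hjk.
  apply: (le_trans (ler_normD _ _)).
  apply: (@le_trans _ _ ((1 + L) * (rmax%:R * del))); last by rewrite le_eqVlt; apply/orP; left; apply/eqP; ring.
  rewrite mulrDl mul1r; apply: lerD => //.
  by apply: (le_trans (lip_chi _ (U_small _) (U_small _))); apply: ler_wpM2l.
(* Up to constants the corrected stress is near [dPhi0 (U k)], which is [gb], which is near [g],
   which is the stress of [u]; [mu] collects the constants. *)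
apply: (coer (mu := (dPhi0 (U 0) - gb 0) - (stress rmax dPhi (diffq e 1 u) 0 - g 0))) => //.
- by apply: periodic_diffq; exact: periodic_corrected.
- exact: periodic_diffq.
- by rewrite psumB !psum_diffq1 ?subrr //; exact: periodic_corrected.
move=> k.
have h1 := stress_lipschitz lip_dPhi C_ge0 adm_c (adm_X (U_small k)) (freeze k).
rewrite stress_X // in h1.
have h2 := eq_uh k 0; have h3 := eq_u k 0; have h4 := gb_g k.
rewrite (_ : _ - _ - _ = (gb k - g k) + (stress rmax dPhi (diffq e 1 (corrected N chi uh)) k - dPhi0 (U k))).
  by apply: (le_trans (ler_normD _ _)); apply: lerD.
by lra.
Qed.

End CorrectionError.

(** * Choice of the constant and the radii, and assembly of the estimate *)

Theorem theorem2p3 (R : realType) (p rmax : nat)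
    (p_gt0 : (0 < p)%N) (rmax_gt0 : (0 < rmax)%N) :
  exists Const : R -> R -> R,
  forall (Phi : nat -> int -> R -> R) (chi_star : int -> R)
         (rho_Phi rho_z rho_chi : R) (chi : R -> int -> R),
    periodic_potentials p rmax Phi ->
    zero_mean p chi_star ->
    0 < rho_Phi ->
    increasing_positions chi_star ->
    regular_potentials rmax Phi chi_star rho_Phi ->
    equilibrium p rmax Phi chi_star ->
    stable p rmax Phi chi_star ->
    homogenization_map p rmax Phi chi_star rho_Phi rho_z rho_chi chi ->
  exists rho_f rho_u : R, [/\ 0 < rho_f, 0 < rho_u &
  forall (N : nat) (c0 : R),
    (0 < N)%N -> (p %| N)%N ->
    coercivity_constant p rmax N Phi chi_star chi c0 ->
  forall (nodes : set int) (h f : int -> R),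
    is_mesh N nodes -> is_mesh_size N nodes h ->
    zero_mean N f -> seminorm_m1_oo N N%:R^-1 f < rho_f ->
  exists uh0 u : int -> R,
    [/\ unique (fun w : int -> R =>
          coarse_solution p rmax N Phi chi nodes f w /\
          seminorm_1_oo N N%:R^-1 w < rho_u) uh0,
        unique (fun w : int -> R =>
          atomistic_solution rmax N Phi f w /\
          seminorm_1_oo N N%:R^-1
            (fun i => w i - scaled_chi_star N chi_star i) < rho_u) u &
        seminorm_1_oo N N%:R^-1 (fun i => corrected N chi uh0 i - u i)
          <= Const c0 (C_Phi_11 p rmax Phi chi_star rho_Phi)
             * norm_oo N (fun i => h i * f i)]].
Proof.
(* Coercivity gives [c0^-1], the averaging of the load gives 1, and [3 / c0] bounds the strain jumps
   of the coarse solution; the rest is the freezing error with the corrector constant [L0] at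
   coercivity [c0]. *)
exists (fun c0 C => let L0 := rmax%:R * C / c0 in
  c0^-1 * (1 + rmax%:R * (C * (3 / c0 * (p%:R * L0 + (1 + L0) * rmax%:R))))).
have rearrange (k1 k2 q x y : R) : x + k1 * (k2 * (q * x * y)) = (1 + k1 * (k2 * (q * y))) * x.
  by ring.
move=> Phi chi_star rho_Phi rho_z rho_chi chi pP zs rP0 _ reg equil stab hom.
have [K [c [rho [m [m' [M [M' [[K0 c_gt0 rho0 rho_le Kc] sd monoN mc mlc]]]]]]]] :=
  local_constants p_gt0 rmax_gt0 pP zs rP0 reg stab.
have [mono_p mono_lin_p] := monoN p (dvdnn p).
have [rho1 [r10 r1s] [zmX nX sX dX [lipX [K1 K10 strictX]]]] :=
  homogenized_potential p_gt0 rmax_gt0 pP zs rP0 reg equil hom K0 c_gt0 rho0 rho_le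
    sd mono_p mono_lin_p mc mlc.
set dPhi := fun r y => derive1 (Phi r y) in sd monoN mono_p sX lipX *.
set Fs := diffq 1 1 chi_star in sd monoN mono_p nX lipX *.
set dom := fun (r : nat) (y : int) (s : R) => `|s - amean r Fs y| < rho in monoN mono_p lipX *.
set C := C_Phi_11 p rmax Phi chi_star rho_Phi in r1s nX lipX *.
set A := derive1n 2 (Phi0 p rmax Phi chi) 0 in strictX *.
set dPhi0 := derive1 (Phi0 p rmax Phi chi) in sX dX strictX *.
have sd_rho r y s s' : (1 <= r <= rmax)%N -> dom r y s -> dom r y s' ->
    `|dPhi r y s - dPhi r y s' - derive1n 2 (Phi r y) (diffq 1 r chi_star y) * (s - s')|
    <= K * rho * `|s - s'| by exact: sd.
(* If [A <= 0], no coercivity constant exists and any radii will do. *)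
have [A0|A0] := leP A 0.
  exists 1, 1; split => // N c0 N0 pN [c0p _ _ _ hA].
  by exfalso; move: hA; rewrite -/A; lra.
have [C0 lipC] := derivative_lipschitz p_gt0 rP0 pP zs reg.
rewrite -/C in C0.
set L := rmax%:R * C / c in r1s nX.
have L0 : 0 <= L by rewrite divr_ge0 ?mulr_ge0 // ltW.
have p1 : 0 <= p%:R :> R by [].
have [d1 [rho_u [rho_f [[ru0 rf0 ru_d1 d1r] [rurho Kd1] near_lt tauA tauc]]]] :=
  small_radii A0 K10 r10 rho0 c_gt0 L0 p1.
have monoS z z' : `|z| < d1 -> `|z'| < d1 ->
    A / 2 * (z - z') ^+ 2 <= (dPhi0 z - dPhi0 z') * (z - z').
  move=> hz hz'; have := strictX d1 z z' d1r hz hz'.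
  set x := z - z'; set y := _ - dPhi0 z' => H.
  have : `|(y - A * x) * x| <= A / 2 * x ^+ 2.
    rewrite normrM -[x ^+ 2]real_normK ?num_real // expr2 mulrA; apply: ler_wpM2r => //.
    by apply: (le_trans H); apply: ler_wpM2r.
  by rewrite ler_norml => /andP[+ _]; rewrite !expr2; lra.
have rho1_lt : (1 + L) * rho1 < rho.
  by apply: lt_le_trans r1s; rewrite ltr_pM2r // ltrD2r ltr1n.
have ru_r1 : rho_u < rho1 by exact: lt_le_trans d1r.
have A20 : 0 < A / 2 by rewrite divr_gt0.
exists rho_f, rho_u; split => // N c0 N0 pN [c0p cell_c lat_c _ hA] nodes h f mesh size zf hf.
rewrite -/A in hA.
have A2c0 : c0 <= A / 2 by rewrite ler_pdivlMr // mulrC.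
have Nn : N%:R != 0 :> R by rewrite pnatr_eq0 -lt0n.
set e : R := N%:R^-1 in lat_c hf *.
have en : e != 0 by rewrite invr_eq0.
have iN0 : 0 <= e by rewrite invr_ge0.
have [g pg gE] := load_exists N0 zf.
have oscg := norm_load_osc N0 zf pg gE (ltW rf0) (ltW hf).
set eta := norm_oo N (fun i => h i * f i).
have ph : periodic N h by exact: periodic_mesh_size N0 mesh size.
have pf : periodic N f by case: zf.
have eta_bound i : `|h i * f i| <= eta.
  by apply: (@ge_norm_oo R N (fun i => h i * f i)) => // k; rewrite ph pf.
have [gb [pgb sgb gbg oscgb testgb]] := element_average N0 mesh size pg eta_bound gE.
have jump := load_jump N0 mesh size eta_bound gE.
have z0 : `|0 : R| < rho1 by rewrite normr0.
have F0 : cell_strain chi 0 = Fs.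
  apply/funext => i; apply/eqP; rewrite -subr_eq0 -normr_le0.
  by have := nX 0 z0 i; rewrite normr0 mulr0.
have stF i j : stress rmax dPhi Fs i = stress rmax dPhi Fs j by rewrite -F0 !sX.
have ps : periodic N chi_star by apply: periodic_dvd pN _; case: zs.
have domball r i s : (1 <= r <= rmax)%N -> dom r i s -> ball (diffq 1 r chi_star i) rho_Phi s.
  move=> /andP[r0 _]; rewrite /dom -diffq_amean // /ball /= distrC => H.
  exact: lt_le_trans rho_le.
have dP r i s : (1 <= r <= rmax)%N -> dom r i s -> is_derive s 1 (Phi r i) (dPhi r i s).
  by move=> hr hs; exact: (potential_derive reg hr (domball r i s hr hs)).
have lip r y s s' : (1 <= r <= rmax)%N -> dom r y s -> dom r y s' ->
    `|dPhi r y s - dPhi r y s'| <= C * `|s - s'|.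
  by move=> hr hs hs'; exact: (lipC r y s s' hr (domball r y s hr hs) (domball r y s' hr hs')).
have PN := periodic_potentials_dvd pN pP.
have [uh [uniq_h U_lt eq_h]] := coarse_problem N0 zf pg gE A20 ru0 tauA pgb sgb
  (oscgb _ oscg) testgb (fun z hz => dX z (le_lt_trans hz ru_r1))
  (fun z z' hz hz' => monoS z z' (le_lt_trans hz ru_d1) (le_lt_trans hz' ru_d1)).
have [u [uniq_u near_u eq_u]] := atomistic_problem N0 zf pg gE rmax_gt0 ru0 rurho c_gt0 tauc
  ps PN dP (monoN N pN).1 mc stF oscg.
exists uh, u; split => //.
have puh : periodic N uh by have [[[[[]]]]] := uniq_h.
have pu : periodic N u by have [[[[]]]] := uniq_u.
have coer n (e' : R) F : (0 < n)%N -> (p %| n)%N -> e' != 0 ->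
    (forall r i, (1 <= r <= rmax)%N -> F r i = diffq 1 r chi_star i) ->
    ((2 * c0)%:E <= inf_sup n e' (hessian_form rmax n e' Phi F))%E ->
    coercive n rmax dPhi dom c0.
  move=> n0 pn en' FE his; have [mn _] := monoN n pn.
  apply: (@coercive_of_inf_sup R n rmax e' Phi chi_star F dPhi dom (K * rho) c c0
    n0 en' c0p FE _ _ _ Kc _ his).
  - move=> r i hr; rewrite (periodic_potentials_dvd pn pP i hr); congr (_ _).
    exact: (periodic_diffq 1 r (periodic_dvd pn zs.1) i).
  - exact: sd_rho.
  - by rewrite mulr_ge0 // ltW.
  - by move=> G H mu nu aG aH pG pH; exact: monotone_coercive mn mc c_gt0 aG aH pG pH.
have coer_p := coer p 1 _ p_gt0 (dvdnn p) (oner_neq0 _) (fun _ _ _ => erefl) cell_c.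
have coer_N : coercive N rmax dPhi dom c0.
  apply: (coer N e _ N0 pN en _ lat_c) => r i /andP[r0 _].
  by rewrite !diffq_amean //; apply: amean_ext => k; exact: scaled_strain.
have lip_chi c1 : 0 < c1 -> coercive p rmax dPhi dom c1 -> forall (z z' : R) i,
    `|z| < rho1 -> `|z'| < rho1 ->
    `|diffq 1 1 (chi z) i - diffq 1 1 (chi z') i| <= rmax%:R * C / c1 * `|z - z'|.
  move=> c10 hc z z' i hz hz'; have := lipX c1 z z' i hc hz hz'.
  by rewrite -ler_pdivlMl // mulrA [c1^-1 * _]mulrC.
have coer_c : coercive p rmax dPhi dom c.
  by move=> G H mu nu aG aH pG pH; exact: monotone_coercive mono_p mc c_gt0 aG aH pG pH.
have U_lt1 i : `|diffq e 1 uh i| < rho1 by exact: lt_trans ru_r1.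
(* The 3 counts two averaging errors and one jump of the load; [c0 <= A / 2] converts stress jumps
   into strain jumps. *)
have U_jump i : `|diffq e 1 uh (i + 1) - diffq e 1 uh i| <= 3 / c0 * eta.
  rewrite mulrAC ler_pdivlMr // mulrC.
  apply: (le_trans (quadratic_expansive A2c0 (monoS _ _ (lt_trans (U_lt _) ru_d1)
    (lt_trans (U_lt _) ru_d1)))).
  rewrite eq_h (_ : _ - _ = (gb (i + 1) - g (i + 1)) + ((g (i + 1) - g i) - (gb i - g i)));
    last by ring.
  apply: (le_trans (ler_normD _ _)).
  rewrite (_ : 3 * eta = eta + (eta + eta)); last by ring.
  apply: lerD; first exact: gbg.
  by apply: (le_trans (ler_normB _ _)); apply: lerD; [exact: jump | exact: gbg].
have adm_X z : `|z| < rho1 -> admissible rmax dom (cell_strain chi z).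
  move=> hz; apply: (near_admissible (nX z hz)).
  apply: le_lt_trans rho1_lt; apply: ler_wpM2l; last exact: ltW.
  by rewrite addr_ge0.
have adm_u : admissible rmax dom (diffq e 1 u).
  by apply: (near_admissible (zeta := rho_u)) => // i; exact: ltW (near_u i).
(* [rho_u] was fixed with [c], so admissibility needs the corrector bound at [c]; the error bound
   below takes the one at [c0]. *)
have adm_c : admissible rmax dom (diffq e 1 (corrected N chi uh)).
  apply: (near_admissible _ near_lt) => i.
  exact: (corrected_near p_gt0 N0 L0 zmX (lip_chi c c_gt0 coer_c) U_lt1 nX (fun i => ltW (U_lt i))).
have L00 : 0 <= rmax%:R * C / c0 by rewrite divr_ge0 ?mulr_ge0 // ltW.
have err i := correction_error p_gt0 N0 pN C0 L00 puh pu zmX (lip_chi c0 c0p coer_p) U_lt1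
  lip adm_X adm_c adm_u sX U_jump eq_h eq_u gbg coer_N i.
have eta0 : 0 <= eta by exact: norm_oo_ge0.
apply: norm_oo_le => [|i].
  rewrite mulr_ge0 // mulr_ge0 ?invr_ge0 ?(ltW c0p) //.
  rewrite addr_ge0 // mulr_ge0 // mulr_ge0 // mulr_ge0 ?divr_ge0 ?(ltW c0p) //.
  by rewrite addr_ge0 // mulr_ge0 // addr_ge0.
rewrite diffqB -/e -(ler_pM2l c0p); apply: (le_trans (err i)).
rewrite /= -[c0^-1 * _ * _]mulrA mulVKf ?gt_eqF //.
by rewrite rearrange.
Qed.
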